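(* Let $R$ be a commutative noetherian ring and $C$ a semidualizing $R$-module. Assume that $x,y\in R$ form a pair of exact zero-divisors on both $R$ and $C$. Let $M$ be an $R$-module such that $xM\neq0$ and $xM\neq M$. Set $\overline{(-)}=(-)\otimes_RR/xR$. The following statements hold true. (i) If $\mathcal P_C\text{-}\operatorname{pd}(M)<\infty$, then $\mathcal P_{\overline C}\text{-}\operatorname{pd}(\overline M)\le\mathcal P_C\text{-}\operatorname{pd}(M)$. (ii) If $\mathcal F_C\text{-}\operatorname{pd}(M)<\infty$, then $\mathcal F_{\overline C}\text{-}\operatorname{pd}(\overline M)\le\mathcal F_C\text{-}\operatorname{pd}(M)$. (iii) If $M$ is finite with $\mathcal I_C\text{-}\operatorname{id}(M)<\infty$, then $\mathcal I_{\overline C}\text{-}\operatorname{id}(\overline M)\le\mathcal I_C\text{-}\operatorname{id}(M)$. (iv) If $R$ is local and $M$ is finite, then equality holds in (i), (ii) and (iii) (each under the finiteness hypothesis stated there). Here the dimensions of $\overline M$ are taken over the ring $\overline R=R/xR$ with respect to the $\overline R$-module $\overline C=C/xC$.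
   Context: Rings are commutative noetherian with identity; ''finite'' module means finitely generated module. A finite $R$-module $C$ is semidualizing if the natural homothety map $R\to\operatorname{Hom}_R(C,C)$ is an isomorphism and $\operatorname{Ext}^i_R(C,C)=0$ for all $i>0$. For an $R$-module $M$ and $x,y\in R$, one says that $x,y$ form a pair of exact zero-divisors on $M$ if $xM\neq 0$, $xM\neq M$ and the sequence of multiplication maps $M\xrightarrow{x}M\xrightarrow{y}M\xrightarrow{x}M$ is exact. The following definitions are for a ring $A$, a finite $A$-module $B$ and an $A$-module $N$; they are applied with $(A,B,N)=(R,C,M)$ and $(R/xR,C/xC,M/xM)$. An augmented proper $\mathcal P_B$-projective resolution of $N$ is a complex $X^+=\cdots\to B\otimes_AP_1\to B\otimes_AP_0\to N\to0$ with all $P_i$ projective $A$-modules such that $\operatorname{Hom}_A(B\otimes_AQ,X^+)$ is exact for every projective $A$-module $Q$ ($X^+$ itself need not be exact); the truncated complex $X=\cdots\to B\otimes_AP_1\to B\otimes_AP_0\to0$ is a proper $\mathcal P_B$-projective resolution of $N$. Put $\mathcal P_B\text{-}\operatorname{pd}(N)=\inf\{\sup X\mid X\text{ a proper }\mathcal P_B\text{-projective resolution of }N\}$, where $\sup X=\sup\{n\mid X_n\ne0\}$, and $\mathcal P_B\text{-}\operatorname{pd}(0)=-\infty$. $\mathcal F_B\text{-}\operatorname{pd}(N)$ is defined in the same way with flat modules in place of projective modules. Dually, an augmented proper $\mathcal I_B$-injective resolution of $N$ is a complex $Y^+=0\to N\to\operatorname{Hom}_A(B,I^0)\to\operatorname{Hom}_A(B,I^1)\to\cdots$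 with all $I^i$ injective such that $\operatorname{Hom}_A(Y^+,\operatorname{Hom}_A(B,I))$ is exact for every injective $A$-module $I$, and $\mathcal I_B\text{-}\operatorname{id}(N)$ is the infimum, over all such, of $\sup\{n\mid\operatorname{Hom}_A(B,I^n)\neq0\}$. *)

(* Defs.v *)
From HB Require Import structures.
From mathcomp Require Import all_boot all_order ssralg ssrnum ssrint.
From mathcomp Require Import ring_quotient.
From mathcomp Require Import boolp classical_sets functions constructive_ereal.

Set Implicit Arguments.
Unset Strict Implicit.
Unset Printing Implicit Defensive.

Import Order.TTheory GRing.Theory.
Local Open Scope ring_scope.
Local Open Scope quotient_scope.
Local Open Scope classical_set_scope.

(* Rings are `comPzRingType`, so that the quotient R/xR is a ring without any
   side condition on x. *)

Section Finiteness.
Variables (A : comPzRingType) (M : lmodType A).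

Definition submodule (N : set M) : Prop :=
  N 0 /\ forall (a : A) (u v : M), N u -> N v -> N (a *: u + v).

Definition lspan (s : seq M) : set M :=
  [set v | exists c : nat -> A, v = \sum_(i < size s) c i *: s`_i].

Definition finite_module : Prop := exists s : seq M, lspan s = [set: M].

End Finiteness.

Definition noetherian (A : comPzRingType) : Prop :=
  forall I : set A^o, submodule I -> exists s : seq A^o, I = lspan s.

Definition maximal_ideal (A : comPzRingType) (m : set A^o) : Prop :=
  [/\ submodule m, m <> [set: A^o] &
      forall I : set A^o, submodule I -> m `<=` I -> I = m \/ I = [set: A^o]].

Definition local_ring (A : comPzRingType) : Prop :=
  exists! m : set A^o, maximal_ideal m.

Definition exact_seq (U V W : zmodType) (f : U -> V) (g : V -> W) : Prop :=
  range f = [set v | g v = 0].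

Definition surjective (U V : Type) (f : U -> V) : Prop := range f = [set: V].

Definition exact_augmented (X : nat -> zmodType) (N : zmodType)
    (d : forall n, X n.+1 -> X n) (e : X 0 -> N) : Prop :=
  [/\ surjective e, exact_seq (d 0) e & forall n, exact_seq (d n.+1) (d n)].

Section Hom.
Variables (A : comPzRingType) (U V : lmodType A).

Definition lhom : Type := {linear U -> V}.
Definition lhom_fun (f : lhom) : U -> V := f.

HB.instance Definition _ := gen_eqMixin lhom.
HB.instance Definition _ := gen_choiceMixin lhom.

Lemma lhomP (f g : lhom) : lhom_fun f =1 lhom_fun g -> f = g.
Proof.
case: f g => [f cf] [g cg] /= /funext; rewrite /lhom_fun /= => fg.
rewrite fg in cf *; congr GRing.Linear.Pack.
case: cf cg => [[a] [b]] [[c] [d]].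
by rewrite (Prop_irrelevance a c) (Prop_irrelevance b d).
Qed.

Definition lhom_zero : lhom := (\0 : {linear U -> V}).
Definition lhom_opp (f : lhom) : lhom := (\- (f : {linear U -> V})).
Definition lhom_add (f g : lhom) : lhom :=
  ((f : {linear U -> V}) \+ (g : {linear U -> V})).
Definition lhom_scale (a : A) (f : lhom) : lhom :=
  (a \*: (f : {linear U -> V})).

Fact lhom_addA : associative lhom_add.
Proof. by move=> f g h; apply: lhomP => u; exact: addrA. Qed.
Fact lhom_addC : commutative lhom_add.
Proof. by move=> f g; apply: lhomP => u; exact: addrC. Qed.
Fact lhom_add0 : left_id lhom_zero lhom_add.
Proof. by move=> f; apply: lhomP => u; exact: add0r. Qed.
Fact lhom_addN : left_inverse lhom_zero lhom_opp lhom_add.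
Proof. by move=> f; apply: lhomP => u; exact: addNr. Qed.

HB.instance Definition _ :=
  GRing.isZmodule.Build lhom lhom_addA lhom_addC lhom_add0 lhom_addN.

Fact lhom_scaleA a b f : lhom_scale a (lhom_scale b f) = lhom_scale (a * b) f.
Proof. by apply: lhomP => u; exact: scalerA. Qed.
Fact lhom_scale1 : left_id 1 lhom_scale.
Proof. by move=> f; apply: lhomP => u; exact: scale1r. Qed.
Fact lhom_scaleDr : right_distributive lhom_scale +%R.
Proof. by move=> a f g; apply: lhomP => u; exact: scalerDr. Qed.
Fact lhom_scaleDl f : {morph lhom_scale^~ f : a b / a + b}.
Proof. by move=> a b; apply: lhomP => u; exact: scalerDl. Qed.

HB.instance Definition _ := GRing.Zmodule_isLmodule.Build A lhom
  lhom_scaleA lhom_scale1 lhom_scaleDr lhom_scaleDl.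

End Hom.

Section HomFunctors.
Variables (A : comPzRingType) (T U V : lmodType A).

Definition postcomp (f : {linear U -> V}) (g : lhom T U) : lhom T V :=
  (f \o (g : {linear T -> U})).

Definition precomp (f : {linear U -> V}) (g : lhom V T) : lhom U T :=
  ((g : {linear V -> T}) \o f).

End HomFunctors.

(* M ⊗ N is the quotient of the formal sums of pairs (m, n), encoded as
   sequences, by the equality of their values under every bilinear map out of
   M x N; `tens_liftE` and `tens_lift_unique` state the universal property. *)
Section Tensor.
Variable A : comPzRingType.

Definition bilin (M N W : lmodType A) (f : M -> N -> W) : Prop :=
  (forall n, linear (f ^~ n)) /\ (forall m, linear (f m)).

Variables M N : lmodType A.

Definition formal_eval (W : lmodType A) (f : M -> N -> W) (s : seq (M * N)) : W :=
  \sum_(p <- s) f p.1 p.2.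

Definition tens_equiv (s t : seq (M * N)) : bool :=
  `[< forall (W : lmodType A) (f : M -> N -> W), bilin f ->
        formal_eval f s = formal_eval f t >].

Fact tens_equiv_class : equiv_class_of tens_equiv.
Proof.
split=> [s|s t|t s u].
- by apply/asboolP.
- by apply/asboolP/asboolP => st W f /st.
- by move=> /asboolP st /asboolP tu; apply/asboolP => W f fb; rewrite st ?tu.
Qed.

Canonical tens_equiv_rel := EquivRelPack tens_equiv_class.

Definition tens : Type := {eq_quot tens_equiv}.

HB.instance Definition _ := EqQuotient.on tens.
HB.instance Definition _ := Choice.on tens.

Lemma tens_eqP (s t : seq (M * N)) :
  (forall (W : lmodType A) (f : M -> N -> W), bilin f ->
     formal_eval f s = formal_eval f t) ->
  \pi_tens s = \pi_tens t.
Proof. by move=> st; apply/eqmodP/asboolP. Qed.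

Lemma formal_eval_repr (W : lmodType A) (f : M -> N -> W) s :
  bilin f -> formal_eval f (repr (\pi_tens s)) = formal_eval f s.
Proof.
have /eqmodP /asboolP h : repr (\pi_tens s) = s %[mod tens] by rewrite reprK.
exact: h.
Qed.

Definition formal_scale (a : A) (s : seq (M * N)) : seq (M * N) :=
  [seq (a *: p.1, p.2) | p <- s].

Lemma formal_eval_cat (W : lmodType A) (f : M -> N -> W) s t :
  formal_eval f (s ++ t) = formal_eval f s + formal_eval f t.
Proof. by rewrite /formal_eval big_cat. Qed.

Lemma bilinZl (W : lmodType A) (f : M -> N -> W) a m n :
  bilin f -> f (a *: m) n = a *: f m n.
Proof. by case=> /(_ n) /scalable_linear h _; exact: h. Qed.

Lemma formal_eval_scale (W : lmodType A) (f : M -> N -> W) a s :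
  bilin f -> formal_eval f (formal_scale a s) = a *: formal_eval f s.
Proof.
move=> fb; rewrite /formal_eval big_map scaler_sumr.
by apply: eq_bigr => p _; rewrite bilinZl.
Qed.

Definition tens_zero : tens := \pi_tens [::].
Definition tens_add (t u : tens) : tens := \pi_tens (repr t ++ repr u).
Definition tens_scale (a : A) (t : tens) : tens :=
  \pi_tens (formal_scale a (repr t)).
Definition tens_opp (t : tens) : tens := tens_scale (-1) t.

Ltac tens_tac :=
  rewrite ?(formal_eval_cat, formal_eval_repr, formal_eval_scale) //.

Fact tens_addA : associative tens_add.
Proof. by move=> t u v; apply: tens_eqP => W f fb; tens_tac; rewrite addrA. Qed.
Fact tens_addC : commutative tens_add.
Proof. by move=> t u; apply: tens_eqP => W f fb; tens_tac; rewrite addrC. Qed.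
Fact tens_add0 : left_id tens_zero tens_add.
Proof.
move=> t; rewrite -[RHS]reprK; apply: tens_eqP => W f fb; tens_tac.
by rewrite /formal_eval big_nil add0r.
Qed.
Fact tens_addN : left_inverse tens_zero tens_opp tens_add.
Proof.
move=> t; apply: tens_eqP => W f fb; tens_tac.
by rewrite scaleN1r addNr /formal_eval big_nil.
Qed.

HB.instance Definition _ :=
  GRing.isZmodule.Build tens tens_addA tens_addC tens_add0 tens_addN.

Fact tens_scaleA a b t : tens_scale a (tens_scale b t) = tens_scale (a * b) t.
Proof. by apply: tens_eqP => W f fb; tens_tac; rewrite scalerA. Qed.
Fact tens_scale1 : left_id 1 tens_scale.
Proof.
move=> t; rewrite -[RHS]reprK; apply: tens_eqP => W f fb; tens_tac.
by rewrite scale1r.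
Qed.
Fact tens_scaleDr : right_distributive tens_scale +%R.
Proof. by move=> a t u; apply: tens_eqP => W f fb; tens_tac; rewrite scalerDr. Qed.
Fact tens_scaleDl t : {morph tens_scale^~ t : a b / a + b}.
Proof. by move=> a b; apply: tens_eqP => W f fb; tens_tac; rewrite scalerDl. Qed.

HB.instance Definition _ := GRing.Zmodule_isLmodule.Build A tens
  tens_scaleA tens_scale1 tens_scaleDr tens_scaleDl.

Definition pure (m : M) (n : N) : tens := \pi_tens [:: (m, n)].

Lemma pure_bilin : bilin pure.
Proof.
split=> [n|m] a u v; apply: tens_eqP => W f fb; tens_tac;
  rewrite /formal_eval !big_seq1 /=; case: fb => fl fr.
- exact: (fl n a u v).
- exact: (fr m a u v).
Qed.

Definition tens_lift (W : lmodType A) (f : M -> N -> W) (t : tens) : W :=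
  formal_eval f (repr t).

Lemma tens_lift_linear (W : lmodType A) (f : M -> N -> W) :
  bilin f -> linear (tens_lift f).
Proof. by move=> fb a t u; rewrite /tens_lift; tens_tac. Qed.

Lemma tens_liftE (W : lmodType A) (f : M -> N -> W) m n :
  bilin f -> tens_lift f (pure m n) = f m n.
Proof.
by move=> fb; rewrite /tens_lift; tens_tac; rewrite /formal_eval big_seq1.
Qed.

Lemma tens_sum (t : tens) : t = \sum_(p <- repr t) pure p.1 p.2.
Proof.
rewrite -[LHS]reprK; elim: (repr t) => [|[m n] s IHs]; first by rewrite big_nil.
by rewrite big_cons -IHs; apply: tens_eqP => W f fb; tens_tac;
  rewrite -formal_eval_cat.
Qed.

Lemma tens_lift_unique (W : lmodType A) (f : M -> N -> W)
    (h : {linear tens -> W}) :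
  (forall m n, h (pure m n) = f m n) -> h =1 tens_lift f.
Proof.
by move=> hf t; rewrite {1}[t]tens_sum linear_sum; apply: eq_bigr.
Qed.

End Tensor.

Definition tens_map (A : comPzRingType) (F U V : lmodType A)
    (f : {linear U -> V}) : tens F U -> tens F V :=
  tens_lift (fun (x : F) (u : U) => pure x (f u)).

Section ModuleClasses.
Variables (A : comPzRingType) (P : lmodType A).

Definition projective : Prop :=
  forall (U V : lmodType A) (f : {linear U -> V}) (g : {linear P -> V}),
    surjective f -> exists h : {linear P -> U}, f \o h =1 g.

Definition injective_module : Prop :=
  forall (U V : lmodType A) (f : {linear U -> V}) (g : {linear U -> P}),
    injective f -> exists h : {linear V -> P}, h \o f =1 g.

Definition flat : Prop :=
  forall (U V W : lmodType A) (f : {linear U -> V}) (g : {linear V -> W}),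
    exact_seq f g -> exact_seq (@tens_map A P _ _ f) (@tens_map A P _ _ g).

End ModuleClasses.

Record projective_resolution (A : comPzRingType) (M : lmodType A) :=
  ProjectiveResolution {
    res_obj : nat -> lmodType A;
    res_projective : forall n, projective (res_obj n);
    res_diff : forall n, {linear res_obj n.+1 -> res_obj n};
    res_aug : {linear res_obj 0 -> M};
    res_exact : exact_augmented (X := fun n => res_obj n) res_diff res_aug
  }.

(* Ext^i_A(M, N) = 0 for all i > 0, where Ext^i_A(M, N) = H^i(Hom_A(P, N)) for
   a projective resolution P of M; the choice of P is immaterial. *)
Definition Ext_pos_eq0 (A : comPzRingType) (M N : lmodType A) : Prop :=
  exists P : projective_resolution M, forall n,
    exact_seq (@precomp A N _ _ (res_diff P n)) (@precomp A N _ _ (res_diff P n.+1)).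

Definition homothety (A : comPzRingType) (C : lmodType A) (a : A) : lhom C C :=
  ( *:%R a : {linear C -> C}).

Definition semidualizing (A : comPzRingType) (C : lmodType A) : Prop :=
  [/\ finite_module C, bijective (@homothety A C) & Ext_pos_eq0 C C].

Definition exact_zero_divisors (A : comPzRingType) (M : lmodType A) (x y : A) : Prop :=
  [/\ range ( *:%R x : M -> M) <> [set 0],
      range ( *:%R x : M -> M) <> [set: M],
      exact_seq ( *:%R x : M -> M) ( *:%R y : M -> M) &
      exact_seq ( *:%R y : M -> M) ( *:%R x : M -> M)].

Definition complex_sup (X : nat -> zmodType) : \bar int :=
  supremum -oo%E [set (n%:Z)%:E | n in [set n | exists v : X n, v <> 0]].

(* The case K = projective gives the proper P_B-projective resolutions of N,
   the case K = flat the proper F_B-flat ones. *)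
Record proper_resolution (A : comPzRingType) (K : lmodType A -> Prop)
    (B N : lmodType A) := ProperResolution {
  prop_obj : nat -> lmodType A;
  prop_class : forall n, K (prop_obj n);
  prop_diff : forall n, {linear tens B (prop_obj n.+1) -> tens B (prop_obj n)};
  prop_aug : {linear tens B (prop_obj 0) -> N};
  prop_complex : (forall t, prop_aug (prop_diff 0 t) = 0) /\
                 (forall n t, prop_diff n (prop_diff n.+1 t) = 0);
  prop_exact : forall Q : lmodType A, K Q ->
    exact_augmented (X := fun n => lhom (tens B Q) (tens B (prop_obj n)))
      (fun n => @postcomp A (tens B Q) _ _ (prop_diff n))
      (@postcomp A (tens B Q) _ _ prop_aug)
}.

Record proper_coresolution (A : comPzRingType) (B N : lmodType A) :=
  ProperCoresolution {
    cop_obj : nat -> lmodType A;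
    cop_injective : forall n, injective_module (cop_obj n);
    cop_diff : forall n, {linear lhom B (cop_obj n) -> lhom B (cop_obj n.+1)};
    cop_aug : {linear N -> lhom B (cop_obj 0)};
    cop_complex : (forall v, cop_diff 0 (cop_aug v) = 0) /\
                  (forall n f, cop_diff n.+1 (cop_diff n f) = 0);
    cop_exact : forall J : lmodType A, injective_module J ->
      exact_augmented (X := fun n => lhom (lhom B (cop_obj n)) (lhom B J))
        (fun n => @precomp A (lhom B J) _ _ (cop_diff n))
        (@precomp A (lhom B J) _ _ cop_aug)
  }.

(* Every subset of \bar int has a supremum and an infimum, so `supremum` and
   `infimum` fall back on their first argument for the empty set only; a module
   without resolutions has dimension +oo, and the zero complex, which resolves
   the zero module, gives the latter dimension -oo. *)
Section Dimensions.
Variables (A : comPzRingType) (B N : lmodType A).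

Definition relative_pd (K : lmodType A -> Prop) : \bar int :=
  infimum +oo%E [set s | exists X : proper_resolution K B N,
                   s = complex_sup (fun n => tens B (prop_obj X n))].

Definition P_pd : \bar int := relative_pd (@projective A).

Definition F_pd : \bar int := relative_pd (@flat A).

Definition I_id : \bar int :=
  infimum +oo%E [set s | exists Y : proper_coresolution B N,
                   s = complex_sup (fun n => lhom B (cop_obj Y n))].

End Dimensions.

Section Reduction.
Variables (R : comPzRingType) (x : R).

Section QuotientModule.
Variable M : lmodType R.

Definition multiples : {pred M} := [pred m | `[< range ( *:%R x : M -> M) m >]].

Lemma multiplesP m : reflect (exists n : M, x *: n = m) (m \in multiples).
Proof.
by apply: (iffP idP) => [/asboolP[n _ <-]|[n <-]]; [exists n|apply/asboolP; exists n].
Qed.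

Fact multiples_zmod_closed : zmod_closed multiples.
Proof.
split=> [|_ _ /multiplesP[m <-] /multiplesP[n <-]]; apply/multiplesP.
  by exists 0; rewrite scaler0.
by exists (m - n); rewrite scalerBr.
Qed.

HB.instance Definition _ :=
  GRing.isZmodClosed.Build M multiples multiples_zmod_closed.

Definition quo_mod : Type := Quotient.quot multiples.

HB.instance Definition _ := GRing.Zmodule.on quo_mod.
HB.instance Definition _ := EqQuotient.on quo_mod.

Lemma quo_mod_eqP (m n : M) :
  (m - n \in multiples) <-> \pi_quo_mod m = \pi_quo_mod n.
Proof.
by split=> [h|/eqP]; [apply/eqP|]; rewrite -Quotient.idealrBE.
Qed.

Lemma quo_mod_piD m n : \pi_quo_mod (m + n) = \pi_quo_mod m + \pi_quo_mod n.
Proof. exact: Quotient.pi_add. Qed.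

End QuotientModule.

Arguments multiples M m : clear implicits.

(* R/xR has the same elements as `quo_mod R^o`; the separate name carries its ring
   structure, over which every M/xM is a module. *)
Definition quo_ring : Type := Quotient.quot (multiples R^o).

HB.instance Definition _ := GRing.Zmodule.on quo_ring.
HB.instance Definition _ := EqQuotient.on quo_ring.

Lemma quo_ring_eqP (a b : R) :
  (exists c, x * c = a - b) <-> \pi_quo_ring a = \pi_quo_ring b.
Proof.
by rewrite -(quo_mod_eqP (M := R^o)); split=> /(@multiplesP R^o).
Qed.

Lemma quo_ring_piD (a b : R) :
  \pi_quo_ring (a + b) = \pi_quo_ring a + \pi_quo_ring b.
Proof. exact: Quotient.pi_add. Qed.

Definition quo_one : quo_ring := \pi_quo_ring 1.
Definition quo_mul (a b : quo_ring) : quo_ring := \pi_quo_ring (repr a * repr b).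

Lemma quo_mulE (a b : R) :
  quo_mul (\pi_quo_ring a) (\pi_quo_ring b) = \pi_quo_ring (a * b).
Proof.
have [c ca] : exists c, x * c = repr (\pi_quo_ring a) - a.
  by apply/quo_ring_eqP; rewrite reprK.
have [d db] : exists d, x * d = repr (\pi_quo_ring b) - b.
  by apply/quo_ring_eqP; rewrite reprK.
apply/quo_ring_eqP; exists (c * repr (\pi_quo_ring b) + a * d).
by rewrite mulrDr mulrA ca mulrCA db mulrBl mulrBr addrA addrNK.
Qed.

Fact quo_mulA : associative quo_mul.
Proof.
move=> a b c; rewrite -[a]reprK -[b]reprK -[c]reprK.
move: (repr a) (repr b) (repr c) => {}a {}b {}c.
by rewrite (quo_mulE b c) (quo_mulE a b) (quo_mulE a) (quo_mulE _ c) mulrA.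
Qed.
Fact quo_mulC : commutative quo_mul.
Proof. by move=> a b; rewrite -[a]reprK -[b]reprK !quo_mulE mulrC. Qed.
Fact quo_mul1 : left_id quo_one quo_mul.
Proof. by move=> a; rewrite -[a]reprK quo_mulE mul1r. Qed.
Fact quo_mulDl : left_distributive quo_mul +%R.
Proof.
move=> a b c; rewrite -[a]reprK -[b]reprK -[c]reprK.
move: (repr a) (repr b) (repr c) => {}a {}b {}c.
rewrite -quo_ring_piD (quo_mulE (a + b)) (quo_mulE a) (quo_mulE b) mulrDl.
exact: quo_ring_piD.
Qed.

HB.instance Definition _ := GRing.Zmodule_isComPzRing.Build quo_ring
  quo_mulA quo_mulC quo_mul1 quo_mulDl.

Section QuotientScale.
Variable M : lmodType R.

Definition quo_scale (a : quo_ring) (m : quo_mod M) : quo_mod M :=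
  \pi_(quo_mod M) (repr a *: repr m).

Lemma quo_scaleE (a : R) (m : M) :
  quo_scale (\pi_quo_ring a) (\pi_(quo_mod M) m) = \pi_(quo_mod M) (a *: m).
Proof.
have [c ca] : exists c, x * c = repr (\pi_quo_ring a) - a.
  by apply/quo_ring_eqP; rewrite reprK.
have /multiplesP[d db] : repr (\pi_(quo_mod M) m) - m \in multiples M.
  by apply/quo_mod_eqP; rewrite reprK.
apply/quo_mod_eqP/multiplesP; exists (c *: repr (\pi_(quo_mod M) m) + a *: d).
rewrite scalerDr scalerA ca (scalerA x) mulrC -scalerA db.
by rewrite scalerBl scalerBr addrA addrNK.
Qed.

Fact quo_scaleA a b m : quo_scale a (quo_scale b m) = quo_scale (a * b) m.
Proof.
rewrite -[a]reprK -[b]reprK -[m]reprK.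
move: (repr a) (repr b) (repr m) => {}a {}b {}m.
by rewrite [_ * _](quo_mulE a b) (quo_scaleE b) !(quo_scaleE _ _) scalerA.
Qed.
Fact quo_scale1 : left_id 1 quo_scale.
Proof. by move=> m; rewrite -[m]reprK quo_scaleE scale1r. Qed.
Fact quo_scaleDr : right_distributive quo_scale +%R.
Proof.
move=> a m n; rewrite -[a]reprK -[m]reprK -[n]reprK.
move: (repr a) (repr m) (repr n) => {}a {}m {}n.
rewrite -quo_mod_piD (quo_scaleE a (m + n)) (quo_scaleE a m) (quo_scaleE a n).
by rewrite scalerDr; exact: quo_mod_piD.
Qed.
Fact quo_scaleDl m : {morph quo_scale^~ m : a b / a + b}.
Proof.
move=> a b; rewrite -[a]reprK -[b]reprK -[m]reprK.
move: (repr a) (repr b) (repr m) => {}a {}b {}m.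
rewrite -quo_ring_piD (quo_scaleE (a + b)) (quo_scaleE a) (quo_scaleE b).
by rewrite scalerDl; exact: quo_mod_piD.
Qed.

HB.instance Definition _ := GRing.Zmodule_isLmodule.Build quo_ring (quo_mod M)
  quo_scaleA quo_scale1 quo_scaleDr quo_scaleDl.

End QuotientScale.

End Reduction.

(* Main.v *)
(* Let [N = Hom(C, M)] and [T = C (x) M].  By adjunction, tensoring with [C] is
   fully faithful on flat modules and [Hom(C, -)] is fully faithful on injective
   ones, so the relative dimensions of [M] are the projective and flat dimensions
   of [N] and the injective dimension of [T].  For the flat dimension one also
   needs that a module of finite flat dimension has a resolution of the same
   length by special flat precovers; over a noetherian ring these come from the
   embedding of a flat module in its bidual, which is flat and cotorsion.
   If [N] has finite flat dimension then [C (x) N = M] (Foxby equivalence).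
   Modules of finite flat or injective dimension inherit the exactness of the
   pair [x, y] from the ring, by the two-out-of-three property, and reduction
   modulo [x] preserves short exact sequences of such modules; it also preserves
   flat, projective and injective modules and keeps [C] semidualizing.  Finite
   resolutions of [N] and [T] thus reduce to resolutions over [R/xR], which gives
   the inequalities.
   Over a local ring, an injection between finite projective modules splits if it
   splits modulo [x], by Nakayama's lemma, so the first and the second inequality
   are equalities.  For the third one, let [Z] be a cosyzygy of [T] such that
   [Z/xZ] and the next cosyzygy are injective; then [Ext^1(R/a, Z) = 0] for all
   ideals [a] by noetherian induction: if [x r] lies in [a] for some [r] outside [a] then [R/a]
   is an extension of quotients by larger ideals or ideals containing [x], and
   otherwise multiplication by [x] is onto on [Ext^1(R/a, Z)], which is finite. *)

From HB Require Import structures.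
Require Import Defs.
From mathcomp Require Import all_boot all_order ssralg ssrnum ssrint.
From mathcomp Require Import generic_quotient ring_quotient rat intdiv.
From mathcomp Require Import boolp classical_sets functions constructive_ereal.

Set Implicit Arguments.
Unset Strict Implicit.
Unset Printing Implicit Defensive.

Import Order.TTheory GRing.Theory Num.Theory.
Local Open Scope ring_scope.
Local Open Scope quotient_scope.
Local Open Scope classical_set_scope.

(** * Short exact sequences, submodules, quotients *)

Section LinearBasics.
Variable A : comPzRingType.
Implicit Types U V W : lmodType A.

Definition mklin U V (f : U -> V) (h : linear f) : {linear U -> V} :=
  HB.pack f (GRing.isLinear.Build _ _ _ _ f h).

Lemma surjP (U V : Type) (f : U -> V) : surjective f <-> forall v, exists u, f u = v.
Proof.
split=> [h v|h]; last first.
  by rewrite /surjective eqEsubset; split=> // v _; have [u <-] := h v; exists u.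
have [u _ <-] : range f v by rewrite h.
by exists u.
Qed.

Lemma exactP (U V W : zmodType) (f : U -> V) (g : V -> W) :
  exact_seq f g <-> forall v, g v = 0 <-> exists u, f u = v.
Proof.
split=> [h v|h].
  have -> : (g v = 0) = range f v by rewrite h.
  by split=> [[u _ <-]|[u <-]]; exists u.
rewrite /exact_seq eqEsubset; split=> v; first by case=> u _ <-; apply/(h (f u)); exists u.
by move=> /h[u <-]; exists u.
Qed.

Lemma lin_inj0 U V (f : {linear U -> V}) :
  (forall u : U, f u = 0 -> u = 0) <-> injective f.
Proof.
split=> [h u v fuv|h u fu]; last by apply: h; rewrite linear0.
by apply/eqP; rewrite -subr_eq0; apply/eqP/h; rewrite linearB fuv subrr.
Qed.

Lemma factor_surj U V W (p : {linear U -> V}) (f : {linear U -> W}) :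
  (forall v, exists u, p u = v) -> (forall u : U, p u = 0 -> f u = 0) ->
  exists h : {linear V -> W}, forall u, h (p u) = f u.
Proof.
move=> /choice[s sK] k.
have key u : f (s (p u)) = f u.
  by apply/eqP; rewrite -subr_eq0 -linearB; apply/eqP/k; rewrite linearB sK subrr.
have hl : linear (f \o s).
  by move=> a v w /=; rewrite -linearP -(key (_ + _)) linearP !sK.
by exists (mklin hl) => u; exact: key.
Qed.

Lemma factor_inj U V W (i : {linear U -> V}) (f : {linear W -> V}) :
  injective i -> (forall w, exists u, i u = f w) ->
  exists h : {linear W -> U}, forall w, i (h w) = f w.
Proof.
move=> ii /choice[s sK].
have hl : linear s by move=> a v w; apply: ii; rewrite linearP !sK linearP.
by exists (mklin hl).
Qed.

Definition lid U : {linear U -> U} := idfun.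

Definition ses U V W (i : {linear U -> V}) (p : {linear V -> W}) : Prop :=
  [/\ injective i, forall w, exists v, p v = w & forall v, p v = 0 <-> exists u, i u = v].

Lemma ses_comp U V W (i : {linear U -> V}) (p : {linear V -> W}) (u : U) : ses i p -> p (i u) = 0.
Proof. by case=> _ _ h; apply/h; exists u. Qed.

Record submod (M : lmodType A) := Submod { sset :> M -> Prop; sset_sub : submodule sset }.

Lemma submod0 (M : lmodType A) (N : submod M) : N 0. Proof. by case: (sset_sub N). Qed.
Lemma submodP (M : lmodType A) (N : submod M) a u v : N u -> N v -> N (a *: u + v).
Proof. by case: (sset_sub N) => _; apply. Qed.
Lemma submodD (M : lmodType A) (N : submod M) u v : N u -> N v -> N (u + v).
Proof. by move=> hu hv; rewrite -[u]scale1r; exact: submodP. Qed.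
Lemma submodZ (M : lmodType A) (N : submod M) a u : N u -> N (a *: u).
Proof. by move=> hu; rewrite -[_ *: _]addr0; apply: submodP => //; exact: submod0. Qed.
Lemma submodN (M : lmodType A) (N : submod M) u : N u -> N (- u).
Proof. by rewrite -scaleN1r; exact: submodZ. Qed.
Lemma submodB (M : lmodType A) (N : submod M) u v : N u -> N v -> N (u - v).
Proof. by move=> hu /submodN; exact: submodD. Qed.
End LinearBasics.

Section SubType.
Variables (A : comPzRingType) (M : lmodType A) (N : submod M).

Definition subpred : {pred M} := [pred m | `[< N m >]].
Fact subpred_closed : submod_closed subpred.
Proof.
by split=> [|a u v /asboolP hu /asboolP hv]; apply/asboolP;
  [exact: submod0 | exact: submodP].
Qed.
HB.instance Definition _ := GRing.isSubmodClosed.Build A M subpred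
  (GRing.submod_closed_semi subpred_closed).

Record subm := SubM { subv : M; _ : subv \in subpred }.
HB.instance Definition _ := [isSub for subv].
HB.instance Definition _ := [Choice of subm by <:].
HB.instance Definition _ := [SubChoice_isSubLmodule of subm by <:].

End SubType.

Section SubTypeTheory.
Variables (A : comPzRingType) (M : lmodType A) (N : submod M).

Fact subv_linear : linear (@subv A M N).
Proof. by move=> a u v; exact: (linearP (val : subm N -> M)). Qed.
Definition subinc : {linear subm N -> M} := mklin subv_linear.

Lemma subincP (u : subm N) : N (subinc u).
Proof. by case: u => u h; exact/asboolP. Qed.

Lemma subinc_inj : injective subinc.
Proof. exact: val_inj. Qed.

Lemma subinc_ex (m : M) : N m -> exists u, subinc u = m.
Proof.
move=> h; have h' : m \in subpred N by apply/asboolP.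
by exists (SubM h').
Qed.

Definition quom : Type := Quotient.quot (subpred N).
HB.instance Definition _ := GRing.Zmodule.on quom.
HB.instance Definition _ := EqQuotient.on quom.

Definition qpi (m : M) : quom := \pi_quom m.

Lemma qpi_eq (m n : M) : qpi m = qpi n <-> N (m - n).
Proof.
split; first by move/eqP; rewrite -Quotient.idealrBE => /asboolP.
by move=> h; apply/eqP; rewrite -Quotient.idealrBE; apply/asboolP.
Qed.

Lemma qpi_repr (q : quom) : qpi (repr q) = q.
Proof. exact: reprK. Qed.

Lemma qpi_add (m n : M) : qpi (m + n) = qpi m + qpi n.
Proof. exact: Quotient.pi_add. Qed.

Definition quom_scale (a : A) (q : quom) : quom := qpi (a *: repr q).

Lemma quom_scaleE a (m : M) : quom_scale a (qpi m) = qpi (a *: m).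
Proof.
by apply/qpi_eq; rewrite -scalerBr; apply: submodZ; apply/qpi_eq; rewrite qpi_repr.
Qed.

Fact quom_scaleA a b q : quom_scale a (quom_scale b q) = quom_scale (a * b) q.
Proof. by rewrite -[q]qpi_repr !quom_scaleE scalerA. Qed.
Fact quom_scale1 : left_id 1 quom_scale.
Proof. by move=> q; rewrite -[q]qpi_repr quom_scaleE scale1r. Qed.
Fact quom_scaleDr : right_distributive quom_scale +%R.
Proof.
move=> a u v; rewrite -[u]qpi_repr -[v]qpi_repr -qpi_add !quom_scaleE.
by rewrite scalerDr qpi_add.
Qed.
Fact quom_scaleDl q : {morph quom_scale^~ q : a b / a + b}.
Proof. by move=> a b; rewrite -[q]qpi_repr !quom_scaleE scalerDl qpi_add. Qed.

HB.instance Definition _ := GRing.Zmodule_isLmodule.Build A quom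
  quom_scaleA quom_scale1 quom_scaleDr quom_scaleDl.

Fact qpi_linear : linear qpi.
Proof. by move=> a u v; rewrite qpi_add -quom_scaleE. Qed.

Definition qproj : {linear M -> quom} := mklin qpi_linear.

Lemma qproj_surj q : exists m, qproj m = q.
Proof. by exists (repr q); exact: qpi_repr. Qed.

Lemma qproj_eq0 m : qproj m = 0 <-> N m.
Proof.
have -> : 0 = qproj 0 by rewrite linear0.
by rewrite (_ : qproj m = qpi m) // (_ : qproj 0 = qpi 0) // qpi_eq subr0.
Qed.

End SubTypeTheory.

Arguments subinc {A M} N : simpl never.
Arguments qproj {A M} N : simpl never.

Section Constructions.
Variable A : comPzRingType.
Implicit Types U V W X : lmodType A.

Fact kerP U V (f : {linear U -> V}) : submodule [set u | f u = 0].
Proof. by split=> [|a u v /= fu fv]; [exact: linear0 | rewrite /= linearP fu fv scaler0 addr0]. Qed.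
Definition kersub U V (f : {linear U -> V}) := Submod (kerP f).

Fact imP U V (f : {linear U -> V}) : submodule [set v | exists u, f u = v].
Proof.
split=> [|a _ _ [u <-] [v <-]] /=; first by exists 0; exact: linear0.
by exists (a *: u + v); exact: linearP.
Qed.
Definition imsub U V (f : {linear U -> V}) := Submod (imP f).

Lemma subm_ses V (N : submod V) : ses (subinc N) (qproj N).
Proof.
split; [exact: subinc_inj | exact: qproj_surj |] => v; rewrite qproj_eq0.
by split=> [/subinc_ex //|[u <-]]; exact: subincP.
Qed.

Lemma ker_ses V W (p : {linear V -> W}) :
  (forall w, exists v, p v = w) -> exists (U : lmodType A) (i : {linear U -> V}), ses i p.
Proof.
move=> ps; exists (subm (kersub p)), (subinc _); split=> //; first exact: subinc_inj.
by move=> v; split=> [h|[u <-]]; [apply: subinc_ex | exact: (subincP u)].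
Qed.

Lemma coker_ses U V (i : {linear U -> V}) :
  injective i -> exists (W : lmodType A) (p : {linear V -> W}), ses i p.
Proof.
move=> ii; exists (quom (imsub i)), (qproj _); split=> //; first exact: qproj_surj.
by move=> v; rewrite qproj_eq0.
Qed.

Definition lcomp U V W (g : {linear V -> W}) (f : {linear U -> V}) : {linear U -> W} :=
  g \o f.

Lemma lcompE U V W (g : {linear V -> W}) (f : {linear U -> V}) u : lcomp g f u = g (f u).
Proof. by []. Qed.

Fact linl_linear U V : linear (fun u : U => (u, 0 : V)).
Proof. by move=> a u v; congr pair; rewrite /= ?scaler0 ?addr0. Qed.
Fact linr_linear U V : linear (fun v : V => (0 : U, v)).
Proof. by move=> a u v; congr pair; rewrite /= ?scaler0 ?addr0. Qed.
Fact lfst_linear U V : linear (fun p : U * V => p.1).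
Proof. by []. Qed.
Fact lsnd_linear U V : linear (fun p : U * V => p.2).
Proof. by []. Qed.
Fact lpair_linear U V W (f : {linear W -> U}) (g : {linear W -> V}) :
  linear (fun w => (f w, g w)).
Proof. by move=> a u v; congr pair; exact: linearP. Qed.
Fact lcase_linear U V W (f : {linear U -> W}) (g : {linear V -> W}) :
  linear (fun p : U * V => f p.1 + g p.2).
Proof. by move=> a u v; rewrite !linearP /= scalerDr addrACA. Qed.

Definition linl U V : {linear U -> (U * V)%type} := mklin (@linl_linear U V).
Definition linr U V : {linear V -> (U * V)%type} := mklin (@linr_linear U V).
Definition lfst U V : {linear (U * V)%type -> U} := mklin (@lfst_linear U V).
Definition lsnd U V : {linear (U * V)%type -> V} := mklin (@lsnd_linear U V).
Definition lpair U V W (f : {linear W -> U}) (g : {linear W -> V}) :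
  {linear W -> (U * V)%type} := mklin (lpair_linear f g).
Definition lcase U V W (f : {linear U -> W}) (g : {linear V -> W}) :
  {linear (U * V)%type -> W} := mklin (lcase_linear f g).
Definition lsub U V (f g : {linear U -> V}) : {linear U -> V} := f \- g.
Definition ladd U V (f g : {linear U -> V}) : {linear U -> V} := f \+ g.
Definition lzero U V : {linear U -> V} := \0.
Definition lscale U V (a : A) (f : {linear U -> V}) : {linear U -> V} := a \*: f.

Lemma prod_ses U V : ses (linl U V) (lsnd U V).
Proof.
split=> [u v [] //|v|[u v] /=]; first by exists (0, v).
by split=> [->|[w [_ <-]] //]; exists u.
Qed.

Lemma lid_ses U (Z : lmodType A) (i : {linear Z -> U}) :
  (forall z : Z, z = 0) -> ses i (lid U).
Proof.
move=> Z0; split=> [z z' _|u|u /=]; [by rewrite [z]Z0 [z']Z0 | by exists u |].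
by split=> [->|[z <-]]; [exists 0; rewrite linear0 | rewrite [z]Z0 linear0].
Qed.

Lemma pushout U V W (i : {linear U -> V}) (f : {linear U -> W}) :
  injective i ->
  exists (Q : lmodType A) (j : {linear W -> Q}) (g : {linear V -> Q}),
  [/\ injective j, forall u, g (i u) = j (f u),
      forall q, exists v w, q = g v + j w &
      forall v w, g v = j w -> exists2 u, i u = v & f u = w].
Proof.
move=> ii; pose h := lpair i (lsub (lzero U W) f).
have [Q [p [ps pE]]] : exists (Q : lmodType A) (p : {linear (V * W)%type -> Q}),
    (forall q, exists v, p v = q) /\ forall v, p v = 0 <-> exists u, h u = v.
  by exists (quom (imsub h)), (qproj _); split=> [|v];
    [exact: qproj_surj | rewrite qproj_eq0].
have key v w : p (v, w) = 0 -> exists2 u, i u = v & f u = - w.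
  move/pE => [u] /=; rewrite /h /= => -[<- <-]; exists u => //.
  by rewrite opprB subr0.
exists Q, (lcomp p (linr V W)), (lcomp p (linl V W)); split.
- apply/lin_inj0 => w /= /key[u]; rewrite -(linear0 i) => /ii -> /eqP.
  by rewrite linear0 eq_sym oppr_eq0 => /eqP.
- move=> u; apply/eqP; rewrite -subr_eq0 /= -linearB; apply/eqP/pE.
  by exists u; rewrite /h /=; congr pair; rewrite /= ?subr0.
- move=> q; have [[v w] <-] := ps q; exists v, w.
  by rewrite /= -linearD; congr (p _); congr pair; rewrite /= ?addr0 ?add0r.
- move=> v w /= e; have [] := key v (- w); last by move=> u <-; rewrite opprK => <-; exists u.
  have -> : (v, - w) = (v, 0) - (0, w) by congr pair; rewrite /= ?subr0 ?sub0r.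
  by rewrite linearB /= e subrr.
Qed.

Lemma ses_section U V W (i : {linear U -> V}) (p : {linear V -> W}) (r : {linear V -> U}) :
  ses i p -> (forall u, r (i u) = u) ->
  exists s : {linear W -> V}, (forall w, p (s w) = w) /\ (forall v, s (p v) + i (r v) = v).
Proof.
move=> ip ri; case: (ip) => ii ps ie.
have [v /ie[u <-]|s sE] := @factor_surj _ _ _ _ p (lsub (lid V) (lcomp i r)) ps.
  by rewrite /= ri subrr.
exists s; split=> [w|v]; last by rewrite sE /= addrNK.
have [v <-] := ps w; rewrite sE /= linearB /=.
by rewrite (ses_comp _ ip) subr0.
Qed.

Lemma ses_retract U V W (i : {linear U -> V}) (p : {linear V -> W}) (s : {linear W -> V}) :
  ses i p -> (forall w, p (s w) = w) ->
  exists r : {linear V -> U}, (forall u, r (i u) = u) /\ (forall v, s (p v) + i (r v) = v).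
Proof.
move=> ip ps; case: (ip) => ii _ ie.
have [v|r rE] := @factor_inj _ _ _ _ i (lsub (lid V) (lcomp s p)) ii.
  by apply/ie; rewrite /= linearB /= ps subrr.
exists r; split=> [u|v]; last by rewrite rE /= addrC addrNK.
by apply: ii; rewrite rE /= (ses_comp _ ip) linear0 subr0.
Qed.

End Constructions.

(** * Injective modules and a cogenerator *)

Lemma Zorn_set (T : Type) (P : set T -> Prop) (S0 : set T) : P S0 ->
  (forall F : set (set T), F `<=` P -> total_on F subset -> (exists S, F S) ->
     P (\bigcup_(X in F) X)) ->
  exists S, P S /\ forall S', P S' -> S `<=` S' -> S' `<=` S.
Proof.
move=> P0 chain.
have [F FP tot|S [PS max]] := @Zorn_bigcup T (fun S => P (S0 `|` S)).
  have [[X0 FX0]|none] := pselect (exists X, F X); last first.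
    rewrite (_ : \bigcup_(X in F) X = set0) ?setU0 // -subset0 => t [X FX _].
    by apply: none; exists X.
  pose F' := [set S0 `|` X | X in F].
  have -> : S0 `|` \bigcup_(X in F) X = \bigcup_(X in F') X.
    rewrite eqEsubset; split=> t.
      case=> [S0t|[X FX Xt]]; first by exists (S0 `|` X0); [exists X0 | left].
      by exists (S0 `|` X); [exists X | right].
    by case=> _ [X FX <-] [S0t|Xt]; [left | right; exists X].
  apply: chain => [_ [X /FP PX <-] //|_ _ [X FX <-] [Y FY <-]|].
    by have [XY|YX] := tot X Y FX FY; [left | right]; apply: setUS.
  by exists (S0 `|` X0), X0.
exists (S0 `|` S); split=> // S' PS' SS'.
have SS : S `<=` S' by apply: subset_trans SS'; exact: subsetUr.
have S'E : S0 `|` S' = S' by apply/setUidPr; apply: subset_trans SS'; exact: subsetUl.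
have [S'S|nS'S] := pselect (S' `<=` S); first exact: subset_trans S'S (@subsetUr _ _ _).
by case: (max S'); [split | rewrite S'E].
Qed.

Section Baer.
Variables (A : comPzRingType) (P : lmodType A).

Definition baer : Prop := forall (I : submod A^o) (f : {linear subm I -> P}),
  exists p, forall a : subm I, f a = (subinc I a : A) *: p.

Lemma baer_injective : baer -> injective_module P.
Proof.
move=> bP U V f g fi.
pose good (S : set (V * P)%type) := [/\ submodule S, forall u, S (f u, g u) &
  forall p, S (0, p) -> p = 0].
have [|F FP tot [S0 FS0]|S [[sS gS fS] max]] := @Zorn_set (V * P)%type good
    [set v | exists u, (f u, g u) = v].
- split=> [|u|p [u [fu <-]]]; first exact: (@imP _ _ _ (lpair f g)).
    by exists u.
  have -> : u = 0 by apply: fi; rewrite fu linear0.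
  exact: linear0.
- split.
  + split; first by exists S0 => //; have [[]] := FP _ FS0.
    move=> a u v [X FX Xu] [Y FY Yv].
    have [XY|YX] := tot X Y FX FY.
      by exists Y => //; have [[_ h] _ _] := FP _ FY; apply: h => //; exact: XY.
    by exists X => //; have [[_ h] _ _] := FP _ FX; apply: h => //; exact: YX.
  + by move=> u; exists S0 => //; have [_ h _] := FP _ FS0.
  + by move=> p [X FX Xp]; have [_ _] := FP _ FX; apply.
pose N := Submod sS.
have uniq v p q : S (v, p) -> S (v, q) -> p = q.
  move=> Sp Sq; apply/eqP; rewrite -subr_eq0; apply/eqP/fS.
  have := submodB (N := N) Sp Sq.
  by rewrite (_ : (v, p) - (v, q) = (0, p - q)) //; congr pair; exact: subrr.
have total v : exists p, S (v, p).
  have sI : submodule ([set a | exists p, S (a *: v, p)] : set A^o).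
    split=> [|a b c [p Sp] [q Sq]]; first by exists 0; rewrite scale0r; exact: (submod0 N).
    exists (a *: p + q); rewrite scalerDl -scalerA.
    exact: (submodP (N := N) a Sp Sq).
  pose I := Submod sI; have /choice[h hE] : forall a : subm I, exists p, S ((subinc I a : A) *: v, p).
    by move=> a; exact: (subincP a).
  have hl : linear h.
    move=> a b c; have := submodP (N := N) a (hE b) (hE c); apply: uniq.
    have := hE (a *: b + c); congr (S (_, _)).
    by rewrite linearP /= scalerA -scalerDl.
  have [p0 p0E] := bP I (mklin hl).
  pose S' : set (V * P)%type := [set w | exists s a, S s /\ w = s + a *: (v, p0)].
  suff gS' : good S'.
    exists p0; apply: (max S' gS'); first by move=> s Ss; exists s, 0; rewrite scale0r addr0.
    by exists 0, 1; split; [exact: (submod0 N) | rewrite scale1r add0r].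
  split.
  - split; first by exists 0, 0; split; [exact: (submod0 N) | rewrite scale0r addr0].
    move=> a _ _ [s [b [Ss ->]]] [t [c [St ->]]].
    exists (a *: s + t), (a * b + c); split; first exact: (submodP (N := N)).
    by rewrite scalerDr scalerDl scalerA addrACA.
  - by move=> u; exists (f u, g u), 0; rewrite scale0r addr0.
  - move=> p [[s1 s2] [a [Ss [s1E ->]]]].
    have s1E' : (- a) *: v = s1 by apply/eqP; rewrite scaleNr eq_sym -addr_eq0 -s1E.
    have [|b bE] := @subinc_ex _ _ I (- a); first by exists s2; rewrite /= s1E'.
    have s2E : s2 = - (a *: p0).
      by rewrite -scaleNr -bE -p0E; apply: uniq Ss _; rewrite -s1E' -bE.
    by rewrite s2E addNr.
have /choice[h hE] := total.
have hl : linear h.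
  by move=> a v w; apply: (uniq (a *: v + w)) => //; exact: (submodP (N := N) a (hE v) (hE w)).
by exists (mklin hl) => u /=; apply: uniq (hE _) (gS u).
Qed.

Lemma injective_baer : injective_module P -> baer.
Proof.
move=> iP I f; have [h hE] := iP _ _ (subinc I) f (@subinc_inj _ _ I).
exists (h (1 : A^o)) => a.
have e : subinc I a = (subinc I a : A) *: (1 : A^o) by rewrite [RHS]mulr1.
by rewrite -hE -[LHS]/(h (subinc I a)) [X in h X]e linearZ.
Qed.

End Baer.

Definition cogenerator (A : comPzRingType) (E : lmodType A) : Prop :=
  forall (U : lmodType A) (u : U), u <> 0 -> exists f : {linear U -> E}, f u <> 0.

Section QZ.

Fact int_sub : submodule [set q : zmodule rat | exists n : int, q = n%:~R].
Proof.
split=> [|a _ _ [m ->] [n ->]]; first by exists 0.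
exists (a * m + n); change ((m%:~R : rat) *~ a + n%:~R = (a * m + n)%:~R).
by rewrite intrD intrM mulrzl.
Qed.

Definition QZ : lmodType int := quom (Submod int_sub).

Lemma QZ_divisible (q : QZ) (n : int) : n != 0 -> exists q', n *: q' = q.
Proof.
move=> n0; have [r <-] := qproj_surj q.
exists (qproj (Submod int_sub) ((r : rat) / n%:~R : zmodule rat)); rewrite -linearZ /=.
congr (qpi _ _); change (((r : rat) / n%:~R) *~ n = r).
by rewrite -mulrzl mulrCA divff ?mulr1 // intr_eq0.
Qed.

Lemma QZ_injective : injective_module QZ.
Proof.
apply: baer_injective => I f.
have [[a0 a0n]|none] := pselect (exists a : subm I, subinc I a <> 0); last first.
  exists 0 => a; rewrite scaler0; have -> : a = 0; last exact: linear0.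
  apply: (@subinc_inj _ _ I); rewrite linear0.
  by have [//|h] := pselect (subinc I a = 0); case: none; exists a.
have ex : exists n : nat, (n > 0)%N && `[< exists a : subm I, subinc I a = n%:Z >].
  exists `|(subinc I a0 : int)|%N; rewrite absz_gt0; apply/andP; split; first exact/eqP.
  apply/asboolP; have [h|h] := lerP 0 (subinc I a0 : int).
    by exists a0; rewrite gez0_abs.
  by exists (- a0); rewrite linearN /= lez0_abs // ltW.
have [d /andP[d0 /asboolP[b bE]] dmin] := ex_minnP ex.
have dn0 : d%:Z != 0 by rewrite -absz_eq0 -lt0n.
have [q qE] := @QZ_divisible (f b) d%:Z dn0.
exists q => a.
have e : (subinc I a : int) = ((subinc I a : int) %/ d)%Z * d%:Z + ((subinc I a : int) %% d)%Z.
  exact: divz_eq.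
pose k := ((subinc I a : int) %/ d)%Z; pose c := a - k *: b.
have cE : subinc I c = ((subinc I a : int) %% d)%Z.
  have -> : subinc I c = subinc I a - k *: subinc I b by rewrite linearB linearZ.
  rewrite bE {1}e -/k.
  by rewrite [LHS]addrC [LHS]addKr.
have c0 : subinc I c = 0.
  have : (0 <= (subinc I c : int)) by rewrite cE modz_ge0.
  have : ((subinc I c : int) < d%:Z) by rewrite cE ltz_pmod.
  case E : (subinc I c : int) => [n|//] nd _.
  case: n E nd => // n E; rewrite ltz_nat ltnNge => /negP; case.
  by apply: dmin; apply/asboolP; exists c.
have aE : a = k *: b by apply: (@subinc_inj _ _ I); apply/eqP; rewrite -subr_eq0 -linearB -/c c0.
have -> : subinc I a = k *: (d%:Z : int^o) by rewrite aE linearZ bE.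
by rewrite aE linearZ -qE; exact: scalerA.
Qed.

End QZ.

Section Cogenerator.

Fact zlin_linear (U V : zmodType) (f : {additive U -> V}) :
  linear (f : zmodule U -> zmodule V).
Proof. by move=> n u v; rewrite raddfD; congr (_ + _); exact: raddfMz. Qed.

Lemma QZ_scale (n : int) (q : QZ) : n *: q = q *~ n.
Proof. by rewrite -{1}[n]intz scaler_int. Qed.

Lemma QZ_separates (U : zmodType) (u : U) : u <> 0 ->
  exists f : {linear zmodule U -> QZ}, f u <> 0.
Proof.
move=> u0.
have [m [m1 mE]] : exists m : nat, (1 < m)%N /\ forall n : int, u *~ n = 0 -> (m %| n)%Z.
  have [ex|none] := pselect (exists n : nat, (0 < n)%N && (u *+ n == 0)); last first.
    exists 2%N; split=> // n un; case: (eqVneq n 0) => [->|n0]; first exact: dvdz0.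
    case: none; exists `|n|%N; rewrite absz_gt0 n0 /=; apply/eqP.
    move: un; clear n0; case: n => [n|n] un; first exact: un.
    by apply: oppr_inj; rewrite oppr0; exact: un.
  have [m /andP[m0 /eqP um] mmin] := ex_minnP ex.
  exists m; split=> [|n un].
    case: m m0 um {mmin} => [|[|m]] // _ um; by case: u0; rewrite -um mulr1n.
  apply/dvdz_mod0P; have r0 : (0 <= (n %% m)%Z) by rewrite modz_ge0 // -absz_eq0 -lt0n.
  have rm : ((n %% m)%Z < m%:Z) by rewrite ltz_pmod.
  have ur : u *~ (n %% m)%Z = 0.
    by rewrite /modz mulrzBr un mulrC mulrzA -[u *~ m]/(u *+ m) um mul0rz subr0.
  case: (n %% m)%Z r0 rm ur => [[|r]|//] // _ rm ur.
  have := mmin r.+1; rewrite -[u *+ _]/(u *~ r.+1) ur eqxx => /(_ isT).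
  by rewrite leqNgt -ltz_nat rm.
pose q : QZ := qproj (Submod int_sub) (m%:R^-1 : zmodule rat).
have m0 : (m%:R : rat) != 0 by rewrite pnatr_eq0 -lt0n ltnW.
have q0 : q <> 0.
  move/qproj_eq0 => [n /= e].
  have e1 : (1 : rat) = (m%:Z * n)%:~R by rewrite intrM -e mulfV.
  have /eqP := e1; rewrite -[1]/(1%:~R) eqr_int eq_sym => /eqP e2.
  have := congr1 absz e2; rewrite abszM => /eqP; rewrite muln_eq1 => /andP[/eqP /= e3 _].
  by rewrite e3 in m1.
have jl : linear (fun n : int^o => (u *~ n : zmodule U)).
  move=> a n k; rewrite mulrzDr (_ : a *: n = (n : int) * a) ?mulrzA //.
  exact: mulrC.
have ql : linear (fun n : int^o => n *: q).
  by move=> a n k; rewrite scalerDl -scalerA.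
pose j := mklin jl.
have [e eE] := @factor_inj _ _ _ _ (subinc (imsub j)) j (@subinc_inj _ _ _)
  (fun n => @subinc_ex _ _ (imsub j) (j n) (ex_intro _ n erefl)).
have es v : exists n, e n = v.
  have [n nE] := subincP v; exists n; apply: (@subinc_inj _ _ (imsub j)).
  by rewrite eE.
have [n en|g gE] := @factor_surj _ _ _ _ e (mklin ql) es.
  have un : u *~ n = 0 by rewrite -[LHS](eE n) en linear0.
  have /dvdzP[k ->] := mE n un; rewrite -[LHS]/((k * m) *: q) -scalerA.
  rewrite (_ : m%:Z *: q = 0) ?scaler0 // -linearZ; apply/qproj_eq0; exists 1.
  by change ((m%:R^-1 : rat) *~ m = 1); rewrite -mulrzl divff.
have [h hE] := QZ_injective g (@subinc_inj _ _ (imsub j)).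
exists h; have <- : subinc _ (e 1) = u by rewrite eE /j /=.
by rewrite -[h _]/((h \o subinc _) _) hE gE /= scale1r.
Qed.

Variable A : comPzRingType.

(* The character module [Hom_Z(A, Q/Z)]. *)
Definition cog : Type := lhom (zmodule A) QZ.
HB.instance Definition _ := GRing.Zmodule.on cog.

Definition cog_app (f : cog) (a : A) : QZ := lhom_fun f a.

Lemma cogP (f g : cog) : cog_app f =1 cog_app g -> f = g.
Proof. by move=> fg; apply: (@lhomP int (zmodule A) QZ). Qed.

Lemma cog_appD f g a : cog_app (f + g) a = cog_app f a + cog_app g a.
Proof. by []. Qed.
Lemma cog_app_add f a b : cog_app f (a + b) = cog_app f a + cog_app f b.
Proof. exact: (linearD (f : {linear zmodule A -> QZ})). Qed.

Definition cog_ev (a : A) (f : cog) : QZ := cog_app f a.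
Fact cog_evB a : {morph cog_ev a : f g / f - g}.
Proof. by []. Qed.
HB.instance Definition _ a := GRing.isZmodMorphism.Build cog QZ (cog_ev a) (cog_evB a).

Fact cog_scale_linear (a : A) (f : cog) :
  linear (fun b : zmodule A => cog_app f (a * b)).
Proof.
move=> n b c; rewrite mulrDr cog_app_add; congr (_ + _).
rewrite -[LHS]/(cog_app f (a * (b *~ n))) mulrzAr.
exact: (linearZZ (f : {linear zmodule A -> QZ}) n (a * b : zmodule A)).
Qed.
Definition cog_scale (a : A) (f : cog) : cog := mklin (cog_scale_linear a f).

Fact cog_scaleA a b f : cog_scale a (cog_scale b f) = cog_scale (a * b) f.
Proof. by apply: cogP => c; rewrite /cog_app /= /cog_app mulrCA mulrA. Qed.
Fact cog_scale1 : left_id 1 cog_scale.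
Proof. by move=> f; apply: cogP => c; rewrite /cog_app /= /cog_app mul1r. Qed.
Fact cog_scaleDr : right_distributive cog_scale +%R.
Proof. by move=> a f g; apply: cogP => c. Qed.
Fact cog_scaleDl f : {morph cog_scale^~ f : a b / a + b}.
Proof.
move=> a b; apply: cogP => c; rewrite cog_appD -[LHS]/(cog_app f ((a + b) * c)).
by rewrite mulrDl cog_app_add.
Qed.
HB.instance Definition _ := GRing.Zmodule_isLmodule.Build A cog
  cog_scaleA cog_scale1 cog_scaleDr cog_scaleDl.

Lemma cog_appZ a f b : cog_app (a *: f) b = cog_app f (a * b).
Proof. by []. Qed.

Section Ext.
Variables (U : lmodType A) (h : {linear zmodule U -> QZ}).

Lemma cog_extD u v : h ((u : U) + v) = h u + h v.
Proof. exact: linearD. Qed.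

Fact cog_ext_linear1 (u : U) : linear (fun b : zmodule A => h ((b : A) *: u)).
Proof.
move=> n b c; rewrite scalerDl cog_extD; congr (_ + _).
rewrite -[LHS]/(h ((b *~ n : A) *: u)) -scalerMzl.
exact: (linearZZ h n ((b : A) *: u : zmodule U)).
Qed.

Definition cog_ext_fun (u : U) : cog := mklin (cog_ext_linear1 u).

Fact cog_ext_linear : linear cog_ext_fun.
Proof.
move=> a u v; apply: cogP => b; rewrite cog_appD cog_appZ.
rewrite -![cog_app (cog_ext_fun _) _]/(h _) -cog_extD.
by rewrite scalerDr scalerA [b * a]mulrC.
Qed.
Definition cog_ext : {linear U -> cog} := mklin cog_ext_linear.
End Ext.

Lemma cog_injective : injective_module cog.
Proof.
move=> U V f g fi.
have gl : linear (fun u : zmodule U => cog_app (g u) 1).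
  move=> n u v; rewrite linearD cog_appD; congr (_ + _).
  rewrite -[LHS]/(cog_app (g ((u : U) *~ n)) 1) raddfMz.
  by rewrite QZ_scale; exact: (raddfMz (cog_ev 1)).
have [h hE] := @QZ_injective _ _ (mklin (zlin_linear f)) (mklin gl) fi.
exists (cog_ext h) => u; apply: cogP => a.
rewrite -[LHS]/(h (a *: f u)) -linearZ -[LHS]/((h \o mklin (zlin_linear f)) (a *: u)) hE /=.
by rewrite linearZ cog_appZ mulr1.
Qed.

Lemma cog_cogenerator : cogenerator cog.
Proof.
move=> U u u0; have [h hu] := QZ_separates u0; exists (cog_ext h) => e.
by apply: hu; rewrite -[u]scale1r -[LHS]/(cog_app (cog_ext h u) 1) e.
Qed.

End Cogenerator.

(** * Homomorphisms, tensor products, duality *)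

Section HomTensor.
Variable A : comPzRingType.
Implicit Types B M N U V W X T : lmodType A.

(* [lhom U V] is [{linear U -> V}] under another name: [lap] and [lam] are
   identities which select the structure that is inferred. *)
Definition lap U V (f : lhom U V) : {linear U -> V} := f.
Definition lam U V (f : {linear U -> V}) : lhom U V := f.

Lemma lamP U V (f g : lhom U V) : lap f =1 lap g -> f = g.
Proof. exact: lhomP. Qed.

Fact lev_linear U V (u : U) : linear (fun f : lhom U V => lap f u).
Proof. by []. Qed.
Definition lev U V (u : U) : {linear lhom U V -> V} := mklin (@lev_linear U V u).

Fact lpost_linear T U V (f : {linear U -> V}) : linear (@postcomp A T U V f).
Proof. by move=> a g h; apply: lamP => t; exact: linearP. Qed.
Definition lpost T U V (f : {linear U -> V}) : {linear lhom T U -> lhom T V} :=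
  mklin (@lpost_linear T U V f).
Fact lpre_linear T U V (f : {linear U -> V}) : linear (@precomp A T U V f).
Proof. by move=> a g h; apply: lamP => t. Qed.
Definition lpre T U V (f : {linear U -> V}) : {linear lhom V T -> lhom U T} :=
  mklin (@lpre_linear T U V f).

Definition tlift M N W (f : M -> N -> W) (fb : bilin f) : {linear tens M N -> W} :=
  mklin (tens_lift_linear fb).
Lemma tliftE M N W (f : M -> N -> W) (fb : bilin f) m n : tlift fb (pure m n) = f m n.
Proof. exact: tens_liftE. Qed.

Lemma tens_ext M N W (f g : {linear tens M N -> W}) :
  (forall m n, f (pure m n) = g (pure m n)) -> f =1 g.
Proof. by move=> fg t; rewrite [t]tens_sum !linear_sum; apply: eq_bigr => p _; exact: fg. Qed.

Definition purel M N (n : N) : {linear M -> tens M N} := mklin ((pure_bilin M N).1 n).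
Definition purer M N (m : M) : {linear N -> tens M N} := mklin ((pure_bilin M N).2 m).

Lemma pure_linl M N a m m' n :
  pure (a *: m + m' : M) (n : N) = a *: pure m n + pure m' n.
Proof. exact: (linearP (purel M n)). Qed.
Lemma pure_linr M N a m n n' :
  pure (m : M) (a *: n + n' : N) = a *: pure m n + pure m n'.
Proof. exact: (linearP (purer N m)). Qed.
Lemma pure0r M N m : pure (m : M) (0 : N) = 0.
Proof. exact: (linear0 (purer N m)). Qed.
Lemma pureZl M N a m n : pure (a *: m : M) (n : N) = a *: pure m n.
Proof. exact: (linearZZ (purel M n)). Qed.
Fact tmap_bilin M M' N N' (f : {linear M -> M'}) (g : {linear N -> N'}) :
  bilin (fun m n => pure (f m) (g n)).
Proof.
split=> [n|m] a u v; first by rewrite linearP pure_linl.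
by rewrite linearP pure_linr.
Qed.
Definition tmap M M' N N' (f : {linear M -> M'}) (g : {linear N -> N'}) :
  {linear tens M N -> tens M' N'} := tlift (tmap_bilin f g).
Lemma tmapE M M' N N' (f : {linear M -> M'}) (g : {linear N -> N'}) m n :
  tmap f g (pure m n) = pure (f m) (g n).
Proof. exact: tliftE. Qed.
Lemma tens_mapE B U V (f : {linear U -> V}) : @tens_map A B U V f =1 tmap (lid B) f.
Proof. by []. Qed.

Fact tcurry_linear B X W (h : {linear tens B X -> W}) :
  linear (fun x => lam (lcomp h (purel B x)) : lhom B W).
Proof.
move=> a x y; apply: lamP => b; rewrite /lap /lam /=.
by rewrite pure_linr linearP.
Qed.
Definition tcurry B X W (h : {linear tens B X -> W}) : {linear X -> lhom B W} :=
  mklin (tcurry_linear h).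
Lemma tcurryE B X W (h : {linear tens B X -> W}) x b : lap (tcurry h x) b = h (pure b x).
Proof. by []. Qed.

Fact tuncurry_bilin B X W (g : {linear X -> lhom B W}) : bilin (fun b x => lap (g x) b).
Proof. by split=> [x|b] a u v; rewrite ?linearP. Qed.
Definition tuncurry B X W (g : {linear X -> lhom B W}) : {linear tens B X -> W} :=
  tlift (tuncurry_bilin g).
Lemma tuncurryE B X W (g : {linear X -> lhom B W}) b x : tuncurry g (pure b x) = lap (g x) b.
Proof. exact: tliftE. Qed.

Fact tswap_bilin M N : bilin (fun (m : M) (n : N) => pure n m).
Proof. by case: (pure_bilin N M). Qed.
Definition tswap M N : {linear tens M N -> tens N M} := tlift (tswap_bilin M N).
Lemma tswapE M N m n : tswap M N (pure m n) = pure n m.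
Proof. exact: tliftE. Qed.
End HomTensor.

Lemma injective_exact (A : comPzRingType) (E U V W : lmodType A) (f : {linear U -> V}) (g : {linear V -> W}) (h : {linear V -> E}) :
  injective_module E ->
  (forall v, g v = 0 -> exists u, f u = v) -> (forall u, h (f u) = 0) ->
  exists k : {linear W -> E}, k \o g =1 h.
Proof.
move=> Einj ex hf.
have gi v : exists b, subinc (imsub g) b = g v by apply: subinc_ex; exists v.
have [g' g'E] := factor_inj (@subinc_inj _ _ (imsub g)) gi.
have g's b : exists v, g' v = b.
  have [v vE] := subincP b; exists v; apply: (@subinc_inj _ _ (imsub g)); rewrite -vE.
  exact: g'E.
have [v|k kE] := @factor_surj _ _ _ _ g' h g's.
  by move=> e; have [|u <-] := ex v; [rewrite -g'E e linear0 | exact: hf].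
have [l lE] := Einj _ _ _ k (@subinc_inj _ _ (imsub g)).
by exists l => v; rewrite -kE -lE; by rewrite -[RHS]/(l (subinc _ (g' v))) g'E.
Qed.

Section InjectiveModules.
Variable A : comPzRingType.
Implicit Types U V W : lmodType A.

Lemma inj_retract U V (i : {linear U -> V}) (r : {linear V -> U}) :
  (forall u, r (i u) = u) -> injective_module V -> injective_module U.
Proof.
move=> ri iV X Y f g fi; have [h hE] := iV _ _ f (lcomp i g) fi.
by exists (lcomp r h) => x; rewrite /= -[RHS]ri; congr (r _); exact: hE.
Qed.

Lemma inj_split U V W (i : {linear U -> V}) (p : {linear V -> W}) :
  ses i p -> injective_module U -> exists r : {linear V -> U}, forall u, r (i u) = u.
Proof. by case=> ii _ _ iU; have [r rE] := iU _ _ i (lid U) ii; exists r. Qed.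

Lemma inj_coker U V W (i : {linear U -> V}) (p : {linear V -> W}) :
  ses i p -> injective_module U -> injective_module V -> injective_module W.
Proof.
move=> ip iU iV; have [r rE] := inj_split ip iU.
by have [s [ps _]] := ses_section ip rE; exact: inj_retract ps iV.
Qed.

Lemma inj_prod U V : injective_module U -> injective_module V -> injective_module (U * V)%type.
Proof.
move=> iU iV X Y f g fi.
have [h hE] := iU _ _ f (lcomp (lfst U V) g) fi.
have [k kE] := iV _ _ f (lcomp (lsnd U V) g) fi.
exists (lpair h k) => x; rewrite [RHS]surjective_pairing.
by congr pair; [exact: hE | exact: kE].
Qed.

Lemma inj_ext U V W (i : {linear U -> V}) (p : {linear V -> W}) :
  ses i p -> injective_module U -> injective_module W -> injective_module V.
Proof.
move=> ip iU iW; have [r rE] := inj_split ip iU.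
have [s [ps sE]] := ses_section ip rE.
apply: (@inj_retract _ _ (lpair r p) (lcase i s)); last exact: inj_prod.
by move=> v; rewrite /= addrC sE.
Qed.

End InjectiveModules.

Section Dual.
Variables (A : comPzRingType) (E : lmodType A).
Hypotheses (Einj : injective_module E) (Ecog : cogenerator E).
Implicit Types B F U V W : lmodType A.

Lemma cog_range U V (f : {linear U -> V}) v :
  (forall h : {linear V -> E}, (forall u, h (f u) = 0) -> h v = 0) -> exists u, f u = v.
Proof.
move=> H; apply: contrapT => nf.
have [|h hv] := @Ecog _ (qproj (imsub f) v); first by move/qproj_eq0.
by apply: hv; apply: (H (lcomp h (qproj (imsub f)))) => u;
  rewrite lcompE (_ : qproj _ _ = 0) ?linear0 //; apply/qproj_eq0; exists u.
Qed.

Lemma cog_inj U V (f : {linear U -> V}) :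
  (forall h : {linear U -> E}, exists g : {linear V -> E}, g \o f =1 h) -> injective f.
Proof.
move=> H; apply/lin_inj0 => u fu; apply: contrapT => /Ecog[h]; apply.
by have [g <-] := H h; rewrite /= fu linear0.
Qed.

Lemma flat_tmap_inj F U V (f : {linear U -> V}) :
  flat F -> injective f -> injective (tmap (lid F) f).
Proof.
move=> Ff fi; have /Ff /exactP ex : exact_seq (lzero U U) f.
  apply/exactP => u; split=> [fu|[w <-]]; last exact: linear0.
  by exists 0; apply: fi; rewrite fu linear0.
apply/lin_inj0 => t ft; have [+ _] := ex t => /(_ ft)[s <-].
suff : tmap (lid F) (lzero U U) s = lzero _ _ s by [].
apply: tens_ext => m n; rewrite tmapE; exact: pure0r.
Qed.

Lemma flat_dual F : flat F -> injective_module (lhom F E).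
Proof.
move=> Ff U V f g fi.
have [h hE] := Einj (tuncurry g) (flat_tmap_inj Ff fi).
exists (tcurry h) => u; apply: lamP => x; rewrite -(tuncurryE g) -hE.
by rewrite -[RHS]/(h (tmap (lid F) f (pure x u))) tmapE.
Qed.

Lemma dual_flat F : injective_module (lhom F E) -> flat F.
Proof.
move=> Fi U V W f g /exactP ex; apply/exactP => t; rewrite !tens_mapE; split.
  move=> gt; apply: (@cog_range _ _ (tmap (lid F) f)) => h hf.
  have [k kE] : exists k : {linear W -> lhom F E}, k \o g =1 tcurry h.
    apply: (injective_exact (f := f)) => // [v /ex //|u].
    by apply: lamP => x; have := hf (pure x u); rewrite tmapE.
  rewrite -(linear0 (tuncurry k)) -gt; move: t {gt}.
  apply: (tens_ext (f := h) (g := lcomp (tuncurry k) (tmap (lid F) g))) => x v.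
  by rewrite lcompE tmapE tuncurryE -tcurryE -kE.
case=> s <-; rewrite -[LHS]/(lcomp (tmap (lid F) g) (tmap (lid F) f) s).
rewrite -[RHS]/(lzero _ _ s); move: s; apply: tens_ext => x u.
rewrite lcompE !tmapE (_ : g (f u) = 0); first exact: pure0r.
by apply/ex; exists u.
Qed.

Lemma dual_ses U V W (i : {linear U -> V}) (p : {linear V -> W}) :
  ses i p -> ses (lpre E p) (lpre E i).
Proof.
move=> [ii ps ie]; split.
- apply/lin_inj0 => f fp; apply: lamP => w; have [v <-] := ps w.
  by rewrite -[LHS]/(lap (lpre E p f) v) fp.
- by move=> f; have [g gE] := Einj (lap f) ii; exists (lam g); apply: lamP.
- move=> f; split=> [fi|[g <-]].
    have [v /ie[u <-]|g gE] := @factor_surj _ _ _ _ p (lap f) ps.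
      by rewrite -[LHS]/(lap (lpre E i f) u) fi.
    by exists (lam g); apply: lamP.
  apply: lamP => u; rewrite -[LHS]/(lap g (p (i u))) (_ : p (i u) = 0) ?linear0 //.
  by apply/ie; exists u.
Qed.

Lemma flat_ext F' F F'' (i : {linear F' -> F}) (p : {linear F -> F''}) :
  ses i p -> flat F' -> flat F'' -> flat F.
Proof.
move=> /dual_ses ip /flat_dual F'i /flat_dual F''i; apply: dual_flat.
exact: inj_ext ip _ _.
Qed.

Lemma flat_ker F' F F'' (i : {linear F' -> F}) (p : {linear F -> F''}) :
  ses i p -> flat F -> flat F'' -> flat F'.
Proof.
move=> /dual_ses ip /flat_dual Fi /flat_dual F''i; apply: dual_flat.
exact: inj_coker ip _ _.
Qed.

Lemma projective_flat F : projective F -> flat F.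
Proof.
move=> Fp; apply: dual_flat => U V f g fi.
have [|h hE] := Fp _ _ (lpre E f) (tcurry (lcomp (tuncurry g) (tswap U F))).
  apply/surjP => h; have [k kE] := Einj (lap h) fi.
  by exists (lam k); apply: lamP.
exists (tcurry (lcomp (tuncurry h) (tswap F V))) => u; apply: lamP => x.
rewrite tcurryE (lcompE (tuncurry h)) tswapE tuncurryE.
have := congr1 (fun k => lap k u) (hE x).
by rewrite tcurryE (lcompE (tuncurry g)) tswapE tuncurryE.
Qed.

End Dual.

(** * Projective and noetherian modules *)

Section FreeModule.
Variables (A : comPzRingType) (S : choiceType).

Definition feval (W : lmodType A) (f : S -> W) (s : seq (A * S)) : W :=
  \sum_(p <- s) p.1 *: f p.2.

Definition free_equiv (s t : seq (A * S)) : bool :=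
  `[< forall (W : lmodType A) (f : S -> W), feval f s = feval f t >].

Fact free_equiv_class : equiv_class_of free_equiv.
Proof.
split=> [s|s t|t s u].
- exact/asboolP.
- by apply/asboolP/asboolP => st W f.
- by move=> /asboolP st /asboolP tu; apply/asboolP => W f; rewrite st.
Qed.

Canonical free_equiv_rel := EquivRelPack free_equiv_class.
Definition free : Type := {eq_quot free_equiv}.
HB.instance Definition _ := EqQuotient.on free.
HB.instance Definition _ := Choice.on free.

Definition fpi (s : seq (A * S)) : free := \pi_free s.

Lemma free_eqP (s t : seq (A * S)) :
  (forall (W : lmodType A) (f : S -> W), feval f s = feval f t) -> fpi s = fpi t.
Proof. by move=> st; apply/eqmodP/asboolP. Qed.

Lemma feval_repr (W : lmodType A) (f : S -> W) s : feval f (repr (fpi s)) = feval f s.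
Proof.
have /eqmodP /asboolP h : repr (\pi_free s) = s %[mod free] by rewrite reprK.
exact: h.
Qed.

Definition fscale (a : A) (s : seq (A * S)) : seq (A * S) := [seq (a * p.1, p.2) | p <- s].

Lemma feval_cat (W : lmodType A) (f : S -> W) s t :
  feval f (s ++ t) = feval f s + feval f t.
Proof. by rewrite /feval big_cat. Qed.

Lemma feval_scale (W : lmodType A) (f : S -> W) a s :
  feval f (fscale a s) = a *: feval f s.
Proof. by rewrite /feval big_map scaler_sumr; apply: eq_bigr => p _; rewrite scalerA. Qed.

Definition free_zero : free := fpi [::].
Definition free_add (t u : free) : free := fpi (repr t ++ repr u).
Definition free_scale (a : A) (t : free) : free := fpi (fscale a (repr t)).
Definition free_opp (t : free) : free := free_scale (-1) t.

Let simpE := (feval_cat, feval_repr, feval_scale).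

Fact free_addA : associative free_add.
Proof. by move=> t u v; apply: free_eqP => W f; rewrite !simpE addrA. Qed.
Fact free_addC : commutative free_add.
Proof. by move=> t u; apply: free_eqP => W f; rewrite !simpE addrC. Qed.
Fact free_add0 : left_id free_zero free_add.
Proof.
move=> t; rewrite -[RHS]reprK; apply: free_eqP => W f; rewrite !simpE.
by rewrite /feval big_nil add0r.
Qed.
Fact free_addN : left_inverse free_zero free_opp free_add.
Proof.
move=> t; apply: free_eqP => W f; rewrite !simpE.
by rewrite scaleN1r addNr /feval big_nil.
Qed.
HB.instance Definition _ :=
  GRing.isZmodule.Build free free_addA free_addC free_add0 free_addN.

Fact free_scaleA a b t : free_scale a (free_scale b t) = free_scale (a * b) t.
Proof. by apply: free_eqP => W f; rewrite !simpE scalerA. Qed.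
Fact free_scale1 : left_id 1 free_scale.
Proof. by move=> t; rewrite -[RHS]reprK; apply: free_eqP => W f; rewrite !simpE scale1r. Qed.
Fact free_scaleDr : right_distributive free_scale +%R.
Proof. by move=> a t u; apply: free_eqP => W f; rewrite !simpE scalerDr. Qed.
Fact free_scaleDl t : {morph free_scale^~ t : a b / a + b}.
Proof. by move=> a b; apply: free_eqP => W f; rewrite !simpE scalerDl. Qed.
HB.instance Definition _ := GRing.Zmodule_isLmodule.Build A free
  free_scaleA free_scale1 free_scaleDr free_scaleDl.

Definition fgen (s : S) : free := fpi [:: (1, s)].

Fact flift_linear (W : lmodType A) (f : S -> W) : linear (fun t : free => feval f (repr t)).
Proof. by move=> a t u; rewrite !simpE. Qed.
Definition flift (W : lmodType A) (f : S -> W) : {linear free -> W} := mklin (flift_linear f).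

Lemma fliftE (W : lmodType A) (f : S -> W) s : flift f (fgen s) = f s.
Proof. by rewrite /= !simpE /feval big_seq1 scale1r. Qed.

Lemma free_ext (W : lmodType A) (f g : {linear free -> W}) :
  (forall s, f (fgen s) = g (fgen s)) -> f =1 g.
Proof.
move=> fg t; rewrite -[t]reprK; elim: (repr t) => [|[a s] r IHr].
  by rewrite (_ : \pi_free [::] = 0) ?linear0.
have -> : \pi_free ((a, s) :: r) = a *: fgen s + fpi r.
  apply: free_eqP => W' f'; rewrite !simpE /feval big_cons big_seq1 /=.
  by rewrite scale1r.
by rewrite !linearP fg; congr (_ + _).
Qed.

Lemma free_projective : projective free.
Proof.
move=> U V f g /surjP fs; have [h hE] := choice (fun s => fs (g (fgen s))).
exists (flift h); apply: (free_ext (f := lcomp f (flift h)) (g := g)) => s.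
by rewrite lcompE fliftE hE.
Qed.

End FreeModule.

Section ProjectiveModules.
Variable A : comPzRingType.
Implicit Types P U V W X : lmodType A.

Lemma enough_projective X :
  exists (P : lmodType A) (p : {linear P -> X}), projective P /\ forall x, exists u, p u = x.
Proof.
exists (free A X), (flift idfun); split; first exact: free_projective.
by move=> x; exists (fgen A x); rewrite fliftE.
Qed.

Lemma proj_lift P U V (p : {linear U -> V}) (g : {linear P -> V}) : projective P ->
  (forall v, exists u, p u = v) -> exists h : {linear P -> U}, forall x, p (h x) = g x.
Proof. by move=> Pp /surjP ps; have [h hE] := Pp _ _ p g ps; exists h. Qed.

Lemma proj_retract P P' (i : {linear P' -> P}) (r : {linear P -> P'}) :
  (forall u, r (i u) = u) -> projective P -> projective P'.
Proof.
move=> ri Pp U V f g fs; have [h hE] := Pp _ _ f (lcomp g r) fs.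
by exists (lcomp h i) => x /=; rewrite -[RHS]/(g x) -{2}[x]ri; exact: hE.
Qed.

Lemma proj_prod P P' : projective P -> projective P' -> projective (P * P')%type.
Proof.
move=> Pp P'p U V f g fs.
have [h hE] := Pp _ _ f (lcomp g (linl P P')) fs.
have [k kE] := P'p _ _ f (lcomp g (linr P P')) fs.
exists (lcase h k) => -[u v]; rewrite /= linearD.
have -> : f (h u) = g (u, 0) := hE u.
have -> : f (k v) = g (0, v) := kE v.
by rewrite -linearD; congr (g _); congr pair; rewrite /= ?addr0 ?add0r.
Qed.

Lemma proj_split U V W (i : {linear U -> V}) (p : {linear V -> W}) :
  ses i p -> projective W -> exists s : {linear W -> V}, forall w, p (s w) = w.
Proof. by case=> _ ps _ Wp; exact: proj_lift p (lid W) Wp ps. Qed.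

Lemma proj_ker U V W (i : {linear U -> V}) (p : {linear V -> W}) :
  ses i p -> projective V -> projective W -> projective U.
Proof.
move=> ip Vp Wp; have [s sE] := proj_split ip Wp.
by have [r [ri _]] := ses_retract ip sE; exact: proj_retract ri Vp.
Qed.

Lemma ring_projective : projective A^o.
Proof.
move=> U V f g /surjP fs; have [u uE] := fs (g 1).
have hl : linear (fun a : A^o => (a : A) *: u).
  by move=> a b c; rewrite scalerDl -scalerA.
exists (mklin hl) => a /=; rewrite linearZ uE -linearZ /=; congr (g _).
exact: mulr1.
Qed.

End ProjectiveModules.

Section Noetherian.
Variable A : comPzRingType.
Implicit Types P U V W X : lmodType A.

Lemma lspan_nil X (v : X) : lspan [::] v <-> v = 0.
Proof.
split=> [[c ->]|->]; first by rewrite big_ord0.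
by exists (fun _ => 0); rewrite big_ord0.
Qed.

Lemma lspan_cons X u (s : seq X) v :
  lspan (u :: s) v <-> exists a w, lspan s w /\ v = a *: u + w.
Proof.
split=> [[c ->]|[a [w [[c ->] ->]]]].
  rewrite big_ord_recl /=; exists (c 0%N), (\sum_(i < size s) c i.+1 *: s`_i).
  by split=> //; exists (fun i => c i.+1).
exists (fun i => if i is j.+1 then c j else a).
by rewrite big_ord_recl.
Qed.

Lemma lspan_sub X (s : seq X) : submodule (lspan s).
Proof.
split=> [|a _ _ [c ->] [d ->]].
  by exists (fun _ => 0); rewrite big1 // => i _; rewrite scale0r.
exists (fun i => a * c i + d i); rewrite scaler_sumr -big_split /=.
by apply: eq_bigr => i _; rewrite scalerDl scalerA.
Qed.
Definition spansub X (s : seq X) := Submod (lspan_sub s).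

Lemma lspan_mem X (s : seq X) u : u \in s -> lspan s u.
Proof.
elim: s => // v s IHs; rewrite inE => /orP[/eqP->|/IHs us]; apply/lspan_cons.
  by exists 1, 0; split; [exact: (submod0 (spansub s)) | rewrite scale1r addr0].
by exists 0, u; rewrite scale0r add0r.
Qed.

Lemma lspan_min X (s : seq X) (N : submod X) v :
  (forall u, u \in s -> N u) -> lspan s v -> N v.
Proof.
elim: s v => [|u s IHs] v sN; first by move/lspan_nil ->; exact: submod0.
move/lspan_cons => [a [w [sw ->]]]; apply: submodP; first by apply: sN; rewrite mem_head.
by apply: IHs sw => t ts; apply: sN; rewrite inE ts orbT.
Qed.

Definition noeth X : Prop := forall N : set X, submodule N -> exists s : seq X, N = lspan s.

Lemma noethP X : noeth X <->
  forall N : submod X, exists s : seq X, (forall u, u \in s -> N u) /\ (forall v, N v -> lspan s v).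
Proof.
split=> [nX N|h N sN].
  by have [s sE] := nX N (sset_sub N); exists s; rewrite sE; split=> // u; exact: lspan_mem.
have [s [s1 s2]] := h (Submod sN); exists s; rewrite eqEsubset; split=> v; first exact: s2.
by apply: (lspan_min (N := Submod sN)).
Qed.

Lemma noeth_finite X : noeth X -> finite_module X.
Proof. by move=> h; have [//|s sE] := h setT; exists s. Qed.

Fact preim_sub X U (f : {linear U -> X}) (N : submod X) : submodule [set u | N (f u)].
Proof.
split=> [|a u v hu hv] /=; first by rewrite linear0; exact: submod0.
by rewrite linearP; exact: submodP.
Qed.
Definition preimsub X U (f : {linear U -> X}) (N : submod X) := Submod (preim_sub f N).

Fact img_sub X U (f : {linear U -> X}) (N : submod U) : submodule [set v | exists2 u, N u & f u = v].
Proof.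
split=> [|a _ _ [u Nu <-] [v Nv <-]] /=.
  by exists 0; [exact: submod0 | exact: linear0].
by exists (a *: u + v); [exact: submodP | exact: linearP].
Qed.
Definition imgsub X U (f : {linear U -> X}) (N : submod U) := Submod (img_sub f N).

Lemma lift_seq (T T' : eqType) (f : T -> T') (N : T -> Prop) (s : seq T') :
  (forall v, v \in s -> exists2 u, N u & f u = v) ->
  exists t, map f t = s /\ forall u, u \in t -> N u.
Proof.
elim: s => [|v s IHs] h; first by exists [::].
have [|t [tE tN]] := IHs; first by move=> w ws; apply: h; rewrite inE ws orbT.
have [u Nu fu] := h v (mem_head _ _).
exists (u :: t); rewrite /= fu tE; split=> // w.
by rewrite inE => /orP[/eqP->|/tN].
Qed.

Lemma lspan_map U V (f : {linear U -> V}) (s : seq U) v :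
  lspan (map f s) v <-> exists2 u, lspan s u & f u = v.
Proof.
split=> [|[u us <-]].
  apply: (lspan_min (N := imgsub f (spansub s))) => _ /mapP[u us ->].
  by exists u => //; exact: lspan_mem.
apply: (lspan_min (N := preimsub f (spansub (map f s)))) us => w ws.
by apply: lspan_mem; exact: map_f.
Qed.

Lemma noeth_surj U V (p : {linear U -> V}) :
  (forall v, exists u, p u = v) -> noeth U -> noeth V.
Proof.
move=> ps /noethP nU; apply/noethP => N.
have [s [s1 s2]] := nU (preimsub p N); exists (map p s); split.
  by move=> _ /mapP[u /s1 us ->].
move=> v Nv; have [u uv] := ps v; apply/lspan_map; exists u => //; apply: s2.
by rewrite /= uv.
Qed.

Lemma noeth_inj U V (i : {linear U -> V}) : injective i -> noeth V -> noeth U.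
Proof.
move=> ii /noethP nV; apply/noethP => N.
have [s [s1 s2]] := nV (imgsub i N); have [t [tE tN]] := lift_seq s1.
exists t; split=> // u Nu; have /s2 : imgsub i N (i u) by exists u.
by rewrite -tE => /lspan_map[w tw /ii <-].
Qed.

Lemma noeth_ext U V W (i : {linear U -> V}) (p : {linear V -> W}) :
  ses i p -> noeth U -> noeth W -> noeth V.
Proof.
move=> [ii ps ie] /noethP nU /noethP nW; apply/noethP => N.
have [s [s1 s2]] := nW (imgsub p N); have [t [tE tN]] := lift_seq s1.
have [r [r1 r2]] := nU (preimsub i N).
exists (t ++ map i r); split=> [u|v Nv].
  by rewrite mem_cat => /orP[/tN //|/mapP[w /r1 wr ->]].
have /s2 : imgsub p N (p v) by exists v.
rewrite -tE => /lspan_map[w tw pw].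
have sub1 u : lspan t u -> lspan (t ++ map i r) u.
  by apply: (lspan_min (N := spansub _)) => x xt; apply: lspan_mem; rewrite mem_cat xt.
have Nw : N w by exact: lspan_min tw.
have [|u uE] := (ie (v - w)).1; first by rewrite linearB pw subrr.
rewrite -[v](subrK w) -uE; apply: (submodD (N := spansub _)); last exact: sub1.
have : lspan r u by apply: r2; rewrite /= uE; exact: submodB.
move=> ru; have : lspan (map i r) (i u) by apply/lspan_map; exists u.
apply: (lspan_min (N := spansub _)) => x xr; apply: lspan_mem.
by rewrite mem_cat xr orbT.
Qed.

Inductive finfree : lmodType A -> Prop :=
| finfree1 : finfree A^o
| finfreeS : forall P : lmodType A, finfree P -> finfree (A^o * P)%type.

Lemma finfree_projective P : finfree P -> projective P.
Proof.
by elim=> [|P' _ IH]; [exact: ring_projective | apply: proj_prod; first exact: ring_projective].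
Qed.

Lemma fg_cover X : finite_module X ->
  exists (P : lmodType A) (p : {linear P -> X}), finfree P /\ forall x, exists u, p u = x.
Proof.
case=> s sE; have : forall x, lspan s x by move=> x; rewrite sE.
have [P [p [Pf pE]]] : exists (P : lmodType A) (p : {linear P -> X}), finfree P /\
    forall x, lspan s x -> exists u, p u = x.
  elim: s {sE} => [|v s [P [p [Pf pE]]]].
    exists A^o, (lzero _ _); split; first exact: finfree1.
    by move=> x /lspan_nil ->; exists 0.
  have hl : linear (fun a : A^o => (a : A) *: v).
    by move=> a b c; rewrite scalerDl -scalerA.
  exists (A^o * P)%type, (lcase (mklin hl) p); split; first exact: finfreeS.
  by move=> x /lspan_cons[a [w [/pE[u <-] ->]]]; exists (a, u).
by move=> h; exists P, p; split=> // x; exact: pE.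
Qed.

Hypothesis An : noetherian A.

Lemma finfree_noeth P : finfree P -> noeth P.
Proof.
by elim=> [|P' _ IH]; [exact: An | exact: noeth_ext (prod_ses _ _) An IH].
Qed.

Lemma finite_noeth X : finite_module X -> noeth X.
Proof.
by move=> /fg_cover[P [p [Pf ps]]]; exact: noeth_surj ps (finfree_noeth Pf).
Qed.

Lemma finite_inj U V (i : {linear U -> V}) :
  injective i -> finite_module V -> finite_module U.
Proof. by move=> ii /finite_noeth/(noeth_inj ii)/noeth_finite. Qed.

Lemma finite_surj U V (p : {linear U -> V}) :
  (forall v, exists u, p u = v) -> finite_module U -> finite_module V.
Proof. by move=> ps /finite_noeth/(noeth_surj ps)/noeth_finite. Qed.

Lemma finfree_finite P : finfree P -> finite_module P.
Proof. by move/finfree_noeth/noeth_finite. Qed.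

Lemma finite_ses X : finite_module X ->
  exists (K P : lmodType A) (i : {linear K -> P}) (p : {linear P -> X}),
  [/\ finfree P, finite_module K & ses i p].
Proof.
move=> /fg_cover[P [p [Pf ps]]]; have [K [i ip]] := ker_ses ps.
exists K, P, i, p; split=> //; apply: (@finite_inj _ _ i); first by case: ip.
exact: finfree_finite.
Qed.

End Noetherian.

(** * Tensor evaluation *)

Section TensorEvaluation.
Variable A : comPzRingType.
Implicit Types U V W X I J : lmodType A.

Fact tev_bilin U I J :
  bilin (fun (u : U) (phi : lhom I J) => lam (lcomp (lap phi) (lev I u)) : lhom (lhom U I) J).
Proof.
split=> [phi|u] a v w; apply: lamP => f //.
rewrite -[LHS]/(lap phi (lap f (a *: v + w))).
by rewrite !linearP.
Qed.
Definition tev U I J : {linear tens U (lhom I J) -> lhom (lhom U I) J} :=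
  tlift (@tev_bilin U I J).
Lemma tevE U I J (u : U) (phi : lhom I J) f :
  lap (tev U I J (pure u phi)) f = lap phi (lap f u).
Proof. by rewrite tliftE. Qed.

Lemma tev_natl U V I J (g : {linear U -> V}) t f :
  lap (tev V I J (tmap g (lid _) t)) f = lap (tev U I J t) (lpre I g f).
Proof.
pose l := lcomp (lev J f) (lcomp (tev V I J) (tmap g (lid _))).
pose r := lcomp (lev J (lpre I g f)) (tev U I J).
apply: (tens_ext (f := l) (g := r)) => u phi.
rewrite /l /r !lcompE tmapE.
by rewrite -[LHS]/(lap (tev V I J _) f) -[RHS]/(lap (tev U I J _) _) !tevE.
Qed.

Lemma tev_natr U I I' J (g : {linear I -> I'}) t f :
  lap (tev U I J (tmap (lid _) (lpre J g) t)) f = lap (tev U I' J t) (lpost U g f).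
Proof.
pose l := lcomp (lev J f) (lcomp (tev U I J) (tmap (lid _) (lpre J g))).
pose r := lcomp (lev J (lpost U g f)) (tev U I' J).
apply: (tens_ext (f := l) (g := r)) => u phi.
rewrite /l /r !lcompE tmapE.
by rewrite -[LHS]/(lap (tev U I J _) f) -[RHS]/(lap (tev U I' J _) _) !tevE.
Qed.

Lemma tev_inj_ext U I J : injective (tev U I J) <->
  forall t, (forall f, lap (tev U I J t) f = 0) -> t = 0.
Proof.
rewrite -lin_inj0; split=> h t.
  by move=> e; apply: h; apply: lamP.
by move=> e; apply: h => f; rewrite e.
Qed.

Lemma tens_ring W (t : tens A^o W) : exists w, t = pure (1 : A^o) w.
Proof.
rewrite [t]tens_sum; elim: (repr t) => [|p s [w IHs]].
  by exists 0; rewrite big_nil pure0r.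
exists (p.1 *: p.2 + w); rewrite big_cons IHs pure_linr; congr (_ + _).
by rewrite -pureZl; congr pure; rewrite [RHS](mulr1 (p.1 : A)).
Qed.

Fact rscale_linear U (u : U) : linear (fun a : A^o => (a : A) *: u).
Proof. by move=> a b c; rewrite scalerDl -scalerA. Qed.
Definition rscale U (u : U) : {linear A^o -> U} := mklin (rscale_linear u).

Lemma rscale1 U (f : {linear A^o -> U}) : rscale (f 1) =1 f.
Proof.
move=> a; rewrite -[LHS]/((a : A) *: f 1) -linearZ; congr (f _).
exact: mulr1.
Qed.

Definition tev_bij U := forall I J, injective (tev U I J) /\ forall g, exists t, tev U I J t = g.

Lemma tev_ring : tev_bij A^o.
Proof.
move=> I J; split=> [|g].
  apply/tev_inj_ext => t; have [phi ->] := tens_ring t => h.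
  rewrite (_ : phi = 0) ?pure0r //; apply: lamP => i.
  by have := h (rscale i); rewrite tevE -[lap (rscale i) 1]/(1 *: i) scale1r.
have hl : linear (fun i : I => lap g (lam (rscale i))).
  move=> a u v; rewrite -linearP; congr (lap g _); apply: lamP => b.
  by rewrite -[LHS]/(b *: (a *: u + v)) scalerDr scalerA mulrC -scalerA.
exists (pure (1 : A^o) (lam (mklin hl))); apply: lamP => f; rewrite tevE.
rewrite -[LHS]/(lap g (lam (rscale (lap f 1)))); congr (lap g _).
by apply: lamP => a; exact: rscale1.
Qed.

Lemma tens_prod U V W (t : tens (U * V)%type W) :
  t = tmap (linl U V) (lid W) (tmap (lfst U V) (lid W) t)
    + tmap (linr U V) (lid W) (tmap (lsnd U V) (lid W) t).
Proof.
pose r := ladd (lcomp (tmap (linl U V) (lid W)) (tmap (lfst U V) (lid W)))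
               (lcomp (tmap (linr U V) (lid W)) (tmap (lsnd U V) (lid W))).
apply: (tens_ext (f := lid _) (g := r)) => -[u v] w.
rewrite -[RHS]/(tmap (linl U V) (lid W) (tmap (lfst U V) (lid W) (pure (u, v) w))
    + tmap (linr U V) (lid W) (tmap (lsnd U V) (lid W) (pure (u, v) w))).
rewrite !tmapE -[pure _ _ + _]/(pure (u, 0) w + pure (0, v) w).
rewrite -[pure (u, 0) w]scale1r -pure_linl; congr pure; rewrite scale1r.
by congr pair; rewrite /= ?addr0 ?add0r.
Qed.

Lemma tev_prod U V : tev_bij U -> tev_bij V -> tev_bij (U * V)%type.
Proof.
move=> hU hV I J; have [Ui Us] := hU I J; have [Vi Vs] := hV I J; split=> [|g].
  apply/tev_inj_ext => t h; rewrite [t]tens_prod.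
  have -> : tmap (lfst U V) (lid (lhom I J)) t = 0.
    by apply: (tev_inj_ext _ _ _).1 Ui _ _ => f; rewrite tev_natl.
  have -> : tmap (lsnd U V) (lid (lhom I J)) t = 0.
    by apply: (tev_inj_ext _ _ _).1 Vi _ _ => f; rewrite tev_natl.
  by rewrite !linear0 addr0.
have [s sE] := Us (lam (lcomp (lap g) (lpre I (lfst U V)))).
have [r rE] := Vs (lam (lcomp (lap g) (lpre I (lsnd U V)))).
exists (tmap (linl U V) (lid _) s + tmap (linr U V) (lid _) r); apply: lamP => f.
rewrite linearD -[LHS]/(lap (tev _ I J (tmap (linl U V) (lid _) s)) f
  + lap (tev _ I J (tmap (linr U V) (lid _) r)) f) !tev_natl sE rE.
rewrite -[LHS]/(lap g (lpre I (lfst U V) (lpre I (linl U V) f))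
   + lap g (lpre I (lsnd U V) (lpre I (linr U V) f))) -linearD; congr (lap g _).
apply: lamP => -[u v]; rewrite -[LHS]/(lap f (u, 0) + lap f (0, v)) -linearD.
by congr (lap f _); congr pair; rewrite /= ?addr0 ?add0r.
Qed.

Lemma tev_finfree P : finfree P -> tev_bij P.
Proof.
by elim=> [|P' _ IH]; [exact: tev_ring | exact: tev_prod tev_ring IH].
Qed.

Hypothesis An : noetherian A.

Lemma tev_surj U I J : finite_module U -> injective_module J ->
  forall g, exists t, tev U I J t = g.
Proof.
move=> /fg_cover[P [p [Pf ps]]] Ji g.
have pi : injective (lpre I p).
  apply/lin_inj0 => f fp; apply: lamP => u; have [v <-] := ps u.
  by rewrite -[LHS]/(lap (lpre I p f) v) fp.
have [h hE] := Ji _ _ (lpre I p) (lap g) pi.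
have [t tE] := (tev_finfree Pf I J).2 (lam h).
exists (tmap p (lid _) t); apply: lamP => f; rewrite tev_natl tE.
exact: hE.
Qed.

Lemma tmap_surj U V W (p : {linear U -> V}) :
  (forall v, exists u, p u = v) -> forall t, exists s, tmap p (lid W) s = t.
Proof.
move=> ps t; rewrite [t]tens_sum; elim: (repr t) => [|[v w] r [s IHr]].
  by exists 0; rewrite big_nil linear0.
have [u uE] := ps v; exists (pure u w + s).
by rewrite big_cons linearD tmapE uE IHr.
Qed.

Lemma tev_inj U I J : finite_module U -> injective_module J -> injective (tev U I J).
Proof.
move=> Uf Ji; have [K [P [i [p [Pf Kf ip]]]]] := finite_ses An Uf.
have [ii ps ie] := ip; apply/tev_inj_ext => t h; have [s sE] := tmap_surj ps t.
have [k kE] : exists k : {linear lhom K I -> J}, k \o lpre I i =1 lap (tev P I J s).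
  apply: (injective_exact (f := lpre I p)) => // [f fi|f].
    have [v /ie[u <-]|g gE] := @factor_surj _ _ _ _ p (lap f) ps.
      by rewrite -[LHS]/(lap (lpre I i f) u) fi.
    by exists (lam g); apply: lamP.
  by rewrite -tev_natl sE h.
have [r rE] := tev_surj Kf Ji (lam k).
have si : tmap i (lid _) r = s.
  apply: (tev_finfree Pf I J).1; apply: lamP => f; rewrite tev_natl rE.
  exact: kE.
rewrite -sE -si -[LHS]/(lcomp (tmap p (lid _)) (tmap i (lid _)) r).
apply: (tens_ext (g := lzero _ _)) => u phi.
rewrite lcompE !tmapE (ses_comp _ ip) -[0 in LHS](scale0r 0) pureZl.
exact: scale0r.
Qed.

End TensorEvaluation.

Section FiniteTensor.
Variable A : comPzRingType.
Hypothesis An : noetherian A.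
Implicit Types B F G I J K U V W : lmodType A.

Definition evalt B J : {linear tens B (lhom B J) -> J} := tuncurry (lid (lhom B J)).

Lemma evaltE B J b (phi : lhom B J) : evalt B J (pure b phi) = lap phi b.
Proof. exact: tuncurryE. Qed.

Lemma evalt_tev B J t : evalt B J t = lap (tev B B J t) (lam (lid B)).
Proof.
apply: (tens_ext (f := evalt B J) (g := lcomp (lev J (lam (lid B))) (tev B B J))) => b phi.
by rewrite evaltE lcompE -[RHS]/(lap (tev B B J _) _) tevE.
Qed.

Lemma evalt_bij B J : finite_module B -> bijective (@homothety A B) -> injective_module J ->
  injective (evalt B J) /\ forall j, exists t, evalt B J t = j.
Proof.
move=> Bf [s sK Ks] Ji.
have hom f : lam (lap f) = s f *: lam (lid B) :> lhom B B.
  by apply: lamP => b; rewrite -{1}[f]Ks.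
split=> [|j].
  apply/lin_inj0 => t; rewrite evalt_tev => e.
  apply: (tev_inj_ext _ _ _).1 (tev_inj An Bf Ji) _ _ => f.
  by rewrite -[f]/(lam (lap f)) hom linearZ /= e scaler0.
have hl : linear (fun f : lhom B B => s f *: j).
  move=> a f g; rewrite scalerA -scalerDl; congr (_ *: _).
  apply: (can_inj sK); rewrite Ks; apply: lamP => b.
  have sE h : h = s h *: lam (lid B) by rewrite -hom.
  rewrite {1}[f]sE {1}[g]sE.
  by rewrite -[LHS]/(a *: (s f *: b) + s g *: b) scalerA -scalerDl.
have [t tE] := tev_surj Bf Ji (lam (mklin hl)).
exists t; rewrite evalt_tev tE -[LHS]/(s (lam (lid B)) *: j).
rewrite (_ : s _ = 1) ?scale1r //; apply: (can_inj sK); rewrite Ks.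
by apply: lamP => b; rewrite -[RHS]/(1 *: b) scale1r.
Qed.

Lemma tmap_idK B U V (f : {linear U -> V}) (g : {linear V -> U}) :
  (forall u, g (f u) = u) -> forall t, tmap (lid B) g (tmap (lid B) f t) = t.
Proof.
move=> gf; apply: (tens_ext (f := lcomp (tmap _ g) (tmap _ f)) (g := lid _)) => b u.
by rewrite lcompE !tmapE gf.
Qed.

Section FlatHom.
Variables (E : lmodType A).
Hypotheses (Einj : injective_module E) (Ecog : cogenerator E).
Variables (B F : lmodType A).
Hypotheses (Bf : finite_module B) (Fflat : flat F).

Let Fdual := flat_dual Einj Fflat.

Fact curryd_linear : linear (fun h : lhom (tens B F) E =>
  lam (tcurry (lcomp (lap h) (tswap F B))) : lhom B (lhom F E)).
Proof.
move=> a f g; apply: lamP => b; apply: lamP => x.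
rewrite -[LHS]/(lap (tcurry (lcomp (lap (a *: f + g)) (tswap F B)) b) x) tcurryE.
rewrite -[RHS]/(a *: lap (tcurry (lcomp (lap f) (tswap F B)) b) x +
   lap (tcurry (lcomp (lap g) (tswap F B)) b) x).
by rewrite !tcurryE !lcompE.
Qed.
Definition curryd : {linear lhom (tens B F) E -> lhom B (lhom F E)} := mklin curryd_linear.

Lemma currydE h b x : lap (lap (curryd h) b) x = lap h (pure b x).
Proof.
rewrite -[LHS]/(lap (tcurry (lcomp (lap h) (tswap F B)) b) x) tcurryE lcompE.
by rewrite tswapE.
Qed.

Fact uncurryd_linear : linear (fun k : lhom B (lhom F E) =>
  lam (lcomp (tuncurry (lap k)) (tswap B F)) : lhom (tens B F) E).
Proof.
move=> a f g; apply: lamP.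
apply: (tens_ext (g := ladd (lscale a (lcomp (tuncurry (lap f)) (tswap B F)))
   (lcomp (tuncurry (lap g)) (tswap B F)))) => b x.
rewrite -[LHS]/(tuncurry (lap (a *: f + g)) (tswap B F (pure b x))).
rewrite -[RHS]/(a *: tuncurry (lap f) (tswap B F (pure b x)) +
   tuncurry (lap g) (tswap B F (pure b x))).
by rewrite tswapE !tuncurryE.
Qed.
Definition uncurryd : {linear lhom B (lhom F E) -> lhom (tens B F) E} :=
  mklin uncurryd_linear.

Lemma uncurrydE k b x : lap (uncurryd k) (pure b x) = lap (lap k b) x.
Proof.
rewrite -[LHS]/(tuncurry (lap k) (tswap B F (pure b x))).
by rewrite tswapE tuncurryE.
Qed.

Lemma currydK h : uncurryd (curryd h) = h.
Proof.
apply: lamP; apply: (tens_ext (f := lap _) (g := lap _)) => b x.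
by rewrite uncurrydE currydE.
Qed.

Lemma uncurrydK k : curryd (uncurryd k) = k.
Proof. by apply: lamP => b; apply: lamP => x; rewrite currydE uncurrydE. Qed.

Definition unit_tens : {linear F -> lhom B (tens B F)} := tcurry (lid (tens B F)).
Lemma unit_tensE x b : lap (unit_tens x) b = pure b x.
Proof. exact: tcurryE. Qed.

Lemma unit_tens_dual t : lpre E unit_tens (tev B (tens B F) E t) =
  evalt B (lhom F E) (tmap (lid B) curryd t).
Proof.
pose l := lcomp (lpre E unit_tens) (tev B (tens B F) E).
pose r := lcomp (evalt B (lhom F E)) (tmap (lid B) curryd).
apply: (tens_ext (f := l) (g := r)) => b phi.
rewrite /l /r !lcompE tmapE evaltE; apply: lamP => x.
rewrite -[LHS]/(lap (tev B (tens B F) E (pure b phi)) (unit_tens x)) tevE.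
by rewrite unit_tensE -currydE.
Qed.

Lemma unit_tens_bij : bijective (@homothety A B) ->
  injective unit_tens /\ forall h, exists x, unit_tens x = h.
Proof.
move=> Bh; have [ei es] := evalt_bij Bf Bh Fdual.
have ti := tev_inj An (I := tens B F) Bf Einj; have ts := tev_surj (I := tens B F) Bf Einj.
split.
  apply: (cog_inj Ecog) => h; have [t tE] := es (lam h).
  exists (lap (tev B (tens B F) E (tmap (lid B) uncurryd t))) => x.
  rewrite -[LHS]/(lap (lpre E unit_tens (tev B (tens B F) E (tmap (lid B) uncurryd t))) x).
  rewrite unit_tens_dual tmap_idK ?tE //; exact: uncurrydK.
move=> g; apply: (cog_range Ecog) => h hE.
have [t tE] := ts (lam h).
suff t0 : t = 0 by rewrite -[h _]/(lap (lam h) _) -tE t0 linear0.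
rewrite -(tmap_idK (f := curryd) (g := uncurryd) currydK t).
rewrite (_ : tmap _ curryd t = 0) ?linear0 //; apply: ei.
rewrite -unit_tens_dual tE linear0; apply: lamP => x; exact: hE.
Qed.

Lemma lpre_tens_surj G K (i : {linear K -> G}) : finite_module K -> finite_module G ->
  (forall f : {linear K -> B}, exists g : {linear G -> B}, g \o i =1 f) ->
  forall f : {linear K -> tens B F}, exists g : {linear G -> tens B F}, g \o i =1 f.
Proof.
move=> Kf Gf H f.
suff [g gE] : exists g, lpre (tens B F) i g = lam f.
  by exists (lap g) => k; rewrite -[RHS]/(lap (lam f) k) -gE.
apply: (cog_range Ecog) => h hE.
have [t tE] := tev_surj (I := tens B F) Kf Einj (lam h).
suff t0 : t = 0 by rewrite -[h _]/(lap (lam h) _) -tE t0 linear0.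
have it0 : tmap i (lid _) t = 0.
  apply: (tev_inj_ext _ _ _).1 (tev_inj An Gf Einj) _ _ => k.
  by rewrite tev_natl tE; exact: hE.
rewrite -(tmap_idK (f := curryd) (g := uncurryd) currydK t).
rewrite (_ : tmap _ curryd t = 0) ?linear0 //.
apply: (tev_inj_ext _ _ _).1 (tev_inj An Kf Fdual) _ _ => k.
have [k' k'E] := H (lap k).
have -> : k = lpre B i (lam k') by apply: lamP => b; rewrite -[LHS]k'E.
rewrite -tev_natl.
pose c := lcomp (tmap i (lid (lhom B (lhom F E)))) (tmap (lid K) curryd).
pose d := lcomp (tmap (lid G) curryd) (tmap i (lid (lhom (tens B F) E))).
rewrite -[tmap i _ _]/(c t).
have -> : c t = d t.
  by apply: (tens_ext (f := c) (g := d)) => u phi; rewrite /c /d !lcompE !tmapE.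
by rewrite /d lcompE it0 !linear0.
Qed.

Lemma finite_flat_projective : finite_module F -> projective F.
Proof.
move=> Ff V W p f /surjP ps.
suff [g gE] : exists g, lpost F p g = lam f.
  by exists (lap g) => k; rewrite -[RHS]/(lap (lam f) k) -gE.
apply: (cog_range Ecog) => h hE.
have [t tE] := tev_surj (I := W) Ff Einj (lam h).
suff t0 : t = 0 by rewrite -[h _]/(lap (lam h) _) -tE t0 linear0.
have pi : injective (lpre E p).
  apply/lin_inj0 => k kp; apply: lamP => u; have [v <-] := ps u.
  by rewrite -[LHS]/(lap (lpre E p k) v) kp.
apply: (flat_tmap_inj Fflat pi); rewrite linear0.
apply: (tev_inj_ext _ _ _).1 (tev_inj An Ff Einj) _ _ => k.
by rewrite tev_natr tE; exact: hE.
Qed.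

End FlatHom.

Lemma dual_injective_flat E I : injective_module E -> cogenerator E ->
  injective_module I -> flat (lhom I E).
Proof.
move=> Einj Ecog Ii; apply: (dual_flat Ecog); apply: baer_injective => a f.
have af : finite_module (subm a).
  exact: (finite_inj An (@subinc_inj _ _ a) (noeth_finite An)).
have ii : injective (tmap (subinc a) (lid (lhom I E))).
  apply/lin_inj0 => t t0; apply: (tev_inj_ext _ _ _).1 (tev_inj An af Einj) _ _ => k.
  have [h hE] := Ii _ _ _ (lap k) (@subinc_inj _ _ a).
  have -> : k = lpre I (subinc a) (lam h) by apply: lamP => b; rewrite -[LHS]hE.
  by rewrite -tev_natl t0 linear0.
have [h hE] := Einj _ _ _ (lcomp (tuncurry f) (tswap _ _)) ii.
exists (lam (lcomp h (purer (lhom I E) (1 : A^o)))) => b; apply: lamP => phi.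
have := hE (pure b phi); rewrite lcompE tswapE tuncurryE => <-.
rewrite -[LHS]/(h (tmap (subinc a) (lid _) (pure b phi))) tmapE.
rewrite -[RHS]/((subinc a b : A) *: h (pure (1 : A^o) phi)) -linearZ -pureZl.
by congr (h (pure _ _)); rewrite [RHS](mulr1 (subinc a b : A)).
Qed.

End FiniteTensor.

(** * Vanishing of Ext *)

Section ExtVanishing.
Variable A : comPzRingType.
Implicit Types G K P U V W X : lmodType A.

Definition extends K G (i : {linear K -> G}) W : Prop :=
  forall f : {linear K -> W}, exists g : {linear G -> W}, g \o i =1 f.

(* [Ext^j(X, W) = 0] for [1 <= j <= n], tested on one projective presentation
   of each syzygy, respectively on all of them. *)
Fixpoint ext_vanish (n : nat) X W : Prop :=
  if n is m.+1 then
    exists (K G : lmodType A) (i : {linear K -> G}) (p : {linear G -> X}),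
      [/\ ses i p, projective G, extends i W & ext_vanish m K W]
  else True.

Fixpoint ext_vanish_all (n : nat) X W : Prop :=
  if n is m.+1 then
    forall (K G : lmodType A) (i : {linear K -> G}) (p : {linear G -> X}),
      ses i p -> projective G -> extends i W /\ ext_vanish_all m K W
  else True.

Lemma ext_vanish_prod n X P W : projective P -> ext_vanish n X W -> ext_vanish n (X * P)%type W.
Proof.
case: n => // n Pp [K [G [i [p [[ii ps ie] Gp ext eK]]]]].
exists K, (G * P)%type, (lcomp (linl G P) i).
exists (lpair (lcomp p (lfst G P)) (lsnd G P)); split=> //.
- split=> [k k' [] /ii //|[x u]|[g u]].
    by have [g <-] := ps x; exists (g, u).
  split; last by case=> k /= [<- <-]; rewrite (_ : p (i k) = 0) //; apply/ie; exists k.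
  by move=> /= -[/ie[k <-] ->]; exists k.
- exact: proj_prod.
- move=> f; have [g gE] := ext f; exists (lcomp g (lfst G P)) => k; exact: gE.
Qed.

(* The usual comparison of projective presentations; the syzygy of [X'] is a
   retract of the sum of the syzygy of [X] and a projective module. *)
Lemma ext_vanish_ext_vanish_all n X X' W (s : {linear X' -> X}) (r : {linear X -> X'}) :
  (forall x, r (s x) = x) -> ext_vanish n X W -> ext_vanish_all n X' W.
Proof.
elim: n X X' s r => // n IHn X X' s r rs [K [G [i [p [ip Gp ext eK]]]]].
move=> K' G' i' p' ip' G'p; have [ii ps ie] := ip; have [ii' ps' ie'] := ip'.
have [s1 s1E] := proj_lift (lcomp s p') G'p ps.
have [r1 r1E] := proj_lift (lcomp r p) Gp ps'.
have [k|s2 s2E] := @factor_inj _ _ _ _ i (lcomp s1 i') ii.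
  by apply/ie; rewrite lcompE s1E lcompE (ses_comp _ ip') linear0.
have [k|r2 r2E] := @factor_inj _ _ _ _ i' (lcomp r1 i) ii'.
  by apply/ie'; rewrite lcompE r1E lcompE (ses_comp _ ip) linear0.
have [g|h hE] := @factor_inj _ _ _ _ i' (lsub (lid G') (lcomp r1 s1)) ii'.
  by apply/ie'; rewrite /= linearB r1E lcompE s1E lcompE rs subrr.
have key k : r2 (s2 k) + h (i' k) = k.
  apply: ii'; rewrite linearD r2E lcompE s2E lcompE hE /=.
  by rewrite addrC subrK.
split=> [f|].
  have [g gE] := ext (lcomp f r2); exists (ladd (lcomp g s1) (lcomp f h)) => k.
  rewrite -[RHS]/(f k) -{2}[k]key linearD; congr (_ + _).
  by rewrite lcompE -[s1 (i' k)]/(lcomp s1 i' k) -s2E -[LHS]/((g \o i) (s2 k)) gE.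
apply: (IHn (K * G')%type K' (lpair s2 i') (lcase r2 h)) => //.
exact: ext_vanish_prod.
Qed.

Lemma ext_vanish_all_lift K W1 W2 W3 (j : {linear W1 -> W2}) (q : {linear W2 -> W3}) :
  ses j q -> ext_vanish_all 1 K W1 ->
  forall f : {linear K -> W3}, exists g : {linear K -> W2}, forall k, q (g k) = f k.
Proof.
move=> [ji qs je] eK f; have [P [p [Pp ps]]] := enough_projective K.
have [L [i ip]] := ker_ses ps; have [ext _] := eK _ _ _ _ ip Pp.
have [g gE] := proj_lift (lcomp f p) Pp qs.
have [l|h hE] := @factor_inj _ _ _ _ j (lcomp g i) ji.
  by apply/je; rewrite lcompE gE lcompE (ses_comp _ ip) linear0.
have [k kE] := ext h; have [ii _ ie] := ip.
have [u /ie[l <-]|m mE] := @factor_surj _ _ _ _ p (lsub g (lcomp j k)) ps.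
  by rewrite /= (_ : k (i l) = h l) ?hE ?subrr //; exact: kE.
exists m => x; have [u <-] := ps x; rewrite mE /= linearB gE.
by rewrite (_ : q (j _) = 0) ?subr0 //; apply/je; exists (k u).
Qed.

Lemma ext_vanish_all_le n m X W : (n <= m)%N -> ext_vanish_all m X W -> ext_vanish_all n X W.
Proof.
elim: n m X => // n IHn [|m] X //; rewrite ltnS => nm h K G i p ip Gp.
by have [h1 h2] := h _ _ _ _ ip Gp; split=> //; exact: IHn nm h2.
Qed.

Lemma ext_vanish_all_coker n X W1 W2 W3 (j : {linear W1 -> W2}) (q : {linear W2 -> W3}) :
  ses j q -> ext_vanish_all n.+1 X W1 -> ext_vanish_all n X W2 -> ext_vanish_all n X W3.
Proof.
move=> jq; elim: n X => // n IHn X e1 e2 K G i p ip Gp.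
have [_ eK1] := e1 _ _ _ _ ip Gp; have [ext eK2] := e2 _ _ _ _ ip Gp.
split=> [f|]; last exact: IHn eK1 eK2.
have [g gE] := ext_vanish_all_lift jq (ext_vanish_all_le (isT : (1 <= n.+1)%N) eK1) f.
have [h hE] := ext g; exists (lcomp q h) => k.
by rewrite -gE -hE.
Qed.

Lemma Ext_pos_ext_vanish X W : Ext_pos_eq0 X W -> forall n, ext_vanish n X W.
Proof.
case=> -[P Pp d e [/surjP es /exactP e0 ex]] /= dual n.
have key : forall n k (X' : lmodType A) (q : {linear P k -> X'}),
    (forall x, exists u, q u = x) -> (forall u, q u = 0 <-> exists v, d k v = u) ->
    ext_vanish n X' W.
  elim=> // {}n IHn k X' q qs qe.
  have [K [i ip]] := ker_ses qs; have [ii _ ie] := ip.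
  have [v|c cE] := @factor_inj _ _ _ _ i (d k) ii.
    by apply/ie/qe; exists v.
  have cs x : exists v, c v = x.
    have /qe[v vE] : q (i x) = 0 by apply/ie; exists x.
    by exists v; apply: ii; rewrite cE.
  have ck v : c v = 0 <-> exists w, d k.+1 w = v.
    have /exactP h := ex k; rewrite -h -cE; split=> [->|]; first exact: linear0.
    by move=> e1; apply: ii; rewrite e1 linear0.
  exists K, (P k), i, q; split=> //; last exact: IHn cs ck.
  move=> f; have /exactP h := dual k.
  have [|g gE] := (h (lam (lcomp f c))).1.
    apply: lamP => w; rewrite -[LHS]/(f (c (d k.+1 w))) (_ : c _ = 0) ?linear0 //.
    by apply/ck; exists w.
  exists (lap g) => x; have [v <-] := cs x.
  have := congr1 (fun l => lap l v) gE; rewrite -[lap (lam _) v]/(f (c v)) => <-.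
  by rewrite -[LHS]/(lap g (i (c v))) cE.
exact: key es e0.
Qed.

End ExtVanishing.

(** * Homomorphisms out of a faithful finite module *)

Section NoetherianMax.
Variables (A : comPzRingType) (X : lmodType A).

Lemma noeth_max (P : set X -> Prop) (N0 : set X) : noeth X ->
  (forall N, P N -> submodule N) -> P N0 ->
  exists N, P N /\ forall N', P N' -> N `<=` N' -> N' `<=` N.
Proof.
move=> nX Psub P0; apply: (Zorn_set P0) => F FP tot [S0 FS0].
have sU : submodule (\bigcup_(Y in F) Y).
  split; first by exists S0 => //; have [] := Psub _ (FP _ FS0).
  move=> a u v [Y FY Yu] [Z FZ Zv].
  have [YZ|ZY] := tot Y Z FY FZ.
    by exists Z => //; have [_ h] := Psub _ (FP _ FZ); apply: h => //; exact: YZ.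
  by exists Y => //; have [_ h] := Psub _ (FP _ FY); apply: h => //; exact: ZY.
have [s sE] := nX _ sU.
have [Y FY sY] : exists2 Y, F Y & forall u, u \in s -> Y u.
  have : forall u, u \in s -> (\bigcup_(Y in F) Y) u by rewrite sE => u; exact: lspan_mem.
  elim: s {sE} => [|u s IHs] h; first by exists S0.
  have [|Y FY sY] := IHs; first by move=> v vs; apply: h; rewrite inE vs orbT.
  have [Z FZ Zu] := h u (mem_head _ _).
  have [YZ|ZY] := tot Y Z FY FZ.
    by exists Z => // v; rewrite inE => /orP[/eqP->//|/sY /YZ].
  by exists Y => // v; rewrite inE => /orP[/eqP->|/sY //]; exact: ZY.
rewrite (_ : \bigcup_(Z in F) Z = Y); first exact: FP.
rewrite eqEsubset; split=> u; last by exists Y.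
by rewrite sE; apply: (lspan_min (N := Submod (Psub _ (FP _ FY)))).
Qed.

End NoetherianMax.

Section HomFaithful.
Variables (A : comPzRingType) (B M : lmodType A).
Hypotheses (An : noetherian A) (Bf : finite_module B).
Hypothesis faithful : forall a : A, (forall b : B, a *: b = 0) -> a = 0.
Hypothesis Hom0 : forall (f : {linear B -> M}) b, f b = 0.

Let prime (v : M) := forall a b : A, a *: v <> 0 -> (b * a) *: v = 0 -> b *: v = 0.

Let exists_prime (v0 : M) : v0 <> 0 -> exists2 v, v <> 0 & prime v.
Proof.
move=> v00; pose P (I : set A^o) := exists2 v : M, v <> 0 & I = [set a : A^o | (a : A) *: v = 0].
have [| |N [[v vn0 NE] max]] := @noeth_max A A^o P [set a : A^o | (a : A) *: v0 = 0] An.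
- move=> _ [v _ ->]; split=> [|a b c /= hb hc]; first exact: scale0r.
  by rewrite scalerDl -scalerA hb hc scaler0 addr0.
- by exists v0.
exists v => // a b av bav; have := max [set c : A^o | (c : A) *: (a *: v) = 0].
rewrite NE => /(_ _ _ b); apply; first by exists (a *: v).
  by move=> c /= cv; rewrite scalerA mulrC -scalerA cv scaler0.
by rewrite /= scalerA.
Qed.

Fixpoint pspan (v : M) (s : seq B) (z : B) : Prop :=
  if s is u :: t then exists a w, [/\ (a : A) *: v = 0, pspan v t w & z = a *: u + w]
  else z = 0.

Let pspan_sub v s : submodule (pspan v s).
Proof.
elim: s => [|u s [s0 sP]] /=.
  by split=> // a x y -> ->; rewrite scaler0 addr0.
split=> [|a x y [b [w [bv ws ->]]] [c [z [cv zs ->]]]].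
  by exists 0, 0; rewrite !scale0r addr0.
exists (a * b + c), (a *: w + z); split; last by rewrite scalerDr scalerDl scalerA addrACA.
  by rewrite scalerDl -scalerA bv cv scaler0 addr0.
exact: sP.
Qed.
Let psub v s := Submod (pspan_sub v s).

(* Write [a x = r(x) u + ..]; if the coefficient [r(x)] were well defined modulo
   the annihilator of [v], then [x |-> r(x) v] would be a nonzero map [B -> M]. *)
Let step1 v u s t : v <> 0 -> prime v ->
  (exists2 a, a *: v <> 0 & forall x : B, exists r w z, [/\ lspan t w, pspan v s z & a *: x = r *: u + w + z]) ->
  exists2 a, a *: v <> 0 & forall x : B, exists w z, [/\ lspan t w, pspan v s z & a *: x = w + z].
Proof.
move=> vn0 pv [a av aB].
have sL : submodule [set x : B | exists w z, [/\ lspan t w, pspan v s z & x = w + z]].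
  split=> [|c _ _ [w [z [wt zs ->]]] [w' [z' [wt' zs' ->]]]] /=.
    exists 0, 0; rewrite addr0; split=> //; first exact: (submod0 (spansub t)).
    exact: (submod0 (psub v s)).
  exists (c *: w + w'), (c *: z + z'); rewrite scalerDr addrACA; split=> //.
    exact: (submodP (N := spansub t)).
  exact: (submodP (N := psub v s)).
pose L := Submod sL.
have /choice[r rE] : forall x, exists r, L (a *: x - r *: u).
  move=> x; have [r [w [z [wt zs ->]]]] := aB x; exists r, w, z; split=> //.
  by rewrite -[_ + _ + z]addrA [LHS]addrC addKr.
have [[c Lc cv]|none] := pselect (exists2 c, L (c *: u) & c *: v <> 0).
  exists (c * a) => [|x]; first by move=> /(pv _ _ av).
  have : L ((c * a) *: x); last by [].
  have := submodD (submodZ c (rE x)) (submodZ (r x) Lc).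
  by rewrite scalerBr !scalerA [r x * c]mulrC subrK.
have Lv c : L (c *: u) -> c *: v = 0.
  by move=> Lc; have [//|cv] := pselect (c *: v = 0); case: none; exists c.
have fl : linear (fun x : B => r x *: v).
  move=> c x y; apply/eqP; rewrite -subr_eq0 scalerA -scalerDl -scalerBl; apply/eqP/Lv.
  have := submodB (submodP c (rE x) (rE y)) (rE (c *: x + y)).
  congr (L _); rewrite scalerBl scalerDl -scalerA scalerBr scalerDr.
  rewrite (_ : c *: (a *: x) = a *: (c *: x)); last by rewrite !scalerA mulrC.
  by rewrite addrACA -opprD opprB [LHS]addrC subrKA.
case: av; rewrite -(Hom0 (mklin fl) u) /=; apply/eqP; rewrite -subr_eq0 -scalerBl.
by apply/eqP/Lv; rewrite scalerBl.
Qed.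

Let step2 v u t : prime v ->
  (exists2 a, a *: v <> 0 & forall x : B, pspan v (u :: t) (a *: x)) ->
  exists2 a, a *: v <> 0 & forall x : B, pspan v t (a *: x).
Proof.
move=> pv [b bv bB]; have [c [w [cv wt bu]]] := bB u.
have bu' : (b - c) *: u = w by rewrite scalerBl bu addrC addKr.
exists ((b - c) * b) => [|x].
  by move=> /(pv _ _ bv); rewrite scalerBl cv subr0.
have [d [z [dv zt bx]]] := bB x.
rewrite -scalerA bx scalerDr scalerA mulrC -scalerA bu'.
exact: (submodP (N := psub v t) d wt (submodZ (N := psub v t) (b - c) zt)).
Qed.

Lemma Hom_faithful (m : M) : m = 0.
Proof.
apply: contrapT => /exists_prime[v vn0 pv]; have [s sE] := Bf.
have h1 t : suffix t s -> exists2 a, a *: v <> 0 &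
    forall x : B, exists w z, [/\ lspan t w, pspan v s z & a *: x = w + z].
  move=> /suffixP[r rE]; elim/last_ind: r t rE => [|r u IHr] t rE.
    exists 1 => [|x]; first by rewrite scale1r.
    exists x, 0; rewrite scale1r addr0; split=> //; last exact: (submod0 (psub v s)).
    by rewrite -[t]/([::] ++ t) -rE sE.
  apply: (step1 vn0 pv (u := u)); have [|a av aB] := IHr (u :: t).
    by rewrite rE cat_rcons.
  exists a => // x; have [w [z [/lspan_cons[c [w' [w't ->]]] zs ->]]] := aB x.
  by exists c, w', z.
have [a av aB] := h1 [::] (suffix0s s).
have h2 t : suffix t s -> exists2 a, a *: v <> 0 & forall x : B, pspan v t (a *: x).
  move=> /suffixP[r rE]; elim/last_ind: r t rE => [|r u IHr] t rE.
    exists a => // x; have [w [z [/lspan_nil -> zs ->]]] := aB x.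
    by rewrite add0r -[t]/([::] ++ t) -rE.
  by apply: (step2 pv (u := u)); apply: IHr; rewrite rE cat_rcons.
have [b bv bB] := h2 [::] (suffix0s s).
by case: bv; rewrite (faithful bB) scale0r.
Qed.

End HomFaithful.

(** * Finite resolutions and the Foxby equivalence *)

Section Chains.
Variable A : comPzRingType.
Implicit Types F G L M N P Q U V W X : lmodType A.

(* [chain K n X]: a resolution of [X] of the form [0 -> F_(n-1) -> .. -> F_0]
   with all [F_i] in [K]; thus [n = 0] means [X = 0], and [n.+1] dimension
   at most [n]. *)
Fixpoint chain (K : lmodType A -> Prop) (n : nat) X : Prop :=
  if n is m.+1 then
    exists (L F : lmodType A) (i : {linear L -> F}) (p : {linear F -> X}),
      [/\ ses i p, K F & chain K m L]
  else forall x : X, x = 0.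

Fixpoint proper_chain (K : lmodType A -> Prop) (n : nat) X : Prop :=
  if n is m.+1 then
    exists (L F : lmodType A) (i : {linear L -> F}) (p : {linear F -> X}),
      [/\ ses i p, K F, proper_chain K m L &
          forall Q, K Q -> forall g : {linear Q -> X}, exists h : {linear Q -> F},
            forall x, p (h x) = g x]
  else forall x : X, x = 0.

Lemma chain_sub (K K' : lmodType A -> Prop) n X :
  (forall F, K F -> K' F) -> chain K n X -> chain K' n X.
Proof.
move=> KK'; elim: n X => // n IHn X [L [F [i [p [ip FK cL]]]]].
by exists L, F, i, p; split; [| exact: KK' | exact: IHn].
Qed.

Lemma ses_isor U V W W' (i : {linear U -> V}) (p : {linear V -> W}) (h : {linear W -> W'}) :
  ses i p -> injective h -> (forall w, exists v, h v = w) -> ses i (lcomp h p).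
Proof.
move=> [ii ps ie] hi hs; split=> // [w|v].
  by have [v <-] := hs w; have [u <-] := ps v; exists u.
rewrite -ie lcompE; split=> [|->]; last exact: linear0.
by rewrite -(linear0 h) => /hi.
Qed.

Lemma chain_iso (K : lmodType A -> Prop) n X X' (h : {linear X -> X'}) :
  injective h -> (forall w, exists v, h v = w) -> chain K n X -> chain K n X'.
Proof.
case: n => [|n] hi hs; first by move=> X0 x; have [u <-] := hs x; rewrite [u]X0 linear0.
move=> [L [F [i [p [ip FK cL]]]]]; exists L, F, i, (lcomp h p); split=> //.
exact: ses_isor.
Qed.

Lemma trivial_projective X : (forall x : X, x = 0) -> projective X.
Proof.
by move=> X0 U V f g _; exists (lzero _ _) => x; rewrite [x]X0 /= !linear0.
Qed.

Section ResolvingClass.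
Variable K : lmodType A -> Prop.
Hypothesis Kproj : forall P, projective P -> K P.
Hypothesis Kker : forall L F N (i : {linear L -> F}) (p : {linear F -> N}),
  ses i p -> K F -> K N -> K L.
Hypothesis Kprod : forall F G, K F -> K G -> K (F * G)%type.

Lemma chainS n X : chain K n X -> chain K n.+1 X.
Proof.
elim: n X => [|n IHn] X; last first.
  move=> [L [F [i [p [ip FK cL]]]]]; exists L, F, i, p; split=> //; exact: IHn.
move=> X0; exists X, X, (lzero X X), (lid X); split=> //; first exact: lid_ses.
by apply: Kproj; exact: trivial_projective.
Qed.

Lemma chain_le m n X : (m <= n)%N -> chain K m X -> chain K n X.
Proof. by move=> /subnK <- h; elim: (n - m)%N => // k; exact: chainS. Qed.

Lemma chain1 F : K F -> chain K 1 F.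
Proof.
move=> FK; exists (subm (kersub (lid F))), F, (subinc _), (lid F); split=> //.
  apply: lid_ses => u; apply: (@subinc_inj _ _ (kersub (lid F))).
  by rewrite linear0; exact: (subincP u).
by move=> u; apply: (@subinc_inj _ _ (kersub (lid F))); rewrite linear0; exact: (subincP u).
Qed.

Lemma chain_ker n X X' F (i : {linear X' -> X}) (p : {linear X -> F}) :
  ses i p -> K F -> chain K n.+1 X -> chain K n.+1 X'.
Proof.
move=> [ii ps ie] FK [L [F0 [j [q [[ji qs je] F0K cL]]]]].
have pqs w : exists u, lcomp p q u = w.
  by have [v <-] := ps w; have [u <-] := qs v; exists u.
have [M [k kpq]] := ker_ses pqs; have [ki _ ke] := kpq.
have [m|r rE] := @factor_inj _ _ _ _ i (lcomp q k) ii.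
  by apply/ie; rewrite -[LHS]/(lcomp p q (k m)) (ses_comp _ kpq).
have [l|s sE] := @factor_inj _ _ _ _ k j ki.
  by apply/ke; rewrite lcompE (_ : q (j l) = 0) ?linear0 //; apply/je; exists l.
exists L, M, s, r; split=> //; last exact: Kker kpq F0K FK.
split=> [l l' e|x|m].
- by apply: ji; rewrite -!sE e.
- have [u uE] := qs (i x); have /ke[m mE] : lcomp p q u = 0.
    by rewrite lcompE uE; apply/ie; exists x.
  by exists m; apply: ii; rewrite rE lcompE mE.
- split=> [rm|[l <-]]; last first.
    by apply: ii; rewrite rE lcompE sE linear0; apply/je; exists l.
  have /je[l lE] : q (k m) = 0 by rewrite -[LHS]rE rm linear0.
  by exists l; apply: ki; rewrite sE.
Qed.

Lemma chain_prod n X G : projective G -> chain K n.+1 X -> chain K n.+1 (X * G)%type.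
Proof.
move=> Gp [L [F [j [q [[ji qs je] FK cL]]]]].
exists L, (F * G)%type, (lcomp (linl F G) j), (lpair (lcomp q (lfst F G)) (lsnd F G)).
split=> //; last by apply: Kprod => //; exact: Kproj.
split=> [l l' [] /ji //|[x u]|[f u] /=].
  by have [f <-] := qs x; exists (f, u).
by split=> [[/je[l <-] ->]|[l [<- <-]]]; [exists l | congr pair; apply/je; exists l].
Qed.

Lemma chain_syzygy n N M G (i : {linear M -> G}) (p : {linear G -> N}) :
  ses i p -> projective G -> chain K n.+2 N -> chain K n.+1 M.
Proof.
move=> [ii ps ie] Gp [L [F [j [q [[ji qs je] FK cL]]]]].
have [phi phiE] := proj_lift p Gp qs.
have [m|psi psiE] := @factor_inj _ _ _ _ j (lcomp phi i) ji.
  by apply/je; rewrite lcompE phiE; apply/ie; exists m.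
apply: (@chain_ker n (L * G)%type M F (lpair (lsub (lzero _ _) psi) i) (lcase j phi)) => //.
  split=> [m m' [_] /ii //|f|[l u]].
    have [u uE] := ps (q f); have [|l lE] := (je (f - phi u)).1.
      by rewrite linearB phiE uE subrr.
    by exists (l, u); rewrite /= lE subrK.
  split=> [/= e|[m [<- <-]]]; last by rewrite /= sub0r linearN psiE addNr.
  have [|m mE] := (ie u).1.
    have qj : q (j l) = 0 by apply/je; exists l.
    by have := congr1 q e; rewrite linearD qj add0r phiE linear0.
  exists m; congr pair => //=; apply: ji; rewrite sub0r linearN psiE lcompE mE.
  by apply/eqP; rewrite eq_sym -addr_eq0 e.
exact: chain_prod.
Qed.

End ResolvingClass.
End Chains.

Section SemidualizingTheory.
Variable A : comPzRingType.
Implicit Types F G K L M N P Q U V W X : lmodType A.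
Hypothesis An : noetherian A.

Let E : lmodType A := cog A.
Let Einj : injective_module E := @cog_injective A.
Let Ecog : cogenerator E := @cog_cogenerator A.

Lemma projective_isflat P : projective P -> flat P.
Proof. exact: projective_flat Einj Ecog _. Qed.
Lemma flat_isker L F N (i : {linear L -> F}) (p : {linear F -> N}) :
  ses i p -> flat F -> flat N -> flat L.
Proof. exact: flat_ker Einj Ecog _ _ _ _ _. Qed.
Lemma flat_isext L F N (i : {linear L -> F}) (p : {linear F -> N}) :
  ses i p -> flat L -> flat N -> flat F.
Proof. exact: flat_ext Einj Ecog _ _ _ _ _. Qed.
Lemma flat_isprod F G : flat F -> flat G -> flat (F * G)%type.
Proof. exact: flat_isext (prod_ses F G). Qed.

Lemma tmap_surjr B V W (p : {linear V -> W}) :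
  (forall w, exists v, p v = w) -> forall t, exists s, tmap (lid B) p s = t.
Proof.
move=> ps t; rewrite [t]tens_sum; elim: (repr t) => [|[b w] r [s IHr]].
  by exists 0; rewrite big_nil linear0.
have [v vE] := ps w; exists (pure b v + s).
by rewrite big_cons linearD tmapE vE IHr.
Qed.

Lemma tmap_comp0 B U V W (i : {linear U -> V}) (p : {linear V -> W}) :
  (forall u, p (i u) = 0) -> forall t, tmap (lid B) p (tmap (lid B) i t) = 0.
Proof.
move=> pi; apply: (tens_ext (f := lcomp (tmap _ p) (tmap _ i)) (g := lzero _ _)) => b u.
by rewrite lcompE !tmapE pi pure0r.
Qed.

Lemma tmap_exact B U V W (i : {linear U -> V}) (p : {linear V -> W}) :
  ses i p -> forall t, tmap (lid B) p t = 0 -> exists s, tmap (lid B) i s = t.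
Proof.
move=> ip t pt; apply: (cog_range Ecog) => h hi; have [ii ps ie] := ip.
have [v /ie[u <-]|k kE] := @factor_surj _ _ _ _ p (tcurry h) ps.
  by apply: lamP => b; rewrite tcurryE -(tmapE (lid B) i) hi.
rewrite -(linear0 (tuncurry k)) -pt.
apply: (tens_ext (f := h) (g := lcomp (tuncurry k) (tmap (lid B) p))) => b v.
by rewrite lcompE tmapE tuncurryE kE tcurryE.
Qed.

Variable B : lmodType A.
Hypothesis Bf : finite_module B.
Hypothesis Bh : bijective (@homothety A B).
Hypothesis Bext : forall n, ext_vanish n B B.

Let faithful (a : A) : (forall b : B, a *: b = 0) -> a = 0.
Proof.
case: Bh => s sK _ aB; apply: (can_inj sK); apply: lamP => b.
by rewrite -[LHS]/(a *: b) -[RHS]/(0 *: b) aB scale0r.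
Qed.

Lemma Hom_eq0 M : (forall (f : {linear B -> M}) b, f b = 0) -> forall m : M, m = 0.
Proof. by move=> h m; exact: Hom_faithful An Bf faithful h m. Qed.

Lemma ext_vanish_all_flat n F : flat F -> ext_vanish_all n B (tens B F).
Proof.
move=> Ff; apply: (@ext_vanish_ext_vanish_all _ n B B _ (lid B) (lid B)) => //.
have eB : ext_vanish_all n B B by apply: (@ext_vanish_ext_vanish_all _ n B B _ (lid B) (lid B)).
suff gen X : finite_module X -> ext_vanish_all n X B -> ext_vanish n X (tens B F) by exact: gen.
elim: n X {eB} => // n IHn X Xf eX; have [K [G [i [p [Gff Kf ip]]]]] := finite_ses An Xf.
have Gp := finfree_projective Gff.
have [ext eK] := eX _ _ _ _ ip Gp; exists K, G, i, p; split=> //; last exact: IHn.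
exact: (lpre_tens_surj An Einj Ecog Ff Kf (finfree_finite An Gff)).
Qed.

Lemma chain_flat_unit n N : chain (@flat A) n N ->
  [/\ injective (unit_tens B N), forall h, exists x, unit_tens B N x = h &
      forall m, ext_vanish_all m B (tens B N)].
Proof.
elim: n N => [|n IHn] N.
  move=> N0; have T0 : forall t : tens B N, t = 0.
    by apply: (tens_ext (f := lid _) (g := lzero _ _)) => b x; rewrite [x]N0 /= pure0r.
  split=> [x y _|h|m]; first by rewrite [x]N0 [y]N0.
    by exists 0; apply: lamP => b; rewrite [LHS]T0 [RHS]T0.
  suff gen X : ext_vanish_all m X (tens B N) by exact: gen.
  elim: m X => // m IHm X K G i p ip Gp; split=> [f|]; last exact: IHm.
  by exists (lzero _ _) => k; rewrite [RHS]T0.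
move=> [L [F [i [p [ip Ff cL]]]]]; have [ii ps ie] := ip.
have [Li Ls Le] := IHn _ cL; have [Fi Fs] := unit_tens_bij An Einj Ecog Bf Ff Bh.
have pi u : p (i u) = 0 by apply/ie; exists u.
have unat U V (f : {linear U -> V}) u b : tmap (lid B) f (lap (unit_tens B U u) b) = lap (unit_tens B V (f u)) b.
  by rewrite !unit_tensE tmapE.
have ti : injective (tmap (lid B) i).
  apply/lin_inj0 => t t0; pose k := subinc (kersub (tmap (lid B) i)).
  have [u <-] : exists u, k u = t by exact: subinc_ex.
  rewrite (_ : u = 0) ?linear0 //; move: u; apply: Hom_eq0 => f b.
  apply: (@subinc_inj _ _ (kersub (tmap (lid B) i))); rewrite linear0.
  have [l lE] := Ls (lam (lcomp k f)).
  rewrite -[LHS]/(lap (lam (lcomp k f)) b) -lE.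
  rewrite (_ : l = 0) ?linear0 //; apply: ii; rewrite linear0; apply: Fi.
  rewrite linear0; apply: lamP => c; rewrite -unat lE.
  exact: (subincP (f c)).
have tses : ses (tmap (lid B) i) (tmap (lid B) p).
  split=> //; first exact: tmap_surjr.
  by move=> t; split=> [|[s <-]]; [exact: tmap_exact | exact: tmap_comp0].
split.
- apply/lin_inj0 => x; have [f <-] := ps x => e.
  have [b|g gE] := @factor_inj _ _ _ _ (tmap (lid B) i) (lap (unit_tens B F f)) ti.
    by apply: (tmap_exact ip); rewrite unat e.
  have [l lE] := Ls (lam g).
  rewrite (_ : f = i l) ?pi //; apply: Fi; apply: lamP => b.
  by rewrite -gE -unat lE.
- move=> h; have [g gE] := ext_vanish_all_lift tses (Le 1%N) (lap h).
  have [f fE] := Fs (lam g); exists (p f); apply: lamP => b.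
  by rewrite -unat fE -[LHS]/(tmap (lid B) p (g b)) gE.
- by move=> m; apply: (ext_vanish_all_coker tses); [exact: Le | exact: ext_vanish_all_flat].
Qed.

Lemma chain_flat_eval n M : chain (@flat A) n (lhom B M) ->
  injective (evalt B M) /\ forall m, exists t, evalt B M t = m.
Proof.
move=> /chain_flat_unit[ui us ue].
have ev_unit (phi : lhom B M) b : evalt B M (lap (unit_tens B (lhom B M) phi) b) = lap phi b.
  by rewrite unit_tensE evaltE.
have ei : injective (evalt B M).
  apply/lin_inj0 => t t0; pose k := subinc (kersub (evalt B M)).
  have [u <-] : exists u, k u = t by exact: subinc_ex.
  rewrite (_ : u = 0) ?linear0 //; move: u; apply: Hom_eq0 => f b.
  apply: (@subinc_inj _ _ (kersub (evalt B M))); rewrite linear0.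
  have [l lE] := us (lam (lcomp k f)).
  rewrite -[LHS]/(lap (lam (lcomp k f)) b) -lE (_ : l = 0) ?linear0 //.
  by apply: lamP => c; rewrite -ev_unit lE; exact: (subincP (f c)).
split=> //; have [W [q eq]] := coker_ses ei; have [_ qs qe] := eq => m.
apply/qe; move: (q m); apply: Hom_eq0 => f b.
have [g gE] := ext_vanish_all_lift eq (ue 1%N) f.
by rewrite -gE -[g b]/(lap (lam g) b) -ev_unit; apply/qe; eexists.
Qed.

End SemidualizingTheory.

(** * Proper flat resolutions *)

Section Cotorsion.
Variable A : comPzRingType.
Implicit Types D F G L M N P Q U V W X Y : lmodType A.

Definition lflip X Y W (f : {linear X -> lhom Y W}) : {linear Y -> lhom X W} :=
  tcurry (lcomp (tuncurry f) (tswap X Y)).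
Lemma lflipE X Y W (f : {linear X -> lhom Y W}) x y : lap (lflip f y) x = lap (f x) y.
Proof. by rewrite tcurryE (lcompE (tuncurry f)) tswapE tuncurryE. Qed.

Let E : lmodType A := cog A.
Let Einj : injective_module E := @cog_injective A.
Let Ecog : cogenerator E := @cog_cogenerator A.

Definition cotorsion D : Prop := forall Q, flat Q -> ext_vanish_all 1 Q D.

Lemma cotorsion_dual Y : cotorsion (lhom Y E).
Proof.
move=> Q Qf K G i p ip Gp; split=> // f.
have d := dual_ses Einj ip; have [r rE] := inj_split d (flat_dual Einj Qf).
have [s [sE _]] := ses_section d rE.
exists (lflip (lcomp s (lflip f))) => k; apply: lamP => y.
rewrite lflipE -[LHS]/(lap (lpre E i (s (lflip f y))) k) sE.
exact: lflipE.
Qed.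

Lemma cotorsion_coker D G W (j : {linear D -> G}) (q : {linear G -> W}) :
  ses j q -> cotorsion D -> cotorsion G -> cotorsion W.
Proof.
move=> jq Dc Gc Q Qf K P i p ip Pp; split=> // f.
have Kf : flat K by apply: flat_isker ip _ Qf; exact: projective_isflat.
have [g gE] := ext_vanish_all_lift jq (Dc K Kf) f.
have [h hE] := (Gc Q Qf _ _ _ _ ip Pp).1 g.
by exists (lcomp q h) => k; rewrite -gE -hE.
Qed.

Definition bidual X : {linear X -> lhom (lhom X E) E} := lflip (lid (lhom X E)).
Lemma bidualE X x phi : lap (bidual X x) phi = lap phi x.
Proof. exact: lflipE. Qed.

Lemma bidual_inj X : injective (bidual X).
Proof.
apply/lin_inj0 => x x0; apply: contrapT => /Ecog[h]; apply.
by rewrite -[LHS]/(lap (lam h) x) -bidualE x0.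
Qed.

Hypothesis An : noetherian A.

Lemma bidual_flat F : flat F -> flat (lhom (lhom F E) E).
Proof. by move=> Ff; apply: dual_injective_flat => //; exact: flat_dual. Qed.

Lemma bidual_coker_flat F G (s : {linear lhom (lhom F E) E -> G}) :
  flat F -> ses (bidual F) s -> flat G.
Proof.
move=> Ff us; have d := dual_ses Einj us.
have dE phi : lpre E (bidual F) (bidual (lhom F E) phi) = phi.
  apply: lamP => x; rewrite -[LHS]/(lap (bidual (lhom F E) phi) (bidual F x)).
  by rewrite !bidualE.
have [r [rE _]] := ses_retract d dE.
apply: (dual_flat Ecog); apply: inj_retract rE _.
exact (flat_dual Einj (bidual_flat Ff)).
Qed.

Fixpoint cotorsion_chain (n : nat) X : Prop :=
  if n is m.+1 then
    exists (L F : lmodType A) (i : {linear L -> F}) (p : {linear F -> X}),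
      [/\ ses i p, flat F, cotorsion L & cotorsion_chain m L]
  else forall x : X, x = 0.

Lemma cotorsion_chain_proper_chain n X : cotorsion_chain n X -> proper_chain (@flat A) n X.
Proof.
elim: n X => // n IHn X [L [F [i [p [ip Ff Lc cL]]]]].
exists L, F, i, p; split=> //; first exact: IHn.
by move=> Q Qf g; apply: (ext_vanish_all_lift ip); exact: Lc.
Qed.

(* A special flat precover of [X] is a pushout of the preenvelope of its
   syzygy; a special cotorsion preenvelope of [X] is then a pushout of the
   bidual embedding of that flat precover. *)
Lemma chain_cotorsion_chain n X : chain (@flat A) n X ->
  cotorsion_chain n X /\
  exists (D G : lmodType A) (j : {linear X -> D}) (q : {linear D -> G}),
    [/\ ses j q, flat G, cotorsion D & cotorsion_chain n D].
Proof.
elim: n X => [|n IHn] X.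
  move=> X0; split=> //; exists X, X, (lid X), (lzero X X); split=> //.
  - split=> // [x|x]; first by exists 0; rewrite [x]X0.
    by split=> // _; exists x.
  - exact: projective_isflat (trivial_projective X0).
  - move=> Q _ K G i p _ _; split=> // f.
    by exists (lzero _ _) => k; rewrite [RHS]X0.
move=> [L [F [i [p [ip Ff cL]]]]]; have [_ [D [G [j [q [jq Gf Dc cD]]]]]] := IHn _ cL.
have [ii ps ie] := ip; have [ji qs je] := jq.
have [Q [j' [g [j'i comm gen cap]]]] := pushout j ii.
have gs z : exists w, lcase g j' w = z.
  by have [v [w ->]] := gen z; exists (v, w).
have lk v w : g v + j' w = 0 -> exists2 l, i l = v & j l = - w.
  by move/eqP; rewrite addr_eq0 -linearN => /eqP /cap.
have [[v w] /= /lk[l <- _]|p' p'E] := @factor_surj _ _ _ _ (lcase g j') (lcase p (lzero D X)) gs.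
  by rewrite addr0; apply/ie; exists l.
have [[v w] /= /lk[l _ lw]|q' q'E] := @factor_surj _ _ _ _ (lcase g j') (lcase (lzero F G) q) gs.
  rewrite add0r -[w]opprK -lw linearN (_ : q _ = 0) ?oppr0 //.
  by apply/je; exists l.
have p'g v : p' (g v) = p v.
  by have := p'E (v, 0); rewrite /= linear0 !addr0.
have p'j w : p' (j' w) = 0.
  by have := p'E (0, w); rewrite /= !linear0 !add0r.
have q'g v : q' (g v) = 0.
  by have := q'E (v, 0); rewrite /= !linear0 !addr0.
have q'j w : q' (j' w) = q w.
  by have := q'E (0, w); rewrite /= !linear0 !add0r.
have jp' : ses j' p'.
  split=> // [x|z]; first by have [v <-] := ps x; exists (g v).
  split=> [|[w <-] //]; have [v [w ->]] := gen z.
  rewrite linearD p'g p'j addr0 => /ie[l <-].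
  by exists (j l + w); rewrite comm linearD.
have gq' : ses g q'.
  split=> [|x|z].
  - apply/lin_inj0 => v gv; have [|l <- jl] := cap v 0; first by rewrite linear0.
    by rewrite (_ : l = 0) ?linear0 //; apply: ji; rewrite jl linear0.
  - by have [w <-] := qs x; exists (j' w).
  - split=> [|[v <-] //]; have [v [w ->]] := gen z.
    rewrite linearD q'g q'j add0r => /je[l <-].
    by exists (v + i l); rewrite linearD comm.
have Qf : flat Q by exact: flat_isext gq' Ff Gf.
split; first by exists D, Q, j', p'.
have [G2 [s us]] := coker_ses (@bidual_inj Q); have [ui ss se] := us.
have uji : injective (lcomp (bidual Q) j') by move=> x y /ui /j'i.
have [N [r ur]] := coker_ses uji; have [_ rs re] := ur.
have [_ p's p'e] := jp'.
have [z /p'e[d <-]|k kE] := @factor_surj _ _ _ _ p' (lcomp r (bidual Q)) p's.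
  exact: (ses_comp d ur).
have [e /re[d <-]|t tE] := @factor_surj _ _ _ _ r s rs.
  exact: (ses_comp (j' d) us).
exists N, G2, k, t; split.
- split=> [|x|n0].
  + apply/lin_inj0 => x; have [z <-] := p's x; rewrite kE => /re[d /ui <-].
    exact: p'j.
  + by have [e <-] := ss x; exists (r e).
  + split=> [|[x <-]]; last first.
      by have [z <-] := p's x; rewrite kE tE (ses_comp z us).
    have [e <-] := rs n0; rewrite tE => /se[z <-].
    by exists (p' z); rewrite kE.
- exact: bidual_coker_flat Qf us.
- exact: cotorsion_coker ur Dc (cotorsion_dual (lhom Q E)).
- exists D, (lhom (lhom Q E) E), (lcomp (bidual Q) j'), r; split=> //.
  exact: bidual_flat.
Qed.

Lemma chain_proper_chain_flat n X : chain (@flat A) n X -> proper_chain (@flat A) n X.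
Proof. by move=> /chain_cotorsion_chain[/cotorsion_chain_proper_chain]. Qed.

End Cotorsion.

Lemma chain_proper_chain_proj (A : comPzRingType) n (X : lmodType A) :
  chain (@projective A) n X -> proper_chain (@projective A) n X.
Proof.
elim: n X => // n IHn X [L [F [i [p [ip Ff cL]]]]].
exists L, F, i, p; split=> //; first exact: IHn.
by move=> Q Qp g; apply: proj_lift => //; case: ip.
Qed.

(** * Relative dimensions *)

Section Levels.

(* The dimensions that a finite resolution can witness; the zero complex has
   supremum [-oo]. *)
Definition level (n : nat) : \bar int := if n is m.+1 then (m%:Z)%:E else -oo%E.

Lemma level_le m n : (level m <= level n)%E = (m <= n)%N.
Proof. by case: m n => [|m] [|n]. Qed.

Lemma level_ltoo n : (level n < +oo)%E.
Proof. by case: n. Qed.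

Lemma supremum_unique (S : set (\bar int)) s x0 : supremums S s ->
  (S = set0 -> x0 = s) -> supremum x0 S = s.
Proof.
move=> Ss S0; rewrite /supremum; case: ifPn => [/eqP /S0 //|_].
have [u1 l1] := Ss; have [u2 l2] : supremums S (xget x0 (supremums S)).
  by apply: xgetPex; exists s.
by apply/eqP; rewrite eq_le; apply/andP; split; [exact: l2 | exact: l1].
Qed.

Lemma infimum_unique (S : set (\bar int)) s x0 : infimums S s ->
  (S = set0 -> x0 = s) -> infimum x0 S = s.
Proof.
move=> Ss S0; rewrite /infimum; case: ifPn => [/eqP /S0 //|_].
have [u1 l1] := Ss; have [u2 l2] : infimums S (xget x0 (infimums S)).
  by apply: xgetPex; exists s.
by apply/eqP; rewrite eq_le; apply/andP; split; [exact: l1 | exact: l2].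
Qed.

Lemma complex_sup_level (X : nat -> zmodType) :
  (exists n, complex_sup X = level n /\
     forall m, (n <= m)%N <-> forall k, (m <= k)%N -> forall v : X k, v = 0) \/
  (complex_sup X = +oo%E /\ forall m, exists k, (m <= k)%N /\ exists v : X k, v <> 0).
Proof.
pose S := [set ((n%:Z)%:E : \bar int) | n in [set n | exists v : X n, v <> 0]].
pose bd m := forall k, (m <= k)%N -> forall v : X k, v = 0.
have [[m0 bm0]|unb] := pselect (exists m, bd m); [left | right].
  have ex : exists m, `[< bd m >] by exists m0; apply/asboolP.
  have [n /asboolP bn nmin] := ex_minnP ex; exists n.
  split; last first.
    move=> m; split=> [nm k mk v|bm]; last by apply: nmin; apply/asboolP.
    by apply: bn; exact: leq_trans nm mk.
  apply: supremum_unique; last first.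
    case: n bn nmin => // n bn nmin S0; have : bd n; last first.
      by move=> bd'; have := nmin n (asboolT bd'); rewrite ltnn.
    move=> k nk v; apply: contrapT => v0; have : S (k%:Z)%:E by exists k => //; exists v.
    by rewrite /S S0.
  split=> [_ [k [v v0] <-]|t ut].
    case: n bn {nmin} => [|n] bn; first by case: v0; exact: bn.
    rewrite /level lee_fin lez_nat leqNgt; apply/negP => nk.
    by apply: v0; exact: bn.
  case: n bn nmin => [|n] bn nmin; first exact: leNye.
  apply: ut; exists n => //; apply: contrapT => none; have : bd n; last first.
    by move=> bd'; have := nmin n (asboolT bd'); rewrite ltnn.
  move=> k; rewrite leq_eqVlt => /orP[/eqP <- v|nk v]; last exact: bn.
  by apply: contrapT => v0; apply: none; exists v.
have unb' m : exists k, (m <= k)%N /\ exists v : X k, v <> 0.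
  apply: contrapT => none; apply: unb; exists m => k mk v; apply: contrapT => v0.
  by apply: none; exists k; split=> //; exists v.
split=> //; apply: supremum_unique; last first.
  move=> S0; have [k [_ ex]] := unb' 0%N.
  by have : S (k%:Z)%:E; [exists k | rewrite /S S0].
split=> [t _|t ut]; first exact: leey.
have tk m : exists k, (m <= k)%N /\ ((k%:Z)%:E <= t)%E.
  by have [k [mk kD]] := unb' m; exists k; split=> //; apply: ut; exists k.
case: t {ut} tk => [t|//|] tk; last by have [k [_]] := tk 0%N.
have [k [tk1]] := tk `|t|.+1%N; rewrite lee_fin => kt.
have : (k%:Z <= `|t|%N)%R by apply: le_trans kt _; rewrite abszE ler_norm.
by rewrite lez_nat leqNgt tk1.
Qed.

Lemma complex_sup_le (X : nat -> zmodType) m :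
  (complex_sup X <= level m)%E <-> forall k, (m <= k)%N -> forall v : X k, v = 0.
Proof.
have [[n [-> nE]]|[-> unb]] := complex_sup_level X; first by rewrite level_le nE.
split; first by case: m.
by have [k [mk [v v0]]] := unb m => /(_ k mk v).
Qed.

Lemma infimum_level (S : set (\bar int)) :
  (forall s, S s -> s = +oo%E \/ exists n, s = level n) ->
  (infimum +oo%E S = +oo%E /\ forall n, ~ S (level n)) \/
  exists n, [/\ infimum +oo%E S = level n, S (level n) & forall m, S (level m) -> (n <= m)%N].
Proof.
move=> SE; have [[m0 Sm0]|none] := pselect (exists n, S (level n)); [right | left].
  have ex : exists n, `[< S (level n) >] by exists m0; apply/asboolP.
  have [n /asboolP Sn nmin] := ex_minnP ex.
  have nm m : S (level m) -> (n <= m)%N by move=> Sm; apply: nmin; apply/asboolP.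
  exists n; split=> //; apply: infimum_unique => [|S0]; last by rewrite S0 in Sn.
  split=> [s Ss|t lt]; last exact: lt.
  have [->|[m mE]] := SE s Ss; first exact: leey.
  by rewrite mE level_le; apply: nm; rewrite -mE.
split=> [|n Sn]; last by apply: none; exists n.
apply: infimum_unique => //; split=> [s Ss|t _]; last exact: leey.
by have [->|[n nE]] := SE s Ss; [|case: none; exists n; rewrite -nE].
Qed.

Lemma dim_le (S : set (\bar int)) n :
  (forall s, S s -> exists X, s = complex_sup X) ->
  (infimum +oo%E S <= level n)%E <->
  exists X, S (complex_sup X) /\ forall k, (n <= k)%N -> forall v : X k, v = 0.
Proof.
move=> SE; have [|[-> none]|[m [-> Sm mmin]]] := @infimum_level S.
- move=> _ /SE[X ->]; have [[k [-> _]]|[-> _]] := complex_sup_level X; last by left.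
  by right; exists k.
- split; first by case: n.
  case=> X [SX Xn]; have [[k [kE _]]|[kE _]] := complex_sup_level X.
    by case: (none k); rewrite -kE.
  by have /complex_sup_le := Xn; rewrite kE; case: n {Xn}.
- rewrite level_le; split=> [mn|[X [SX Xn]]].
    have [X XE] := SE _ Sm; exists X; rewrite -XE; split=> //.
    by apply/complex_sup_le; rewrite -XE level_le.
  have [[k [kE kP]]|[kE _]] := complex_sup_level X.
    by apply: (@leq_trans k); [apply: mmin; rewrite -kE | apply/kP].
  by have /complex_sup_le := Xn; rewrite kE; case: n {Xn}.
Qed.

Lemma dim_finite (S : set (\bar int)) :
  (forall s, S s -> exists X, s = complex_sup X) ->
  (infimum +oo%E S < +oo)%E -> exists n, infimum +oo%E S = level n.
Proof.
move=> SE; have [|[-> //]|[m [-> _ _]] _] := @infimum_level S; last by exists m.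
move=> _ /SE[X ->]; have [[k [-> _]]|[-> _]] := complex_sup_level X; last by left.
by right; exists k.
Qed.

Lemma level_monotone (s t : \bar int) :
  (exists n, t = level n) -> (forall n, (t <= level n)%E -> (s <= level n)%E) -> (s <= t)%E.
Proof. by case=> n -> ; apply. Qed.

End Levels.

Lemma lin_inverse (A : comPzRingType) (U V : lmodType A) (f : {linear U -> V}) :
  injective f -> (forall v, exists u, f u = v) ->
  exists g : {linear V -> U}, (forall u, g (f u) = u) /\ (forall v, f (g v) = v).
Proof.
move=> fi fs; have [g gE] := factor_inj (f := lid V) fi fs.
by exists g; split=> // u; apply: fi; rewrite gE.
Qed.

Section ChainComplex.
Variables (A : comPzRingType) (K : lmodType A -> Prop).
Implicit Types F L N Q X : lmodType A.

Record cover N := Cover {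
  cov_syz : lmodType A; cov_obj : lmodType A;
  cov_inc : {linear cov_syz -> cov_obj}; cov_map : {linear cov_obj -> N} }.

Definition good_cover m N (c : cover N) : Prop :=
  [/\ ses (cov_inc c) (cov_map c), K (cov_obj c), proper_chain K m.-1 (cov_syz c),
      forall Q, K Q -> forall g : {linear Q -> N}, exists h : {linear Q -> cov_obj c},
        forall x, cov_map c (h x) = g x &
      m = 0%N -> forall u : cov_obj c, u = 0].

Hypothesis K0 : forall X, (forall x : X, x = 0) -> K X.

Lemma proper_chain_cover m N : proper_chain K m N -> exists c : cover N, good_cover m c.
Proof.
case: m => [N0|m [L [F [i [p [ip FK cL lift]]]]]]; last by exists (Cover i p).
exists (Cover (lzero N N) (lid N)); split=> //=.
- exact: lid_ses.
- exact: K0.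
- by move=> Q _ g; exists g.
Qed.

Record pstate := PState { ps_obj : lmodType A; ps_len : nat; ps_ok : proper_chain K ps_len ps_obj }.

Definition ps_cover (s : pstate) : cover (ps_obj s) := projT1 (cid (proper_chain_cover (ps_ok s))).
Definition ps_good (s : pstate) : good_cover (ps_len s) (ps_cover s) :=
  projT2 (cid (proper_chain_cover (ps_ok s))).
Definition ps_next (s : pstate) : pstate :=
  PState (let: And5 _ _ h _ _ := ps_good s in h).

Lemma proper_chain_complex m N : proper_chain K m N ->
  exists (P : nat -> lmodType A) (d : forall n, {linear P n.+1 -> P n}) (e : {linear P 0%N -> N}),
  [/\ forall n, K (P n), forall n, (m <= n)%N -> forall u : P n, u = 0,
      (forall u, e (d 0%N u) = 0) /\ (forall n u, d n (d n.+1 u) = 0),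
      forall Q, K Q -> forall g : {linear Q -> N}, exists h : {linear Q -> P 0%N},
        forall x, e (h x) = g x &
      forall Q, K Q ->
        (forall g : {linear Q -> P 0%N}, (forall x, e (g x) = 0) ->
           exists h : {linear Q -> P 1%N}, forall x, d 0%N (h x) = g x) /\
        (forall n (g : {linear Q -> P n.+1}), (forall x, d n (g x) = 0) ->
           exists h : {linear Q -> P n.+2}, forall x, d n.+1 (h x) = g x)].
Proof.
move=> cN; pose st n := iter n ps_next (PState cN).
pose P n := cov_obj (ps_cover (st n)).
pose i n : {linear ps_obj (st n.+1) -> P n} := cov_inc (ps_cover (st n)).
pose p n : {linear P n -> ps_obj (st n)} := cov_map (ps_cover (st n)).
have ip n : ses (i n) (p n) by have [] := ps_good (st n).
have lift n Q : K Q -> forall g : {linear Q -> ps_obj (st n)}, exists h : {linear Q -> P n},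
    forall x, p n (h x) = g x by have [_ _ _ h _] := ps_good (st n); exact: h.
have len n : ps_len (st n) = (m - n)%N.
  elim: n => [|n IHn]; first by rewrite subn0.
  by rewrite subnS -IHn.
have ker n Q (g : {linear Q -> P n}) : K Q -> (forall x, p n (g x) = 0) ->
    exists h : {linear Q -> P n.+1}, forall x, lcomp (i n) (p n.+1) (h x) = g x.
  move=> QK pg; have [ii _ ie] := ip n.
  have [x|g' g'E] := @factor_inj _ _ _ _ (i n) g ii; first exact/ie/pg.
  have [h hE] := lift n.+1 Q QK g'; exists h => x.
  by rewrite lcompE hE g'E.
exists P, (fun n => lcomp (i n) (p n.+1)), (p 0%N); split.
- by move=> n; have [] := ps_good (st n).
- move=> n mn; have [_ _ _ _ h] := ps_good (st n); apply: h.
  by rewrite len; apply/eqP; rewrite subn_eq0.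
- split=> [u|n u]; first exact: (ses_comp _ (ip 0%N)).
  rewrite !lcompE (_ : p n.+1 (i n.+1 _) = 0) ?linear0 //.
  exact: (ses_comp _ (ip n.+1)).
- exact: (lift 0%N).
- move=> Q QK; split=> [g ge|n g gd]; first exact: ker.
  apply: ker => // x; have [ii _ _] := ip n; apply: ii.
  by rewrite linear0 -[RHS](gd x).
Qed.

Lemma chain_of_complex m N (P : nat -> lmodType A) (d : forall n, {linear P n.+1 -> P n})
    (e : {linear P 0%N -> N}) :
  (forall n, K (P n)) -> (forall n, (m <= n)%N -> forall u : P n, u = 0) ->
  (forall x, exists u, e u = x) -> (forall u, e u = 0 <-> exists v, d 0%N v = u) ->
  (forall n u, d n u = 0 <-> exists v, d n.+1 v = u) -> chain K m N.
Proof.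
elim: m N P d e => [|m IHm] N P d e PK P0 es e0 ex.
  by move=> x; have [u <-] := es x; rewrite [u]P0 ?linear0.
have [L [i ie]] := ker_ses es; have [ii _ ke] := ie.
have [v|c cE] := @factor_inj _ _ _ _ i (d 0%N) ii; first by apply/ke/e0; exists v.
exists L, (P 0%N), i, e; split=> //.
apply: (IHm L (fun n => P n.+1) (fun n => d n.+1) c) => //.
- by move=> n mn u; apply: P0.
- move=> x; have /e0[v vE] : e (i x) = 0 by apply/ke; exists x.
  by exists v; apply: ii; rewrite cE.
- move=> u; rewrite -ex -cE; split=> [->|h]; first exact: linear0.
  by apply: ii; rewrite h linear0.
Qed.

End ChainComplex.

Section RelativeDimension.
Variables (A : comPzRingType) (B : lmodType A).
Hypotheses (An : noetherian A) (Bf : finite_module B).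
Hypothesis Bh : bijective (@homothety A B).
Variable K : lmodType A -> Prop.
Hypothesis Kflat : forall F, K F -> flat F.
Hypothesis Kproj : forall F, projective F -> K F.
Hypothesis Kiso : forall (F G : lmodType A) (f : {linear F -> G}),
  injective f -> (forall v, exists u, f u = v) -> K F -> K G.
Implicit Types F L N Q X : lmodType A.

Lemma tmap_full F Q : flat F ->
  forall h : {linear tens B Q -> tens B F}, exists q : {linear Q -> F}, h =1 tmap (lid B) q.
Proof.
move=> Ff h.
have [ui us] := unit_tens_bij An (@cog_injective A) (@cog_cogenerator A) Bf Ff Bh.
have [g [_ gK]] := lin_inverse ui us.
exists (lcomp g (tcurry h)); apply: (tens_ext (g := tmap (lid B) (lcomp g (tcurry h)))) => b x.
rewrite tmapE -[RHS]unit_tensE gK.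
by rewrite tcurryE.
Qed.

Lemma tmap_faithful F Q (f g : {linear Q -> F}) : flat F ->
  tmap (lid B) f =1 tmap (lid B) g -> f =1 g.
Proof.
move=> Ff fg x.
have [ui us] := unit_tens_bij An (@cog_injective A) (@cog_cogenerator A) Bf Ff Bh.
by apply: ui; apply: lamP => b; rewrite !unit_tensE -!(tmapE (lid B)) fg.
Qed.

Lemma evalt_tmap N Q (g : {linear Q -> lhom B N}) b x :
  evalt B N (tmap (lid B) g (pure b x)) = lap (g x) b.
Proof. by rewrite tmapE evaltE. Qed.

Lemma relative_pd_of_chain n N : proper_chain K n (lhom B N) ->
  exists X : proper_resolution K B N,
    forall k, (n <= k)%N -> forall v : tens B (prop_obj X k), v = 0.
Proof.
have K0 X : (forall x : X, x = 0) -> K X by move=> /trivial_projective/Kproj.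
move=> /(proper_chain_complex K0)[P [d [e [PK P0 [ed dd] lift ex]]]].
have cplx : (forall t, lcomp (evalt B N) (tmap (lid B) e) (tmap (lid B) (d 0%N) t) = 0) /\
    (forall n t, tmap (lid B) (d n) (tmap (lid B) (d n.+1) t) = 0).
  by split=> [t|k t]; [rewrite lcompE tmap_comp0 ?linear0 | rewrite tmap_comp0].
have exact : forall Q, K Q ->
    exact_augmented (X := fun n => lhom (tens B Q) (tens B (P n)))
      (fun n => @postcomp A (tens B Q) _ _ (tmap (lid B) (d n)))
      (@postcomp A (tens B Q) _ _ (lcomp (evalt B N) (tmap (lid B) e))).
  move=> Q QK; have [ex0 exn] := ex Q QK; split.
  - apply/surjP => h; have [g gE] := lift Q QK (tcurry (lap h)).
    exists (lam (tmap (lid B) g)); apply: lamP.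
    apply: (tens_ext (f := lcomp (lcomp (evalt B N) (tmap (lid B) e)) (tmap (lid B) g)) (g := lap h)).
    by move=> b x; rewrite !lcompE tmapE evalt_tmap gE tcurryE.
  - apply/exactP => h; split=> [h0|[g <-]]; last first.
      by apply: lamP => t; exact: (cplx.1 (lap g t)).
    have [q qE] := tmap_full (Kflat (PK 0%N)) (lap h).
    have [x|k kE] := ex0 q.
      apply: lamP => b; rewrite -[LHS]evalt_tmap.
      rewrite tmapE -(tmapE (lid B)) -(tmapE (lid B) q) -qE.
      by rewrite -[LHS]/(lap (@postcomp A (tens B Q) _ _ (lcomp (evalt B N) (tmap (lid B) e)) h) (pure b x)) h0.
    exists (lam (tmap (lid B) k)); apply: lamP => t; rewrite [RHS]qE; move: t.
    apply: (tens_ext (f := lcomp (tmap (lid B) (d 0%N)) (tmap (lid B) k)) (g := tmap (lid B) q)).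
    by move=> b x; rewrite lcompE !tmapE kE.
  - move=> m; apply/exactP => h; split=> [h0|[g <-]]; last first.
      by apply: lamP => t; exact: (cplx.2 m (lap g t)).
    have [q qE] := tmap_full (Kflat (PK m.+1)) (lap h).
    have [x|k kE] := exn m q.
      apply: (@tmap_faithful _ _ (lcomp (d m) q) (lzero _ _)); first exact: Kflat.
      move=> t; rewrite (_ : tmap _ (lcomp _ _) t = 0).
        by move: t; apply: (tens_ext (f := lzero _ _)) => b y; rewrite tmapE pure0r.
      have -> : tmap (lid B) (lcomp (d m) q) t = tmap (lid B) (d m) (tmap (lid B) q t).
        move: t; apply: (tens_ext (g := lcomp (tmap _ _) (tmap _ _))) => b y.
        by rewrite lcompE !tmapE.
      by rewrite -qE -[LHS]/(lap (@postcomp A (tens B Q) _ _ (tmap (lid B) (d m)) h) t) h0.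
    exists (lam (tmap (lid B) k)); apply: lamP => t; rewrite [RHS]qE; move: t.
    apply: (tens_ext (f := lcomp (tmap (lid B) (d m.+1)) (tmap (lid B) k)) (g := tmap (lid B) q)).
    by move=> b x; rewrite lcompE !tmapE kE.
exists (ProperResolution PK cplx exact) => k nk /=.
apply: (tens_ext (f := lid _) (g := lzero _ _)) => b u.
by rewrite [u]P0 //= pure0r.
Qed.

Lemma chain_of_relative_pd n N (X : proper_resolution K B N) :
  (forall k, (n <= k)%N -> forall v : tens B (prop_obj X k), v = 0) -> chain K n (lhom B N).
Proof.
case: X => P PK d e [ed dd] ex /= P0.
have KA : K A^o by apply: Kproj; exact: ring_projective.
have [/surjP es /exactP e0 exn] := ex _ KA.
(* [B] is a retract of [tens B A^o], so exactness passes to [Hom(B, -)]. *)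
have rl : bilin (fun (b : B) (a : A^o) => (a : A) *: b).
  split=> [a|b] c u v; last by rewrite scalerDl scalerA.
  by rewrite scalerDr !scalerA mulrC.
pose r := tlift rl; pose s := purel B (1 : A^o).
have rs b : r (s b) = b by rewrite [LHS]tliftE scale1r.
apply: (@chain_of_complex A K n (lhom B N) (fun k => lhom B (tens B (P k)))
  (fun k => lpost B (d k)) (lpost B e)).
- move=> k; have [ui us] := unit_tens_bij An (@cog_injective A) (@cog_cogenerator A) Bf (Kflat (PK k)) Bh.
  exact: Kiso ui us (PK k).
- by move=> k nk f; apply: lamP => b; exact: P0.
- move=> h; have [g gE] := es (lam (lcomp (lap h) r)).
  exists (lam (lcomp (lap g) s)); apply: lamP => b.
  by rewrite -[LHS]/(lap (@postcomp A _ _ _ e g) (s b)) gE -[LHS]/(lap h (r (s b))) rs.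
- move=> h; split=> [h0|[g <-]]; last by apply: lamP => b; exact: ed.
  have [|g gE] := (e0 (lam (lcomp (lap h) r))).1.
    apply: lamP => t; exact: (congr1 (fun l => lap l (r t)) h0).
  exists (lam (lcomp (lap g) s)); apply: lamP => b.
  by rewrite -[LHS]/(lap (@postcomp A _ _ _ (d 0%N) g) (s b)) gE -[LHS]/(lap h (r (s b))) rs.
- move=> k h; split=> [h0|[g <-]]; last by apply: lamP => b; exact: dd.
  have /exactP dk := exn k; have [|g gE] := (dk (lam (lcomp (lap h) r))).1.
    apply: lamP => t; exact: (congr1 (fun l => lap l (r t)) h0).
  exists (lam (lcomp (lap g) s)); apply: lamP => b.
  by rewrite -[LHS]/(lap (@postcomp A _ _ _ (d k.+1) g) (s b)) gE -[LHS]/(lap h (r (s b))) rs.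
Qed.

Hypothesis Kproper : forall n X, chain K n X -> proper_chain K n X.

Lemma relative_pd_le n N : (relative_pd B N K <= level n)%E <-> chain K n (lhom B N).
Proof.
rewrite /relative_pd dim_le; last by move=> _ [X ->]; eexists.
split=> [[Y [[X XE] Y0]]|/Kproper /relative_pd_of_chain [X X0]]; last first.
  by exists (fun k => tens B (prop_obj X k)); split=> //; exists X.
by apply: (chain_of_relative_pd (X := X)); apply/complex_sup_le; rewrite -XE; apply/complex_sup_le.
Qed.

Lemma relative_pd_finite N : (relative_pd B N K < +oo)%E ->
  exists n, relative_pd B N K = level n.
Proof. by apply: dim_finite => _ [X ->]; eexists. Qed.

End RelativeDimension.

Section InjectiveDimension.
Variable A : comPzRingType.
Implicit Types I J T X Z : lmodType A.

Fixpoint ichain (n : nat) T : Prop :=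
  if n is m.+1 then
    exists (I Z : lmodType A) (i : {linear T -> I}) (p : {linear I -> Z}),
      [/\ ses i p, injective_module I & ichain m Z]
  else forall x : T, x = 0.

Record cocover T := CoCover {
  coc_obj : lmodType A; coc_cok : lmodType A;
  coc_inc : {linear T -> coc_obj}; coc_map : {linear coc_obj -> coc_cok} }.

Definition good_cocover m T (c : cocover T) : Prop :=
  [/\ ses (coc_inc c) (coc_map c), injective_module (coc_obj c), ichain m.-1 (coc_cok c) &
      m = 0%N -> forall u : coc_obj c, u = 0].

Lemma trivial_injective X : (forall x : X, x = 0) -> injective_module X.
Proof.
by move=> X0 U V f g _; exists (lzero _ _) => x; rewrite [RHS]X0.
Qed.

Lemma ichain_cocover m T : ichain m T -> exists c : cocover T, good_cocover m c.
Proof.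
case: m => [T0|m [I [Z [i [p [ip Ii cZ]]]]]]; last by exists (CoCover i p).
exists (CoCover (lid T) (lzero T T)); split=> //=; last exact: trivial_injective.
split=> // [x|x]; first by exists 0; rewrite [x]T0.
by split=> // _; exists x.
Qed.

Record istate := IState { is_obj : lmodType A; is_len : nat; is_ok : ichain is_len is_obj }.

Definition is_cover (s : istate) : cocover (is_obj s) := projT1 (cid (ichain_cocover (is_ok s))).
Definition is_good (s : istate) : good_cocover (is_len s) (is_cover s) :=
  projT2 (cid (ichain_cocover (is_ok s))).
Definition is_next (s : istate) : istate :=
  IState (let: And4 _ _ h _ := is_good s in h).

Lemma ichain_complex m T : ichain m T ->
  exists (I : nat -> lmodType A) (d : forall n, {linear I n -> I n.+1}) (e : {linear T -> I 0%N}),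
  [/\ forall n, injective_module (I n), forall n, (m <= n)%N -> forall u : I n, u = 0,
      (forall u, d 0%N (e u) = 0) /\ (forall n u, d n.+1 (d n u) = 0),
      forall J, injective_module J -> forall g : {linear T -> J}, exists h : {linear I 0%N -> J},
        forall x, h (e x) = g x &
      forall J, injective_module J ->
        (forall g : {linear I 0%N -> J}, (forall x, g (e x) = 0) ->
           exists h : {linear I 1%N -> J}, forall x, h (d 0%N x) = g x) /\
        (forall n (g : {linear I n.+1 -> J}), (forall x, g (d n x) = 0) ->
           exists h : {linear I n.+2 -> J}, forall x, h (d n.+1 x) = g x)].
Proof.
move=> cT; pose st n := iter n is_next (IState cT).
pose I n := coc_obj (is_cover (st n)).
pose i n : {linear is_obj (st n) -> I n} := coc_inc (is_cover (st n)).
pose p n : {linear I n -> is_obj (st n.+1)} := coc_map (is_cover (st n)).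
have ip n : ses (i n) (p n) by have [] := is_good (st n).
have len n : is_len (st n) = (m - n)%N.
  elim: n => [|n IHn]; first by rewrite subn0.
  by rewrite subnS -IHn.
have lift n J : injective_module J -> forall g : {linear is_obj (st n) -> J},
    exists h : {linear I n -> J}, forall x, h (i n x) = g x.
  by move=> Ji g; have [ii _ _] := ip n; have [h hE] := Ji _ _ (i n) g ii; exists h.
have ker n J (g : {linear I n -> J}) : injective_module J -> (forall x, g (i n x) = 0) ->
    exists h : {linear I n.+1 -> J}, forall x, h (lcomp (i n.+1) (p n) x) = g x.
  move=> Ji gi; have [_ ps ie] := ip n.
  have [x /ie[y <-] //|g' g'E] := @factor_surj _ _ _ _ (p n) g ps.
  have [h hE] := lift n.+1 J Ji g'; exists h => x.
  by rewrite lcompE hE g'E.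
exists I, (fun n => lcomp (i n.+1) (p n)), (i 0%N); split.
- by move=> n; have [] := is_good (st n).
- move=> n mn; have [_ _ _ h] := is_good (st n); apply: h.
  by rewrite len; apply/eqP; rewrite subn_eq0.
- split=> [u|n u].
    by rewrite lcompE (_ : p 0%N _ = 0) ?linear0 //; exact: (ses_comp _ (ip 0%N)).
  rewrite !lcompE (_ : p n.+1 (i n.+1 _) = 0) ?linear0 //.
  exact: (ses_comp _ (ip n.+1)).
- exact: (lift 0%N).
- move=> J Ji; split=> [g ge|n g gd]; first exact: ker.
  apply: ker => // x; have [_ ps _] := ip n; have [y <-] := ps x.
  exact: gd.
Qed.

Lemma ichain_of_complex m T (I : nat -> lmodType A) (d : forall n, {linear I n -> I n.+1})
    (e : {linear T -> I 0%N}) :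
  (forall n, injective_module (I n)) -> (forall n, (m <= n)%N -> forall u : I n, u = 0) ->
  injective e -> (forall u, d 0%N u = 0 <-> exists v, e v = u) ->
  (forall n u, d n.+1 u = 0 <-> exists v, d n v = u) -> ichain m T.
Proof.
elim: m T I d e => [|m IHm] T I d e Ii I0 ei e0 ex.
  by move=> x; apply: ei; rewrite [LHS]I0 // [RHS]I0.
have [Z [p ep]] := coker_ses ei; have [_ ps pe] := ep.
have [v|c cE] := @factor_surj _ _ _ _ p (d 0%N) ps; first by move/pe/e0.
exists (I 0%N), Z, e, p; split=> //.
apply: (IHm Z (fun n => I n.+1) (fun n => d n.+1) c) => //.
- by move=> n mn u; apply: I0.
- apply/lin_inj0 => z; have [v <-] := ps z; rewrite cE => /e0 h; exact/pe.
- move=> u; rewrite ex; split=> [[v <-]|[z <-]]; first by exists (p v); rewrite cE.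
  by have [v <-] := ps z; exists v; rewrite cE.
Qed.

Variable B : lmodType A.
Hypotheses (An : noetherian A) (Bf : finite_module B).
Hypothesis Bh : bijective (@homothety A B).

Lemma postcomp_full I J (Phi : {linear lhom B I -> lhom B J}) : injective_module I ->
  exists phi : {linear I -> J}, forall f b, lap (Phi f) b = phi (lap f b).
Proof.
move=> Ii; have [ei es] := evalt_bij An Bf Bh Ii; have [g [gK _]] := lin_inverse ei es.
exists (lcomp (tuncurry Phi) g) => f b.
by rewrite lcompE -(evaltE b f) gK tuncurryE.
Qed.

Lemma coresolution_of_ichain n N : ichain n (tens B N) ->
  exists Y : proper_coresolution B N,
    forall k, (n <= k)%N -> forall v : lhom B (cop_obj Y k), v = 0.
Proof.
move=> /ichain_complex[I [d [e [Ii I0 [ed dd] lift ex]]]].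
have cplx : (forall v, lpost B (d 0%N) (tcurry e v) = 0) /\
    (forall n f, lpost B (d n.+1) (lpost B (d n) f) = 0).
  split=> [v|k f]; apply: lamP => b; first exact: (ed (pure b v)).
  exact: (dd k (lap f b)).
have exact : forall J : lmodType A, injective_module J ->
    exact_augmented (X := fun n => lhom (lhom B (I n)) (lhom B J))
      (fun n => @precomp A (lhom B J) _ _ (lpost B (d n)))
      (@precomp A (lhom B J) _ _ (tcurry e)).
  move=> J Ji; have [ex0 exn] := ex J Ji; split.
  - apply/surjP => h; have [g gE] := lift J Ji (tuncurry (lap h)).
    exists (lam (lpost B g)); apply: lamP => v; apply: lamP => b.
    by rewrite -[LHS]/(g (e (pure b v))) gE tuncurryE.
  - apply/exactP => h; split=> [h0|[g <-]]; last first.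
      by apply: lamP => v; rewrite -[RHS](linear0 (lap g)) -(cplx.1 v).
    have [phi phiE] := postcomp_full (lap h) (Ii 0%N).
    have [t|k kE] := ex0 phi.
      move: t; apply: (tens_ext (f := lcomp phi e) (g := lzero _ _)) => b v.
      rewrite lcompE -(phiE (tcurry e v)).
      by rewrite -[LHS]/(lap (lap (@precomp A (lhom B J) _ _ (tcurry e) h) v) b) h0.
    exists (lam (lpost B k)); apply: lamP => f; apply: lamP => b.
    by rewrite phiE -kE.
  - move=> m; apply/exactP => h; split=> [h0|[g <-]]; last first.
      by apply: lamP => v; rewrite -[RHS](linear0 (lap g)) -(cplx.2 m v).
    have [phi phiE] := postcomp_full (lap h) (Ii m.+1).
    have [x|k kE] := exn m phi.
      have [ei es] := evalt_bij An Bf Bh (Ii m); have [t <-] := es x.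
      move: t; apply: (tens_ext (f := lcomp (lcomp phi (d m)) (evalt B (I m))) (g := lzero _ _)) => b f.
      rewrite !lcompE evaltE -(phiE (lpost B (d m) f)).
      by rewrite -[LHS]/(lap (lap (@precomp A (lhom B J) _ _ (lpost B (d m)) h) f) b) h0.
    exists (lam (lpost B k)); apply: lamP => f; apply: lamP => b.
    by rewrite phiE -kE.
exists (ProperCoresolution Ii cplx exact) => k nk f /=.
by apply: lamP => b; exact: I0.
Qed.

Lemma ichain_of_coresolution n N (Y : proper_coresolution B N) :
  (forall k, (n <= k)%N -> forall v : lhom B (cop_obj Y k), v = 0) -> ichain n (tens B N).
Proof.
case: Y => I Ii d e [ed dd] ex /= I0.
pose E : lmodType A := cog A.
have Einj : injective_module E := @cog_injective A.
have Ecog : cogenerator E := @cog_cogenerator A.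
have [/surjP es /exactP e0 exn] := ex _ Einj.
apply: (@ichain_of_complex n _ (fun k => tens B (lhom B (I k)))
  (fun k => tmap (lid B) (d k)) (tmap (lid B) e)).
- move=> k; have [ei' es'] := evalt_bij An Bf Bh (Ii k).
  by have [g [gK _]] := lin_inverse ei' es'; exact: inj_retract gK (Ii k).
- move=> k nk; apply: (tens_ext (f := lid _) (g := lzero _ _)) => b f.
  by rewrite [f]I0 //= pure0r.
- apply: (cog_inj Ecog) => h; have [k kE] := es (lam (tcurry h)).
  exists (tuncurry (lap k)); apply: (tens_ext (f := lcomp (tuncurry (lap k)) (tmap (lid B) e)) (g := h)) => b v.
  rewrite lcompE tmapE tuncurryE -[RHS]tcurryE.
  exact: (congr1 (fun l => lap (lap l v) b) kE).
- move=> t; split=> [t0|[s <-]]; last by rewrite tmap_comp0.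
  apply: (cog_range Ecog) => h hE.
  have [|k kE] := (e0 (lam (tcurry h))).1.
    by apply: lamP => v; apply: lamP => b; rewrite -[RHS](hE (pure b v)) tmapE.
  rewrite -(linear0 (tuncurry (lap k))) -t0.
  move: t {t0}; apply: (tens_ext (f := h) (g := lcomp (tuncurry (lap k)) (tmap (lid B) (d 0%N)))) => b f.
  rewrite lcompE tmapE tuncurryE -[LHS]tcurryE.
  exact: (congr1 (fun l => lap (lap l f) b) (esym kE)).
- move=> m t; split=> [t0|[s <-]]; last by apply: tmap_comp0; exact: dd.
  have /exactP e1 := exn m; apply: (cog_range Ecog) => h hE.
  have [|k kE] := (e1 (lam (tcurry h))).1.
    by apply: lamP => v; apply: lamP => b; rewrite -[RHS](hE (pure b v)) tmapE.
  rewrite -(linear0 (tuncurry (lap k))) -t0.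
  move: t {t0}; apply: (tens_ext (f := h) (g := lcomp (tuncurry (lap k)) (tmap (lid B) (d m.+1)))) => b f.
  rewrite lcompE tmapE tuncurryE -[LHS]tcurryE.
  exact: (congr1 (fun l => lap (lap l f) b) (esym kE)).
Qed.

Lemma I_id_le n N : (I_id B N <= level n)%E <-> ichain n (tens B N).
Proof.
rewrite /I_id dim_le; last by move=> _ [Y ->]; eexists.
split=> [[X [[Y YE] X0]]|/coresolution_of_ichain [Y Y0]]; last first.
  by exists (fun k => lhom B (cop_obj Y k)); split=> //; exists Y.
by apply: (ichain_of_coresolution (Y := Y)); apply/complex_sup_le; rewrite -YE; apply/complex_sup_le.
Qed.

Lemma I_id_finite N : (I_id B N < +oo)%E -> exists n, I_id B N = level n.
Proof. by apply: dim_finite => _ [Y ->]; eexists. Qed.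

End InjectiveDimension.

(** * Reduction modulo an exact zero-divisor *)

Section ExactPairs.
Variable A : comPzRingType.
Implicit Types U V W M I F : lmodType A.

(* The other inclusion follows from [x * y = 0]. *)
Definition ker_im (x y : A) M : Prop := forall m : M, y *: m = 0 -> exists n, x *: n = m.

Lemma ker_im_coker x y U V W (i : {linear U -> V}) (p : {linear V -> W}) :
  x * y = 0 -> ses i p -> ker_im y x U -> ker_im x y V -> ker_im x y W.
Proof.
move=> xy [ii ps ie] hU hV w; have [v <-] := ps w; rewrite -linearZZ => /ie[u uE].
have [|u' u'E] := hU u.
  by apply: ii; rewrite linearZZ uE scalerA xy scale0r linear0.
have [|v' v'E] := hV (v - i u').
  by rewrite scalerBr -uE -linearZZ u'E subrr.
exists (p v'); rewrite -linearZZ v'E linearB (_ : p (i u') = 0) ?subr0 //.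
by apply/ie; exists u'.
Qed.

Lemma ker_im_ker x y U V W (i : {linear U -> V}) (p : {linear V -> W}) :
  x * y = 0 -> ses i p -> ker_im x y V -> ker_im y x W -> ker_im x y U.
Proof.
move=> xy [ii ps ie] hV hW u uy.
have [|v vE] := hV (i u); first by rewrite -linearZZ uy linear0.
have [|w wE] := hW (p v); first by rewrite -linearZZ vE; apply/ie; exists u.
have [v' v'E] := ps w; have [|u' u'E] := (ie (v - y *: v')).1.
  by rewrite linearB linearZZ v'E wE subrr.
exists u'; apply: ii; rewrite linearZZ u'E scalerBr scalerA xy scale0r subr0.
exact: vE.
Qed.

Lemma ker_im_iso x y U V (f : {linear U -> V}) :
  injective f -> (forall v, exists u, f u = v) -> ker_im x y U -> ker_im x y V.
Proof.
move=> fi fs hU v; have [u <-] := fs v; rewrite -linearZZ -(linear0 f) => /fi /hU[n <-].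
by exists (f n); rewrite linearZZ.
Qed.

Fact mulx_linear M (x : A) : linear ( *:%R x : M -> M).
Proof. by move=> a u v; rewrite scalerDr !scalerA mulrC. Qed.
Definition mulx M (x : A) : {linear M -> M} := mklin (@mulx_linear M x).

Lemma ker_im_injective x y I : ker_im y x A^o -> injective_module I -> ker_im x y I.
Proof.
move=> hA Ii i yi.
have [||k kE] := @injective_exact A I A^o A^o A^o (mulx A^o y) (mulx A^o x) (rscale i) Ii.
- by move=> v /hA.
- by move=> a; rewrite -[LHS]/((y * (a : A)) *: i) mulrC -scalerA yi scaler0.
by exists (k (1 : A^o)); rewrite -linearZZ -[RHS]scale1r -[RHS]/(rscale i 1) -kE.
Qed.

Lemma ker_im_flat x y F : ker_im x y A^o -> flat F -> ker_im x y F.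
Proof.
move=> hA Ff m ym; apply: (cog_range (@cog_cogenerator A) (f := mulx F x)) => h hx.
have Fi := flat_dual (@cog_injective A) Ff.
have [|h' h'E] := ker_im_injective hA Fi (m := lam h).
  by apply: lamP => u; rewrite -[LHS]/(x *: h u) -linearZZ; exact: hx.
rewrite -[LHS]/(lap (lam h) m) -h'E -[LHS]/(y *: lap h' m) -linearZZ ym.
exact: linear0.
Qed.

Lemma ker_im_proj_lhom x y F M : y * x = 0 ->
  projective F -> ker_im x y M -> ker_im x y (lhom F M).
Proof.
move=> yx Fp hM f yf; pose k := subinc (kersub (mulx M y)).
have kx m : exists u, k u = mulx M x m.
  by apply: subinc_ex; rewrite /= scalerA yx scale0r.
have [q qE] := factor_inj (@subinc_inj _ _ (kersub (mulx M y))) kx.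
have kf u : exists v, k v = lap f u.
  apply: subinc_ex; exact: (congr1 (fun l => lap l u) yf).
have [f' f'E] := factor_inj (@subinc_inj _ _ (kersub (mulx M y))) kf.
have [v|g gE] := proj_lift (p := q) f' Fp.
  have [n nE] := hM _ (subincP v); exists n.
  by apply: (@subinc_inj _ _ (kersub (mulx M y))); rewrite qE.
exists (lam g); apply: lamP => u; rewrite -[RHS]f'E -gE qE.
by [].
Qed.

End ExactPairs.

Section Restriction.
Variables (R : comPzRingType) (x : R).
Local Notation S := (quo_ring x).

Definition bpr (a : R) : S := \pi_S a.

Lemma bpr_surj (s : S) : exists a, bpr a = s.
Proof. by exists (repr s); exact: reprK. Qed.
Lemma bprD a b : bpr (a + b) = bpr a + bpr b.
Proof. exact: quo_ring_piD. Qed.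
Lemma bprM a b : bpr (a * b) = bpr a * bpr b.
Proof. by apply: esym; exact: quo_mulE. Qed.
Lemma bpr1 : bpr 1 = 1.
Proof. by []. Qed.
Lemma bpr_eq a b : bpr a = bpr b <-> exists c, x * c = a - b.
Proof. by rewrite quo_ring_eqP. Qed.
Lemma bpr0 : bpr 0 = 0.
Proof. by apply: (addrI (bpr 0)); rewrite -bprD !addr0. Qed.
Lemma bprB a b : bpr (a - b) = bpr a - bpr b.
Proof.
rewrite bprD; congr (_ + _); apply: (addrI (bpr b)).
by rewrite -bprD !subrr bpr0.
Qed.
Lemma bprx : bpr x = 0.
Proof.
rewrite -bpr0.
by apply/bpr_eq; exists 1; rewrite mulr1 subr0.
Qed.

(* Restriction of scalars along [R -> R/xR]. *)
Definition res (W : lmodType S) : Type := W.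
Section Res.
Variable W : lmodType S.
HB.instance Definition _ := GRing.Zmodule.on (res W).
Definition res_scale (a : R) (w : res W) : res W := bpr a *: (w : W).
Fact res_scaleA a b w : res_scale a (res_scale b w) = res_scale (a * b) w.
Proof. by rewrite /res_scale scalerA bprM. Qed.
Fact res_scale1 : left_id 1 res_scale.
Proof. by move=> w; rewrite /res_scale bpr1 scale1r. Qed.
Fact res_scaleDr : right_distributive res_scale +%R.
Proof. by move=> a u v; exact: scalerDr. Qed.
Fact res_scaleDl w : {morph res_scale^~ w : a b / a + b}.
Proof. by move=> a b; rewrite /res_scale bprD; exact: scalerDl. Qed.
HB.instance Definition _ := GRing.Zmodule_isLmodule.Build R (res W)
  res_scaleA res_scale1 res_scaleDr res_scaleDl.
End Res.

Lemma res_scaleE (W : lmodType S) a (w : W) : a *: (w : res W) = bpr a *: w.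
Proof. by []. Qed.

Lemma res_x (W : lmodType S) (w : res W) : x *: w = 0.
Proof. by rewrite res_scaleE bprx scale0r. Qed.

Fact rmap_linear (U V : lmodType S) (f : {linear U -> V}) :
  linear (f : res U -> res V).
Proof. by move=> a u v; exact: linearP. Qed.
Definition rmap (U V : lmodType S) (f : {linear U -> V}) : {linear res U -> res V} :=
  mklin (rmap_linear f).

Fact cmap_linear (U V : lmodType S) (f : {linear res U -> res V}) :
  linear (f : U -> V).
Proof. by move=> s u v; have [a <-] := bpr_surj s; exact: (linearP f a u v). Qed.
Definition cmap (U V : lmodType S) (f : {linear res U -> res V}) : {linear U -> V} :=
  mklin (cmap_linear f).

Section Bar.
Variable M : lmodType R.
Definition bpi (m : M) : quo_mod x M := \pi_(quo_mod x M) m.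

Lemma bpi_surj (q : quo_mod x M) : exists m, bpi m = q.
Proof. by exists (repr q); exact: reprK. Qed.
Lemma bpi_eq m n : bpi m = bpi n <-> exists c, x *: c = m - n.
Proof.
by split=> [/quo_mod_eqP/multiplesP //|h]; apply/quo_mod_eqP/multiplesP.
Qed.
Lemma bpiD m n : bpi (m + n) = bpi m + bpi n.
Proof. exact: quo_mod_piD. Qed.
Lemma bpiZ a m : bpi (a *: m) = bpr a *: bpi m.
Proof. by apply: esym; exact: quo_scaleE. Qed.

Fact bproj_linear : linear (bpi : M -> res (quo_mod x M)).
Proof. by move=> a m n; rewrite bpiD bpiZ. Qed.
Definition bproj : {linear M -> res (quo_mod x M)} := mklin bproj_linear.

Lemma bpi_eq0 m : bpi m = 0 <-> exists c, x *: c = m.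
Proof.
have <- : bpi 0 = 0 by exact: (linear0 bproj).
by rewrite bpi_eq subr0.
Qed.

Lemma blift_ex (W : lmodType S) (g : {linear M -> res W}) :
  exists h : {linear quo_mod x M -> W}, forall m, h (bpi m) = g m.
Proof.
have [|m /bpi_eq0[c <-]|h hE] := @factor_surj _ _ _ _ bproj g.
- exact: bpi_surj.
- by rewrite linearZZ; exact: res_x.
by exists (cmap h) => m; exact: hE.
Qed.

Definition blift (W : lmodType S) (g : {linear M -> res W}) : {linear quo_mod x M -> W} :=
  projT1 (cid (blift_ex g)).
Lemma bliftE (W : lmodType S) (g : {linear M -> res W}) m : blift g (bpi m) = g m.
Proof. exact: (projT2 (cid (blift_ex g)) m). Qed.

Lemma bar_ext (W : lmodType S) (f g : {linear quo_mod x M -> W}) :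
  (forall m, f (bpi m) = g (bpi m)) -> f =1 g.
Proof. by move=> fg q; have [m <-] := bpi_surj q. Qed.

End Bar.

Definition bmap (M N : lmodType R) (f : {linear M -> N}) :
  {linear quo_mod x M -> quo_mod x N} := blift (lcomp (bproj N) f).
Lemma bmapE (M N : lmodType R) (f : {linear M -> N}) m : bmap f (bpi m) = bpi (f m).
Proof. exact: bliftE. Qed.

Lemma bar_noetherian : noetherian R -> noetherian S.
Proof.
move=> Rn I sI.
have sJ : submodule ([set a | I (bpr a)] : set R^o).
  case: sI => I0 IP; split=> [|a u v /= hu hv].
    by rewrite /= bpr0.
  by rewrite bprD bprM; exact: IP.
have /noethP h := Rn; have [t [t1 t2]] := h (Submod sJ).
exists (map bpr t); rewrite eqEsubset; split=> q.
  have [a <-] := bpr_surj q => Ia.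
  have bl : linear (bpr : R^o -> res S^o) by move=> b u v; rewrite bprD bprM.
  have /t2 : Submod sJ a by [].
  case=> c cE; exists (fun i => bpr (c i)); rewrite size_map.
  rewrite -[LHS]/(mklin bl a) cE linear_sum; apply: eq_bigr => i _.
  rewrite linearZZ /= res_scaleE (nth_map 0) //.
apply: (lspan_min (N := Submod sI)) => _ /mapP[a /t1 Ia ->].
exact: Ia.
Qed.

Lemma bar_finite (M : lmodType R) : finite_module M -> finite_module (quo_mod x M).
Proof.
case=> s sE; exists (map (@bpi M) s); rewrite eqEsubset; split=> // q _.
have [m <-] := bpi_surj q; have : lspan s m by rewrite sE.
case=> c ->; exists (fun i => bpr (c i)); rewrite size_map.
rewrite -[LHS]/(bproj M _) linear_sum; apply: eq_bigr => i _.
by rewrite linearZZ /= res_scaleE (nth_map 0).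
Qed.

End Restriction.

Section Reduction.
Variables (R : comPzRingType) (x y : R).
Hypotheses (xy : x * y = 0) (hR : ker_im x y R^o) (hR' : ker_im y x R^o).
Local Notation S := (quo_ring x).
Local Notation bar := (quo_mod x).
Implicit Types C F G I K M N P U V W X : lmodType R.

Let yx : y * x = 0. Proof. by rewrite mulrC. Qed.

Lemma bar_ses U V W (i : {linear U -> V}) (p : {linear V -> W}) :
  ses i p -> ker_im x y U -> ses (bmap x i) (bmap x p).
Proof.
move=> [ii ps ie] hU; split.
- apply/lin_inj0 => q; have [u <-] := bpi_surj q; rewrite bmapE => /bpi_eq0[v vE].
  apply/bpi_eq0; apply: hU; apply: ii.
  by rewrite linearZZ -vE scalerA yx scale0r linear0.
- move=> q; have [w <-] := bpi_surj q; have [v <-] := ps w.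
  by exists (bpi x v); rewrite bmapE.
- move=> q; have [v <-] := bpi_surj q; rewrite bmapE; split=> [/bpi_eq0[w wE]|[u]].
    have [v' v'E] := ps w; have [|u uE] := (ie (v - x *: v')).1.
      by rewrite linearB linearZZ v'E wE subrr.
    exists (bpi x u); rewrite bmapE uE; apply/bpi_eq; exists (- v').
    by rewrite scalerN [RHS]addrC addKr.
  have [u' <-] := bpi_surj u; rewrite bmapE => /bpi_eq[c cE].
  apply/bpi_eq0; exists (- p c); rewrite scalerN -linearZZ cE linearB.
  by rewrite (_ : p (i u') = 0) ?sub0r ?opprK //; apply/ie; exists u'.
Qed.

Lemma bar_projective P : projective P -> projective (bar P).
Proof.
move=> Pp U V f g /surjP fs.
have [h hE] := proj_lift (p := rmap f) (lcomp (rmap g) (bproj x P)) Pp fs.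
exists (blift h); apply: (bar_ext (f := lcomp f (blift h)) (g := g)) => m.
by rewrite lcompE bliftE; exact: hE.
Qed.

(* [y] identifies [I/xI] with the [x]-torsion of [I]. *)
Lemma bar_times_y I : ker_im x y I ->
  exists f : {linear res (bar I) -> I}, injective f /\ forall i, f (bpi x i) = y *: i.
Proof.
move=> hI; have [|i|f fE] := @factor_surj _ _ _ _ (bproj x I) (mulx I y).
- exact: bpi_surj.
- by move=> /bpi_eq0[c <-]; rewrite /= scalerA yx scale0r.
exists f; split=> //; apply/lin_inj0 => q; have [i <-] := bpi_surj q.
by move=> e; apply/bpi_eq0/hI; rewrite -[LHS]fE.
Qed.

Lemma bar_injective I : injective_module I -> injective_module (bar I).
Proof.
move=> Ii U V f g fi.
have hI := ker_im_injective hR' Ii; have hI' := ker_im_injective hR Ii.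
have [t [ti tE]] := bar_times_y hI.
have [h hE] := Ii _ _ (rmap f) (lcomp t (rmap g)) fi.
have [v|k kE] := @factor_inj _ _ _ _ t h ti.
  have [|i iE] := hI' (h v); first by rewrite -linearZZ res_x linear0.
  by exists (bproj x I i); rewrite -iE -tE.
exists (cmap k) => u; apply: ti; rewrite -[LHS]/(t (k (f u))) kE.
exact: hE.
Qed.

Lemma bar_cogenerator I : injective_module I -> cogenerator I -> cogenerator (bar I).
Proof.
move=> Ii Ic U u u0; have [phi phiu] := Ic (res U) u u0.
have hI := ker_im_injective hR' Ii; have hI' := ker_im_injective hR Ii.
have [t [ti tE]] := bar_times_y hI.
have [v|k kE] := @factor_inj _ _ _ _ t phi ti.
  have [|i iE] := hI' (phi v); first by rewrite -linearZZ res_x linear0.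
  by exists (bproj x I i); rewrite -iE -tE.
exists (cmap k) => ku; apply: phiu.
by rewrite -kE (_ : k u = 0) ?linear0.
Qed.

Lemma bar_flat F : flat F -> flat (bar F).
Proof.
move=> Ff; pose E : lmodType R := cog R.
have Ei : injective_module E := @cog_injective R.
apply: (dual_flat (bar_cogenerator Ei (@cog_cogenerator R))).
have Fi := flat_dual Ei Ff.
have hE := ker_im_injective hR' Ei; have hE' := ker_im_injective hR Ei.
have [t [ti tE]] := bar_times_y hE.
have bl : linear (fun f : lhom F E => lam (bmap x (lap f)) : res (lhom (bar F) (bar E))).
  move=> a f g; apply: lamP; apply: bar_ext => m.
  rewrite -[RHS]/(bpr x a *: bmap x (lap f) (bpi x m) + bmap x (lap g) (bpi x m)).
  by rewrite -[LHS]/(bmap x (lap (a *: f + g)) (bpi x m)) !bmapE -bpiZ -bpiD.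
pose T := blift (mklin bl).
have TE f m : lap (T (bpi x f)) (bpi x m) = bpi x (lap f m).
  by rewrite /T bliftE -[LHS]/(bmap x (lap f) (bpi x m)) bmapE.
have Ti : injective T.
  apply/lin_inj0 => q; have [f <-] := bpi_surj q => e.
  apply/bpi_eq0; apply: (ker_im_injective hR' Fi); apply: lamP => m.
  have := TE f m; rewrite e => /esym/bpi_eq0[c cE].
  by rewrite -[LHS]/(y *: lap f m) -cE scalerA yx scale0r.
have Ts psi : exists q, T q = psi.
  pose chi := lcomp t (lcomp (rmap (lap psi)) (bproj x F)).
  have [|phi phiE] := ker_im_injective hR Fi (m := lam chi).
    apply: lamP => m; rewrite -[LHS]/(x *: t (lap psi (bpi x m))) -linearZZ.
    by rewrite (res_x (lap psi (bpi x m))) linear0.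
  exists (bpi x phi); apply: lamP; apply: bar_ext => m; rewrite TE; apply: ti.
  rewrite tE; exact: (congr1 (fun l => lap l m) phiE).
have [T' [_ TT']] := lin_inverse Ti Ts.
by apply: inj_retract TT' _; exact: bar_injective.
Qed.

Lemma bar_tens C N :
  exists f : {linear bar (tens C N) -> tens (bar C) (bar N)},
    injective f /\ forall t, exists u, f u = t.
Proof.
have bb : bilin (fun c n => pure (bpi x c) (bpi x n) : res (tens (bar C) (bar N))).
  by split=> [n|c] a u v; rewrite bpiD bpiZ ?pure_linl ?pure_linr.
pose f := blift (tlift bb); exists f.
have fE c n : f (bpi x (pure c n)) = pure (bpi x c) (bpi x n).
  by rewrite /f bliftE tliftE.
split=> [|t]; last first.
  rewrite [t]tens_sum; elim: (repr t) => [|[q r] s [u IHs]].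
    by exists 0; rewrite big_nil linear0.
  have [c cE] := bpi_surj q; have [n nE] := bpi_surj r.
  by exists (bpi x (pure c n) + u); rewrite big_cons linearD IHs fE cE nE.
apply: (cog_inj (@cog_cogenerator S)) => h.
pose g n := lcomp (rmap h) (lcomp (bproj x (tens C N)) (purel C n)).
have gl : linear (fun n => lam (blift (g n)) : res (lhom (bar C) (cog S))).
  move=> a m n; apply: lamP; apply: bar_ext => c.
  rewrite -[LHS]/(blift (g (a *: m + n)) (bpi x c)).
  rewrite -[RHS]/(bpr x a *: blift (g m) (bpi x c) + blift (g n) (bpi x c)).
  rewrite !bliftE -[LHS]/(h (bpi x (pure c (a *: m + n)))) pure_linr bpiD bpiZ.
  by rewrite linearP.
exists (tuncurry (blift (mklin gl))).
apply: (bar_ext (f := lcomp (tuncurry (blift (mklin gl))) f) (g := h)) => t.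
pose l := lcomp (rmap (lcomp (tuncurry (blift (mklin gl))) f)) (bproj x (tens C N)).
apply: (tens_ext (f := l) (g := lcomp (rmap h) (bproj x (tens C N)))) => c n.
rewrite -[LHS]/(tuncurry (blift (mklin gl)) (f (bpi x (pure c n)))) fE tuncurryE bliftE.
by rewrite -[LHS]/(blift (g n) (bpi x c)) bliftE.
Qed.

Section Homs.
Variable C : lmodType R.
Hypotheses (hC : ker_im x y C) (hC' : ker_im y x C).

Lemma ker_im_syzygy_hom X K G (i : {linear K -> G}) (p : {linear G -> X}) :
  ses i p -> projective G -> extends i C ->
  (ker_im x y (lhom X C) -> ker_im y x (lhom K C)) /\ (ker_im y x (lhom X C) -> ker_im x y (lhom K C)).
Proof.
move=> ip Gp ext.
have d : ses (lpre C p) (lpre C i).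
  have [ii ps ie] := ip; split.
  - apply/lin_inj0 => f fp; apply: lamP => w; have [v <-] := ps w.
    by rewrite -[LHS]/(lap (lpre C p f) v) fp.
  - by move=> f; have [g gE] := ext (lap f); exists (lam g); apply: lamP.
  - move=> f; split=> [fi|[g <-]].
      have [v /ie[u <-]|g gE] := @factor_surj _ _ _ _ p (lap f) ps.
        by rewrite -[LHS]/(lap (lpre C i f) u) fi.
      by exists (lam g); apply: lamP.
    apply: lamP => u; rewrite -[LHS]/(lap g (p (i u))) (ses_comp _ ip).
    exact: linear0.
by split=> hX; apply: (ker_im_coker _ d hX) => //; exact: ker_im_proj_lhom.
Qed.

Lemma hom_lift X : ext_vanish 1 X C -> ker_im y x (lhom X C) ->
  forall g : {linear X -> res (bar C)}, exists f : {linear X -> C}, forall u, bpi x (f u) = g u.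
Proof.
move=> [K [G [i [p [ip Gp ext _]]]]] hX g.
have hK := (ker_im_syzygy_hom ip Gp ext).2 hX.
have [h hE] := proj_lift (p := bproj x C) (lcomp g p) Gp (@bpi_surj _ x C).
have hix k : exists c, x *: c = h (i k).
  by apply/bpi_eq0; rewrite -[LHS]/(bproj x C (h (i k))) hE lcompE (ses_comp _ ip) linear0.
have [|h' h'E] := hK (lam (lcomp h i)).
  apply: lamP => k; have [c cE] := hix k.
  by rewrite -[LHS]/(y *: h (i k)) -cE scalerA yx scale0r.
have [k kE] := ext (lap h'); have [_ ps ie] := ip.
have [v /ie[u <-]|f fE] := @factor_surj _ _ _ _ p (lsub h (lscale x k)) ps.
  have e : x *: k (i u) = h (i u).
    by rewrite -[k (i u)]/((k \o i) u) kE; exact: (congr1 (fun l => lap l u) h'E).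
  by rewrite -[LHS]/(h (i u) - x *: k (i u)) e subrr.
exists f => u; have [v <-] := ps u; rewrite fE -[RHS]/(lcomp g p v) -hE.
rewrite -[RHS]/(bpi x (h v)); apply/bpi_eq; exists (- k v); rewrite scalerN /=.
by rewrite addrC addrA addNr add0r.
Qed.

Lemma bar_ext_vanish n X : ker_im x y X -> ker_im y x X -> ker_im x y (lhom X C) -> ker_im y x (lhom X C) ->
  ext_vanish n.+1 X C -> ext_vanish n (bar X) (bar C).
Proof.
elim: n X => // n IHn X hX hX' hXC hXC' [K [G [i [p [ip Gp ext eK]]]]].
have Gf := projective_isflat Gp.
have hK : ker_im x y K := ker_im_ker xy ip (ker_im_flat hR Gf) hX'.
have hK' : ker_im y x K := ker_im_ker yx ip (ker_im_flat hR' Gf) hX.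
have [hKC' hKC] := ker_im_syzygy_hom ip Gp ext.
exists (bar K), (bar G), (bmap x i), (bmap x p); split.
- exact: bar_ses.
- exact: bar_projective.
- move=> f; have [| |f' f'E] := @hom_lift K _ _ (lcomp (rmap f) (bproj x K)).
  + by have [K' [G' [i' [p' [? ? ? _]]]]] := eK; exists K', G', i', p'; split.
  + exact: hKC'.
  have [g gE] := ext f'; exists (bmap x g).
  apply: (bar_ext (f := lcomp (bmap x g) (bmap x i)) (g := f)) => k.
  rewrite lcompE !bmapE -[RHS]/(lcomp (rmap f) (bproj x K) k) -f'E.
  by congr (bpi x _); exact: gE.
- by apply: IHn => //; [exact: hKC | exact: hKC'].
Qed.

Hypothesis Ch : bijective (@homothety R C).
Hypothesis Cext : forall n, ext_vanish n C C.

Lemma homothety_linear : linear (@homothety R C : R^o -> lhom C C).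
Proof. by move=> a b c; apply: lamP => u; rewrite -[LHS]/((a * b + c) *: u) scalerDl -scalerA. Qed.

Lemma ker_im_End : ker_im x y (lhom C C) /\ ker_im y x (lhom C C).
Proof.
have [s sK Ks] := Ch; pose h := mklin homothety_linear.
have hi : injective h by exact: can_inj sK.
have hs f : exists a, h a = f by exists (s f); exact: Ks.
by split; apply: (ker_im_iso hi hs).
Qed.

Lemma bar_ext_vanishing n : ext_vanish n (bar C) (bar C).
Proof. by have [h h'] := ker_im_End; exact: bar_ext_vanish. Qed.

Lemma bar_homothety : bijective (@homothety S (bar C)).
Proof.
have [h h'] := ker_im_End; have [s sK Ks] := Ch.
have lift f : exists a : R, homothety (bar C) (bpr x a) = f.
  have [u uE] := hom_lift (Cext 1) h' (lcomp (rmap (lap f)) (bproj x C)).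
  exists (s (lam u)); apply: lamP; apply: bar_ext => c.
  rewrite -[RHS]uE -[LHS]/(bpr x (s (lam u)) *: bpi x c) -bpiZ.
  by congr (bpi x _); exact: (congr1 (fun l => lap l c) (Ks (lam u))).
have inj a : homothety (bar C) (bpr x a) = 0 -> bpr x a = 0.
  move=> e; have [|b bE] := hR (m := a).
    apply: (can_inj sK); apply: lamP => c.
    rewrite -[LHS]/((y * a) *: c) -[RHS]/((0 : R) *: c) scale0r -scalerA.
    have : bpi x (a *: c) = 0.
      by rewrite bpiZ -[LHS]/(lap (homothety (bar C) (bpr x a)) (bpi x c)) e.
    by move=> /bpi_eq0[d <-]; rewrite scalerA yx scale0r.
  by rewrite -bE -[LHS]/(bpr x (x * b)) bprM bprx mul0r.
have /choice[t tE] := lift; exists (fun f => bpr x (t f)); last exact: tE.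
move=> q; have [a <-] := bpr_surj q; apply/eqP; rewrite -subr_eq0; apply/eqP.
rewrite -bprB; apply: inj; rewrite bprB; set b := t _.
apply: lamP => c; rewrite -[LHS]/((bpr x b - bpr x a) *: c) scalerBl.
have := congr1 (fun l => lap l c) (tE (homothety (bar C) (bpr x a))).
rewrite -[LHS]/(bpr x b *: c) -[RHS]/(bpr x a *: c) => ->.
exact: subrr.
Qed.

End Homs.

Section BarChains.
Variables (K : lmodType R -> Prop) (K' : lmodType S -> Prop).
Hypothesis Kflat : forall F, K F -> flat F.
Hypothesis Kbar : forall F, K F -> K' (bar F).

Lemma chain_ker_im n X : chain K n X -> ker_im x y X /\ ker_im y x X.
Proof.
elim: n X => [|n IHn] X.
  by move=> X0; split=> u _; exists 0; rewrite scaler0 [u]X0.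
move=> [L [F [i [p [ip FK cL]]]]]; have [h h'] := IHn _ cL; have Ff := Kflat FK.
by split; [apply: (ker_im_coker _ ip h') | apply: (ker_im_coker _ ip h)] => //; exact: ker_im_flat.
Qed.

Lemma chain_bar n X : chain K n X -> chain K' n (bar X).
Proof.
elim: n X => [|n IHn] X.
  move=> X0 q; have [u <-] := bpi_surj q; rewrite [u]X0.
  exact: (linear0 (bproj x X)).
move=> [L [F [i [p [ip FK cL]]]]]; have [h _] := chain_ker_im cL.
exists (bar L), (bar F), (bmap x i), (bmap x p); split; [exact: bar_ses | exact: Kbar | exact: IHn].
Qed.
End BarChains.

Lemma ichain_ker_im n X : ichain n X -> ker_im x y X /\ ker_im y x X.
Proof.
elim: n X => [|n IHn] X.
  by move=> X0; split=> u _; exists 0; rewrite scaler0 [u]X0.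
move=> [I [Z [i [p [ip Ii cZ]]]]]; have [h h'] := IHn _ cZ.
by split; [apply: (ker_im_ker _ ip _ h') | apply: (ker_im_ker _ ip _ h)] => //; exact: ker_im_injective.
Qed.

Lemma ichain_bar n X : ichain n X -> ichain n (bar X).
Proof.
elim: n X => [|n IHn] X.
  move=> X0 q; have [u <-] := bpi_surj q; rewrite [u]X0.
  exact: (linear0 (bproj x X)).
move=> cX; have [hX _] := ichain_ker_im cX; move: cX => [I [Z [i [p [ip Ii cZ]]]]].
exists (bar I), (bar Z), (bmap x i), (bmap x p).
by split; [exact: bar_ses | exact: bar_injective | exact: IHn].
Qed.

End Reduction.

(** * Finite injective resolutions *)

Section CosyzygyChains.
Variable A : comPzRingType.
Implicit Types F G I L M N T X Z : lmodType A.

Lemma ichainS n T : ichain n T -> ichain n.+1 T.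
Proof.
elim: n T => [|n IHn] T; last first.
  move=> [I [Z [i [p [ip Ii cZ]]]]]; exists I, Z, i, p; split=> //; exact: IHn.
move=> T0; exists T, T, (lid T), (lzero T T); split=> //; last exact: trivial_injective.
split=> // [x|x]; first by exists 0; rewrite [x]T0.
by split=> // _; exists x.
Qed.

Lemma ichain_le m n T : (m <= n)%N -> ichain m T -> ichain n T.
Proof. by move=> /subnK <- h; elim: (n - m)%N => // k; exact: ichainS. Qed.

Lemma ichain_iso n T T' (h : {linear T' -> T}) :
  injective h -> (forall w, exists v, h v = w) -> ichain n T -> ichain n T'.
Proof.
case: n => [|n] hi hs; first by move=> T0 x; apply: hi; rewrite [LHS]T0 [RHS]T0.
move=> [I [Z [i [p [[ii ps ie] Ii cZ]]]]]; exists I, Z, (lcomp i h), p; split=> //.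
split=> // [x y /ii /hi //|v]; rewrite ie; split=> [[u <-]|[u <-]].
  by have [w <-] := hs u; exists w.
by exists (h u).
Qed.

Lemma ichain1 T : ichain 1 T -> injective_module T.
Proof.
move=> [I [Z [i [p [[ii _ ie] Ii Z0]]]]].
have is_ v : exists u, i u = v by apply/ie; exact: Z0.
by have [g [gK _]] := lin_inverse ii is_; exact: inj_retract gK Ii.
Qed.

Lemma injective_ichain1 T : injective_module T -> ichain 1 T.
Proof.
move=> Ti; have [Z [p ip]] := coker_ses (i := lid T) (@inj_id T).
exists T, Z, (lid T), p; split=> //= z; have [_ ps pe] := ip.
by have [v <-] := ps z; apply/pe; exists v.
Qed.

Lemma ichain_coker n X M F (i : {linear F -> X}) (p : {linear X -> M}) :
  ses i p -> injective_module F -> ichain n.+1 X -> ichain n.+1 M.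
Proof.
move=> [ii ps ie] Fi [I [Z [j [q [[ji qs je] Ii cZ]]]]].
have jii : injective (lcomp j i) by move=> u v /ji /ii.
have [J [k jk]] := coker_ses jii; have [_ ks ke] := jk.
have [x /ie[f <-]|r rE] := @factor_surj _ _ _ _ p (lcomp k j) ps.
  exact: (ses_comp f jk).
have [v /ke[f <-]|s sE] := @factor_surj _ _ _ _ k q ks.
  by apply/je; exists (i f).
exists J, Z, r, s; split=> //; last exact: inj_coker jk Fi Ii.
split=> [|z|v].
- apply/lin_inj0 => m; have [x <-] := ps m; rewrite rE => /ke[f /ji <-].
  by apply/ie; exists f.
- by have [v <-] := qs z; exists (k v).
- have [w <-] := ks v; rewrite sE; split=> [/je[x <-]|[m]].
    by exists (p x); rewrite rE.
  have [x <-] := ps m; rewrite rE => /esym e.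
  have [|f fE] := (ke (w - j x)).1; first by rewrite linearB e subrr.
  by apply/je; exists (x + i f); rewrite linearD -[j (i f)]/(lcomp j i f) fE addrC subrK.
Qed.

Lemma ichain_prod n X G : injective_module G -> ichain n.+1 X -> ichain n.+1 (G * X)%type.
Proof.
move=> Gi [I [Z [j [q [[ji qs je] Ii cZ]]]]].
exists (G * I)%type, Z, (lpair (lfst G X) (lcomp j (lsnd G X))), (lcomp q (lsnd G I)).
split=> //; last exact: inj_prod.
split=> [[g u] [h v] /= [-> /ji ->] //|z|[g v] /=].
  by have [v <-] := qs z; exists (0, v).
by rewrite je; split=> [[u <-]|[[h u] [_ <-]]]; [exists (g, u) | exists u].
Qed.

Lemma ichain_cosyzygy n N M G (i : {linear N -> G}) (p : {linear G -> M}) :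
  ses i p -> injective_module G -> ichain n.+2 N -> ichain n.+1 M.
Proof.
move=> [ii ps ie] Gi [F [L [j [q [[ji qs je] Fi cL]]]]].
have [phi phiE] := Gi _ _ j i ji.
have [v /je[u <-]|psi psiE] := @factor_surj _ _ _ _ q (lcomp p phi) qs.
  by rewrite lcompE -[phi (j u)]/((phi \o j) u) phiE; apply/ie; exists u.
apply: (@ichain_coker n (G * L)%type M F (lpair phi q) (lsub (lcomp p (lfst G L)) (lcomp psi (lsnd G L)))) => //.
  split=> [|m|[g l]].
  - apply/lin_inj0 => f [phif /je[u uE]]; rewrite -uE (_ : u = 0) ?linear0 //.
    by apply: ii; rewrite -phiE /= uE phif linear0.
  - by have [g <-] := ps m; exists (g, 0); rewrite /= linear0 subr0.
  - split=> [/= e|[f [<- <-]]]; last by rewrite /= psiE subrr.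
    have [f fE] := qs l; have [|u uE] := (ie (g - phi f)).1.
      by rewrite linearB -[p (phi f)]/(lcomp p phi f) -psiE fE.
    exists (f + j u); congr pair; rewrite /= linearD.
      by rewrite -[phi (j u)]/((phi \o j) u) phiE uE addrC subrK.
    by rewrite fE (_ : q (j u) = 0) ?addr0 //; apply/je; exists u.
exact: ichain_prod.
Qed.

End CosyzygyChains.

Section FlatProjectiveChains.
Variable A : comPzRingType.
Hypothesis An : noetherian A.
Implicit Types F G I L M N T X Z : lmodType A.

Lemma chain1_retract (K : lmodType A -> Prop) X : chain K 1 X ->
  exists F (p : {linear F -> X}), [/\ K F, injective p & forall x, exists u, p u = x].
Proof.
move=> [L [F [i [p [[ii ps ie] FK L0]]]]]; exists F, p; split=> //.
by apply/lin_inj0 => u /ie[l <-]; rewrite [l]L0 linear0.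
Qed.

Lemma chain1_projective X : chain (@projective A) 1 X -> projective X.
Proof.
move=> /chain1_retract[F [p [Fp pi ps]]]; have [g [_ pg]] := lin_inverse pi ps.
exact: proj_retract pg Fp.
Qed.

Lemma flat_iso F G (f : {linear F -> G}) :
  injective f -> (forall v, exists u, f u = v) -> flat F -> flat G.
Proof.
move=> fi fs Ff; have [Q [q fq]] := coker_ses fi.
apply: (flat_isext fq Ff); apply: projective_isflat; apply: trivial_projective => z.
have [_ qs qe] := fq; have [v <-] := qs z; apply/qe; exact: fs.
Qed.

Lemma finite_chain_flat n X : finite_module X -> chain (@flat A) n X -> chain (@projective A) n X.
Proof.
elim: n X => // n IHn X Xf; case: n IHn => [_|n IHn] cX.
  apply: chain1; apply: (finite_flat_projective An (@cog_injective A) (@cog_cogenerator A)) => //.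
  by have [F [p [Ff pi ps]]] := chain1_retract cX; exact: flat_iso pi ps Ff.
have [L [P [i [p [Pf Lf ip]]]]] := finite_ses An Xf.
have Pp := finfree_projective Pf.
exists L, P, i, p; split=> //; apply: IHn => //.
apply: (chain_syzygy _ _ _ ip Pp cX); first exact: projective_isflat.
  exact: flat_isker.
exact: flat_isprod.
Qed.

Lemma noeth_lhom L M : finite_module L -> finite_module M -> noeth (lhom L M).
Proof.
move=> Lf Mf; have Mn := finite_noeth An Mf.
have [P [p [Pf ps]]] := fg_cover Lf.
have pi : injective (lpre M p).
  apply/lin_inj0 => f fp; apply: lamP => u; have [v <-] := ps u.
  by rewrite -[LHS]/(lap (lpre M p f) v) fp.
apply: noeth_inj pi _; elim: Pf => [|P' _ IH].
  apply: (noeth_inj (i := lev M (1 : A^o))) Mn; apply/lin_inj0 => f f0.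
  by apply: lamP => a; rewrite -[LHS](rscale1 (lap f)) -[LHS]/((a : A) *: lap f 1) (f0 : lap f 1 = 0) scaler0.
apply: (noeth_inj (i := lpair (lpre M (linl A^o P')) (lpre M (linr A^o P')))) (noeth_ext (prod_ses _ _) _ IH).
- apply/lin_inj0 => f [f1 f2]; apply: lamP => -[a u].
  have -> : (a, u) = (linl A^o P') a + (linr A^o P') u by congr pair; rewrite /= ?addr0 ?add0r.
  have e1 : lap f (linl A^o P' a) = 0 := congr1 (@^~ a) f1.
  have e2 : lap f (linr A^o P' u) = 0 := congr1 (@^~ u) f2.
  by rewrite linearD e1 e2 addr0.
- apply: (noeth_inj (i := lev M (1 : A^o))) Mn; apply/lin_inj0 => f f0.
  by apply: lamP => a; rewrite -[LHS](rscale1 (lap f)) -[LHS]/((a : A) *: lap f 1) (f0 : lap f 1 = 0) scaler0.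
Qed.

Lemma finite_lhom L M : finite_module L -> finite_module M -> finite_module (lhom L M).
Proof. by move=> Lf Mf; apply/noeth_finite/noeth_lhom. Qed.

Definition noeth_mod X (B : submod X) : Prop := forall N : submod X, (forall b, B b -> N b) ->
  exists s : seq X, (forall u, u \in s -> N u) /\
    forall v, N v -> exists w b, [/\ lspan s w, B b & v = w + b].

Lemma noeth_noeth_mod X (B : submod X) : noeth X -> noeth_mod B.
Proof.
move=> /noethP nX N _; have [s [s1 s2]] := nX N; exists s; split=> // v /s2 sv.
by exists v, 0; rewrite addr0; split=> //; exact: submod0.
Qed.

(* An injection [X/B -> Y/B'], presented by a linear relation. *)
Lemma noeth_mod_rel X Y (B : submod X) (B' : submod Y) (rho : submod (X * Y)%type) :
  (forall u, exists v, rho (u, v)) -> (forall u v, rho (u, v) -> B' v -> B u) ->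
  (forall v, B' v -> rho (0, v)) -> noeth_mod B' -> noeth_mod B.
Proof.
move=> tot inj zero nY N BN.
have sN : submodule [set v | exists2 u, N u & rho (u, v)].
  split=> [|a v v' [u Nu uv] [u' Nu' uv']] /=; first by exists 0; exact: submod0.
  exists (a *: u + u'); first exact: submodP.
  exact: (submodP (N := rho) a uv uv').
have [|s [s1 s2]] := nY (Submod sN); first by move=> v B'v; exists 0; [exact: submod0 | exact: zero].
pose Q (w : X * Y) := N w.1 /\ rho w.
have [|t [tE tQ]] := @lift_seq (X * Y)%type Y snd Q s.
  by move=> v /s1[u Nu uv]; exists (u, v).
exists (map fst t); split=> [_ /mapP[w /tQ[h _] ->] //|u Nu].
have [v uv] := tot u; have [|w' [b [ws Bb vE]]] := s2 v; first by exists u.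
move: ws; rewrite -tE => /(lspan_map (lsnd X Y))[w wt wE].
have rw : rho w by apply: lspan_min wt => z /tQ[].
exists w.1, (u - w.1); split; last by rewrite addrC subrK.
  by apply/(lspan_map (lfst X Y)); exists w.
apply: (inj _ b) => //; have := submodB uv rw; congr (rho _).
by congr pair; rewrite /= -[w.2]/(lsnd X Y w) wE vE addrC addKr.
Qed.

(* [Ext^1(L, Z)] is noetherian for all finite [L]. *)
Definition noeth_ext1 Z : Prop := forall (K G L : lmodType A) (i : {linear K -> G}) (p : {linear G -> L}),
  ses i p -> finfree G -> noeth_mod (imsub (lpre Z i)).

Lemma finite_noeth_ext1 Z : finite_module Z -> noeth_ext1 Z.
Proof.
move=> Zf K G L i p [ii _ _] Gf; apply/noeth_noeth_mod/noeth_lhom => //.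
exact: (finite_inj An ii (finfree_finite An Gf)).
Qed.

Lemma noeth_ext1_cosyzygy Z I Z' (j : {linear Z -> I}) (q : {linear I -> Z'}) :
  ses j q -> injective_module I -> noeth_ext1 Z -> noeth_ext1 Z'.
Proof.
move=> [ji qs je] Ii nZ K G L i p [ii ps ie] Gf.
have Kf : finite_module K by exact: (finite_inj An ii (finfree_finite An Gf)).
have [K' [G' [i' [p' [Gf' _ ip']]]]] := finite_ses An Kf.
have [ii' ps' ie'] := ip'.
have sr : submodule [set w : (lhom K Z' * lhom K' Z)%type | exists g : lhom G' I,
    lpost G' q g = lpre Z' p' w.1 /\ lpre I i' g = lpost K' j w.2].
  split=> [|a w1 w2 [g1 [g11 g12]] [g2 [g21 g22]]].
    exists 0; split; first exact: etrans (linear0 _) (esym (linear0 (lpre Z' p'))).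
    exact: etrans (linear0 _) (esym (linear0 (lpost K' j))).
  exists (a *: g1 + g2); split.
    by rewrite -[(a *: w1 + w2).1]/(a *: w1.1 + w2.1) !linearP g11 g21.
  by rewrite -[(a *: w1 + w2).2]/(a *: w1.2 + w2.2) !linearP g12 g22.
apply: (noeth_mod_rel (rho := Submod sr)) (nZ _ _ _ _ _ ip' Gf').
- move=> f; have [g gE] := proj_lift (lcomp (lap f) p') (finfree_projective Gf') qs.
  have [k|h hE] := @factor_inj _ _ _ _ j (lcomp g i') ji.
    by apply/je; rewrite lcompE gE lcompE (ses_comp _ ip') linear0.
  exists (lam h), (lam g); split; apply: lamP => u; first exact: gE.
  exact: (esym (hE u)).
- move=> f h [g [g1 g2]] [k kE]; rewrite /= in g1 g2.
  have [u /ie'[v <-]|l lE] := @factor_surj _ _ _ _ p' (lsub (lap g) (lcomp j (lap k))) ps'.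
    have := congr1 (fun t => lap t v) g2; rewrite -kE.
    by rewrite -[lap (lpre I i' g) v]/(lap g (i' v)) /= => ->; exact: subrr.
  have [l' l'E] := Ii _ _ i l ii.
  exists (lam (lcomp q l')); apply: lamP => v.
  rewrite -[LHS]/(q ((l' \o i) v)) l'E; have [u <-] := ps' v; rewrite lE /= linearB.
  rewrite (_ : q (j _) = 0) ?subr0; last by apply/je; eexists.
  exact: (congr1 (fun t => lap t u) g1).
- move=> h [k <-]; exists (lpost G' j k); split; apply: lamP => u //.
  by apply/je; eexists.
Qed.

End FlatProjectiveChains.

(** * Local rings *)

Section Nakayama.
Variables (R : comPzRingType) (x : R).

Lemma local_unit : noetherian R -> local_ring R -> range ( *:%R x : R^o -> R^o) <> setT ->
  forall a : R, exists u, u * (1 - x * a) = 1.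
Proof.
move=> Rn [m [[ms mT mmax] muniq]] xT a.
have in_m z : (forall u : R, u * z <> 1) -> m z.
  move=> zn; pose P (I : set R^o) := [/\ submodule I, ~ I (1 : R^o) & I z].
  have [||N [[sN N1 Nz] Nmax]] := @noeth_max R R^o P [set b | exists u : R, u * z = b] Rn.
  - by move=> N [].
  - split; last by exists 1; rewrite mul1r.
      split=> [|c _ _ [u <-] [v <-]]; first by exists 0; rewrite mul0r.
      by exists (c * u + v); rewrite mulrDl -mulrA.
    by case=> u; exact: zn.
  suff NM : maximal_ideal N by rewrite (muniq N NM).
  split=> // [NT|I sI NI]; first by apply: N1; rewrite NT.
  have [I1|I1] := pselect (I (1 : R^o)); [right | left].
    rewrite eqEsubset; split=> // b _; have := submodZ (N := Submod sI) b I1.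
    by rewrite (_ : b *: (1 : R^o) = b) //; exact: mulr1.
  rewrite eqEsubset; split=> //; apply: Nmax => //; split=> //; exact: NI.
have mx : m x.
  apply: in_m => u ux; apply: xT; rewrite eqEsubset; split=> // b _.
  exists (u * b) => //; rewrite -[LHS]/(x * (u * b)) mulrA [x * u]mulrC ux; exact: mul1r.
apply: contrapT => none.
have m1 : m (1 - x * a) := in_m _ (fun u e => none (ex_intro _ u e)).
apply: mT; rewrite eqEsubset; split=> // b _.
have h := submodP (N := Submod ms) a mx m1.
have e : a *: (x : R^o) + (1 - x * a : R^o) = (1 : R^o).
  by rewrite -[a *: (x : R^o)]/(a * x) mulrC addrC subrK.
have := submodZ (N := Submod ms) b h; rewrite e (_ : b *: (1 : R^o) = b) //.
exact: mulr1.
Qed.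

Hypothesis unit : forall a : R, exists u, u * (1 - x * a) = 1.
Implicit Types X Y : lmodType R.

Lemma nakayama X (B : submod X) (s : seq X) :
  (forall v, exists w b, [/\ lspan s w, B b & v = w + b]) ->
  (forall v, exists w b, B b /\ v = x *: w + b) -> forall v, B v.
Proof.
elim: s => [|u s IHs] gen div v; first by have [w [b [/lspan_nil -> Bb ->]]] := gen v; rewrite add0r.
apply: IHs => // {}v.
have uE : exists w b, [/\ lspan s w, B b & u = w + b].
  have [w [b [Bb ub]]] := div u; have [w' [b' [/lspan_cons[a [t [st ->]]] Bb' wE]]] := gen w.
  have [c cE] := unit a.
  exists (c *: (x *: t)), (c *: (x *: b' + b)); split.
  - exact: (submodZ (N := spansub s) c (submodZ (N := spansub s) x st)).
  - exact: submodZ (submodP x Bb' Bb).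
  - rewrite -scalerDr -[LHS]scale1r -cE -scalerA; congr (c *: _).
    have e : u = (x * a) *: u + (x *: t + (x *: b' + b)).
      by rewrite {1}ub wE !scalerDr scalerA !addrA.
    by rewrite scalerBl scale1r {1}e [LHS]addrC addKr.
have [w [b [/lspan_cons[a [t [st ->]]] Bb ->]]] := gen v; have [w' [b' [sw' Bb' uE']]] := uE.
exists (a *: w' + t), (a *: b' + b); split; [exact: (submodP (N := spansub s)) | exact: submodP |].
by rewrite uE' scalerDr -[LHS]addrA addrACA.
Qed.

Lemma nakayama_finite X (B : submod X) : finite_module X ->
  (forall v, exists w b, B b /\ v = x *: w + b) -> forall v, B v.
Proof.
case=> s sE; apply: (nakayama (s := s)) => v; exists v, 0; rewrite addr0; split=> //.
  by rewrite sE.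
exact: submod0.
Qed.

Lemma nakayama0 X : finite_module X -> (forall v : X, exists w, v = x *: w) -> forall v : X, v = 0.
Proof.
move=> Xf div v; pose B := kersub (lid X).
suff : B v by [].
apply: nakayama_finite => // {}v; have [w ->] := div v; exists w, 0.
by rewrite addr0; split=> //; exact: submod0.
Qed.

End Nakayama.

Section LocalReduction.
Variables (R : comPzRingType) (x y : R).
Hypotheses (Rn : noetherian R) (unit : forall a : R, exists u, u * (1 - x * a) = 1).
Hypotheses (xy : x * y = 0 :> R) (hR : ker_im x y R^o) (hR' : ker_im y x R^o).
Local Notation S := (quo_ring x).
Local Notation bar := (quo_mod x).
Implicit Types C F G I K M N P T U V W X Z : lmodType R.

Let yx : y * x = 0. Proof. by rewrite mulrC. Qed.

Lemma bar_eq0 X : finite_module X -> (forall q : bar X, q = 0) -> forall v : X, v = 0.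
Proof.
move=> Xf X0; apply: (nakayama0 unit Xf) => v.
by have /bpi_eq0[w <-] := X0 (bpi x v); exists w.
Qed.

Lemma projective_of_bar n X : finite_module X -> chain (@projective R) n X ->
  projective (bar X) -> projective X.
Proof.
elim: n X => [|n IHn] X Xf; first by move=> /trivial_projective.
case: n IHn => [_ /chain1_projective //|n IHn] cX Xp.
have [K [G [i [p [Gff Kf ip]]]]] := finite_ses Rn Xf.
have Gp := finfree_projective Gff.
have cK : chain (@projective R) n.+1 K.
  apply: (chain_syzygy _ _ _ ip Gp cX) => //; first exact: proj_ker.
  exact: proj_prod.
have [hK _] := chain_ker_im xy hR hR' (@projective_isflat R) cK.
have bip := bar_ses xy ip hK.
have Kp : projective K.
  by apply: IHn => //; apply: proj_ker bip _ Xp; exact: bar_projective.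
have [s' s'E] := proj_split bip Xp; have [r' [r'E _]] := ses_retract bip s'E.
have [r rE] := proj_lift (p := bproj x K) (lcomp (rmap r') (bproj x G)) Gp (@bpi_surj _ x K).
have rik k : exists c, x *: c = r (i k) - k.
  apply/bpi_eq; rewrite -[LHS]/(bproj x K (r (i k))) rE -[LHS]/(r' (bpi x (i k))) -(bmapE x i).
  exact: r'E.
have phis k : exists v, lcomp r i v = k.
  apply: (nakayama_finite unit (B := imsub (lcomp r i)) Kf) => v.
  have [c cE] := rik v; exists (- c), (r (i v)); split; first by exists v.
  by rewrite scalerN cE opprB subrK.
have [s sE] := proj_lift (lid K) Kp phis.
have ss k : exists v, s v = k.
  apply: (nakayama_finite unit (B := imsub s) Kf) => v.
  have [c cE] := rik (v - s (lcomp r i v)).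
  exists (- c), (s (lcomp r i v)); split; first by eexists.
  have z0 : r (i (v - s (lcomp r i v))) = 0.
    rewrite -[LHS]/(lcomp r i (v - s (lcomp r i v))) linearB (sE (lcomp r i v)).
    exact: subrr.
  by rewrite scalerN cE z0 sub0r opprK subrK.
have retr k : lcomp s r (i k) = k.
  have [v <-] := ss k; rewrite lcompE -[r (i _)]/(lcomp r i (s v)).
  by rewrite sE.
have [t [tE _]] := ses_section ip retr.
exact: proj_retract tE Gp.
Qed.

Lemma chain_of_bar m n X : finite_module X -> chain (@projective R) n X ->
  chain (@projective S) m (bar X) -> chain (@projective R) m X.
Proof.
elim: m n X => [|m IHm] n X Xf cX; first exact: bar_eq0.
case: m IHm => [_ /chain1_projective Xp|m IHm cbX].
  by apply: chain1; exact: projective_of_bar cX Xp.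
have [K [G [i [p [Gff Kf ip]]]]] := finite_ses Rn Xf.
have Gp := finfree_projective Gff.
have c2 : chain (@projective R) n.+2 X by apply: (chain_le _ _ cX) => //; rewrite -addn2 leq_addr.
have cK : chain (@projective R) n.+1 K.
  apply: (chain_syzygy _ _ _ ip Gp c2) => //; first exact: proj_ker.
  exact: proj_prod.
have [hK _] := chain_ker_im xy hR hR' (@projective_isflat R) cK.
have bip := bar_ses xy ip hK.
exists K, G, i, p; split=> //; apply: IHm cK _ => //.
apply: (chain_syzygy _ _ _ bip (bar_projective Gp) cbX) => //; first exact: proj_ker.
exact: proj_prod.
Qed.

Section InjectiveOfBar.
Variables (Z I Z' : lmodType R) (i : {linear Z -> I}) (p : {linear I -> Z'}).
Hypotheses (ip : ses i p) (Ii : injective_module I) (Z'i : injective_module Z').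
Hypotheses (nZ : noeth_ext1 Z) (bZ : injective_module (bar Z)).

(* As [I] is injective, this says that [Ext^1(R/a, Z) = 0]. *)
Let good (a : set R^o) := forall w : Z', (forall b : R, a b -> b *: w = 0) ->
  exists e, p e = w /\ forall b : R, a b -> b *: e = 0.

Let good_x (a : submod R^o) : a x -> good a.
Proof.
move=> ax w aw; have hZ' := ker_im_injective hR Z'i; have hI := ker_im_injective hR' Ii.
have hI' := ker_im_injective hR Ii; have hZ'' := ker_im_injective hR' Z'i.
have hZ : ker_im x y Z := ker_im_ker xy ip hI hZ'.
have bip := bar_ses xy ip hZ.
have [r rE] := inj_split bip bZ; have [s [sE _]] := ses_section bip rE.
have [|w1 w1E] := hZ' w; first exact: aw.
have [e1 e1E] := bpi_surj (s (bpi x w1)).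
have /bpi_eq[c cE] : bpi x (p e1) = bpi x w1 by rewrite -bmapE e1E sE.
exists (y *: e1); split=> [|b ab].
  rewrite linearZZ -w1E; apply/eqP; rewrite -subr_eq0 -scalerBr -cE scalerA yx scale0r.
  exact: eqxx.
have [|d dE] := hZ'' (b *: w1); first by rewrite scalerA mulrC -scalerA w1E aw.
have /bpi_eq0[f fE] : bpi x (b *: e1) = 0.
  rewrite bpiZ e1E -linearZ -bpiZ -dE (_ : bpi x (x *: d) = 0) ?linear0 //.
  by apply/bpi_eq0; exists d.
by rewrite scalerA mulrC -scalerA -fE scalerA yx scale0r.
Qed.

(* Extends [b r |-> b e] from [(a + R r)/a] to [R/a]. *)
Let extend_quo (J : lmodType R) (a : submod R^o) (r : R) (e : J) : injective_module J ->
  (forall b : R, a (b * r) -> b *: e = 0) ->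
  exists f, r *: f = e /\ forall b : R, a b -> b *: f = 0.
Proof.
move=> Ji ker; pose q := qproj a; pose g := lcomp q (mulx R^o r).
have gE b : g b = 0 <-> a (b * r) by rewrite lcompE qproj_eq0 [mulx _ _ _]mulrC.
pose N := preimsub (mulx R^o r) a.
have Nr (b : R) : N b <-> a (b * r) by rewrite (mulrC b r).
have [b /gE/Nr/(@subinc_ex _ _ N) //|b|k kE] :=
  @injective_exact R J _ _ _ (subinc N) g (rscale e) Ji.
  by apply: ker; apply/Nr; exact: subincP.
exists (k (q (1 : R^o))); split=> [|b ab].
  rewrite -linearZZ -linearZZ -[RHS]scale1r -[RHS]/(rscale e (1 : R^o)) -kE.
  by [].
rewrite -linearZZ -linearZZ (_ : q _ = 0) ?linear0 //; apply/qproj_eq0.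
by rewrite (_ : b *: (1 : R^o) = b) //; exact: mulr1.
Qed.

Let good_colon (a : submod R^o) (r : R) : a (x * r) ->
  (forall b : submod R^o, (forall c, a c -> b c) -> b r -> good b) -> good a.
Proof.
move=> axr IH w aw.
have sc : submodule [set b : R^o | a ((b : R) * r)].
  split=> [|c b b' ab ab']; first by rewrite /= mul0r; exact: submod0.
  by rewrite /= mulrDl -mulrA; exact: (submodP (N := a)).
have [||e0 [pe0 ke0]] := @good_x (Submod sc) _ (r *: w) => //.
  by move=> b ab; rewrite scalerA; exact: aw.
have [e1 [re1 ae1]] := extend_quo Ii ke0.
have sb : submodule [set b : R^o | exists c (d : R), a c /\ b = c + d * r].
  split=> [|t _ _ [c [d [ac ->]]] [c' [d' [ac' ->]]]].
    by exists 0, 0; rewrite mul0r addr0; split=> //; exact: submod0.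
  exists (t *: c + c'), (t * d + d'); split; first exact: (submodP (N := a)).
  by rewrite scalerDr mulrDl -mulrA addrACA.
have [|||e2 [pe2 ae2]] := IH (Submod sb) _ _ (w - p e1).
- by move=> c ac; exists c, 0; rewrite mul0r addr0.
- by exists 0, 1; rewrite mul1r add0r; split=> //; exact: submod0.
- move=> _ [c [d [ac ->]]]; rewrite scalerDl -scalerA.
  have -> : r *: (w - p e1) = 0 by rewrite scalerBr -linearZZ re1 pe0 subrr.
  by rewrite scaler0 addr0 scalerBr -linearZZ ae1 // linear0 aw // subr0.
exists (e1 + e2); split=> [|b ab]; first by rewrite linearD pe2 addrC subrK.
rewrite scalerDr ae1 // ae2 ?addr0 //; exists b, 0.
by rewrite mul0r addr0.
Qed.

Let good_regular (a : submod R^o) : (forall b : R, a (x * b) -> a b) -> good a.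
Proof.
move=> reg.
have sX : submodule [set w : Z' | forall b : R, a b -> b *: w = 0].
  split=> [b _|c u v hu hv b ab] /=; first exact: scaler0.
  by rewrite scalerDr hv // addr0 scalerA mulrC -scalerA hu // scaler0.
pose X := subm (Submod sX); pose j : {linear X -> Z'} := subinc (Submod sX).
have sB : submodule [set w : X | exists e, p e = j w /\ forall b : R, a b -> b *: e = 0].
  split=> [|c u v [e [pe ae]] [f [pf af]]] /=.
    by exists 0; rewrite !linear0; split=> // b _; exact: scaler0.
  exists (c *: e + f); rewrite !linearP pe pf; split=> // b ab.
  by rewrite scalerDr af // addr0 scalerA mulrC -scalerA ae // scaler0.
pose B := Submod sB.
have ises := subm_ses a.
have sr : submodule [set w : (X * lhom (subm a) Z)%type |
    exists e, p e = j w.1 /\ forall b, i (lap w.2 b) = (subinc a b : R) *: e].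
  split=> [|c u v [e [pe ae]] [f [pf af]]].
    exists 0; split; first by rewrite linear0; exact: (esym (linear0 j)).
    by move=> b; rewrite scaler0; exact: linear0.
  exists (c *: e + f); split; first by rewrite linearP pe pf -linearP.
  move=> b; rewrite -[lap _ b]/(c *: lap u.2 b + lap v.2 b) linearP ae af.
  by rewrite scalerDr !scalerA mulrC.
have jX w : forall c : R, a c -> c *: j w = 0 := subincP w.
have [ii ps ie] := ip.
have nB : noeth_mod B.
  apply: (noeth_mod_rel (rho := Submod sr)) (nZ ises (finfree1 R)).
  - move=> w; have [e eE] := ps (j w).
    have [b|f fE] := @factor_inj _ _ _ _ i (lcomp (rscale e) (subinc a)) ii.
      apply/ie; rewrite -[lcomp _ _ b]/((subinc a b : R) *: e) linearZZ eE.
      exact: jX (subincP b).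
    by exists (lam f), e; split=> // b; exact: fE.
  - move=> w f [e [pe ef]] [g gE]; exists (e - i (lap g (1 : R^o))); split.
      by rewrite linearB (_ : p (i _) = 0) ?subr0 //; apply/ie; eexists.
    move=> b /subinc_ex[c cE].
    have fE : lap f c = lap g (subinc a c) by rewrite -gE.
    have e1 : b *: e = i (lap g (b : R^o)) by rewrite -cE -ef fE.
    rewrite scalerBr e1 -linearZZ -linearZZ (_ : b *: (1 : R^o) = b) ?subrr //.
    exact: mulr1.
  - move=> f [g gE]; exists (i (lap g (1 : R^o))); split.
      by rewrite (_ : j _ = 0); [apply/ie; eexists | exact: linear0].
    move=> b.
    have fE : lap f b = lap g (subinc a b) by rewrite -gE.
    rewrite -[LHS]/(i (lap f b)) fE -linearZZ -linearZZ.
    by congr (i (lap g _)); apply: esym; exact: mulr1.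
have allB : forall w, B w.
  have sT : submodule [set: X] by [].
  have [//|s [_ s2]] := nB (Submod sT).
  apply: (nakayama unit (s := s)) => w; first exact: s2.
  have [b|w' [xw' aw']] := @extend_quo Z' a x (j w) Z'i.
    by rewrite mulrC => /reg; exact: jX.
  have [w'' w''E] := @subinc_ex _ _ (Submod sX) w' aw'.
  exists w'', 0; split; first exact: submod0.
  by apply: (@subinc_inj _ _ (Submod sX)); rewrite addr0 linearZZ w''E xw'.
move=> w aw; have [u uE] := @subinc_ex _ _ (Submod sX) w aw.
by have [e [pe ae]] := allB u; exists e; rewrite pe; split.
Qed.

Lemma injective_of_bar : injective_module Z.
Proof.
have all_good (a : submod R^o) : good a.
  apply: contrapT => bad.
  pose P (b : set R^o) := submodule b /\ ~ good b.
  have [||N [[sN Nbad] Nmax]] := @noeth_max R R^o P a Rn.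
  - by move=> N [].
  - by split; [exact: sset_sub | exact: bad].
  apply: Nbad.
  have [[r [Nxr Nr]]|none] := pselect (exists r : R, N (x * r) /\ ~ N r).
    apply: (good_colon (a := Submod sN) Nxr) => b Nb br.
    apply: contrapT => bbad; apply: Nr; apply: (Nmax b) => //.
    by split=> //; exact: sset_sub.
  apply: (good_regular (a := Submod sN)) => b Nxb; apply: contrapT => Nb.
  by apply: none; exists b.
have [ii ps ie] := ip; apply: baer_injective => a f.
have [e eE] := injective_baer Ii (lcomp i f).
have [b /subinc_ex[c <-]|e' [pe' ae']] := all_good a (p e).
  by rewrite -linearZZ -eE; apply/ie; eexists.
have [|z zE] := (ie (e - e')).1; first by rewrite linearB pe' subrr.
exists z => b; apply: ii; rewrite linearZZ zE scalerBr ae' ?subr0; last exact: subincP.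
exact: eE.
Qed.

End InjectiveOfBar.

Lemma ichain_of_barS n Z : noeth_ext1 Z -> ichain n.+2 Z -> ichain n.+1 (bar Z) -> ichain n.+1 Z.
Proof.
elim: n Z => [|n IHn] Z nZ cZ cbZ; have [kZ _] := ichain_ker_im xy hR hR' cZ;
  move: cZ => [I [Z' [i [p [ip Ii cZ']]]]].
  apply: injective_ichain1; apply: (injective_of_bar ip Ii (ichain1 cZ') nZ).
  exact: ichain1.
exists I, Z', i, p; split=> //; apply: IHn => //; first exact (noeth_ext1_cosyzygy Rn ip Ii nZ).
by apply: (ichain_cosyzygy (bar_ses xy ip kZ) _ cbZ); exact (bar_injective xy hR hR' Ii).
Qed.

Lemma ichain_of_bar m n T : finite_module T -> ichain n T -> ichain m (bar T) -> ichain m T.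
Proof.
case: m => [|m] Tf cT cbT; first exact: bar_eq0.
have nT := finite_noeth_ext1 Rn Tf.
have : ichain (n + m.+1) T by apply: ichain_le cT; exact: leq_addr.
elim: n {cT} => // n IHn; rewrite addSn addnS => cT; apply: IHn.
rewrite addnS; apply: ichain_of_barS => //.
by apply: ichain_le cbT; rewrite ltnS leq_addl.
Qed.

End LocalReduction.

(** * Comparison of the dimensions *)

Lemma proj_iso (A : comPzRingType) (F G : lmodType A) (f : {linear F -> G}) :
  injective f -> (forall v, exists u, f u = v) -> projective F -> projective G.
Proof.
by move=> fi fs; have [g [_ fg]] := lin_inverse fi fs; exact: proj_retract fg.
Qed.

Section DimensionsOverA.
Variables (A : comPzRingType) (B : lmodType A).
Hypotheses (An : noetherian A) (Bf : finite_module B).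
Hypothesis Bh : bijective (@homothety A B).

Lemma P_pd_le n N : (P_pd B N <= level n)%E <-> chain (@projective A) n (lhom B N).
Proof.
apply: (relative_pd_le An Bf Bh) => //; first exact: projective_isflat.
  exact: proj_iso.
exact: chain_proper_chain_proj.
Qed.

Lemma F_pd_le n N : (F_pd B N <= level n)%E <-> chain (@flat A) n (lhom B N).
Proof.
apply: (relative_pd_le An Bf Bh) => //; first exact: projective_isflat.
  exact: flat_iso.
exact: chain_proper_chain_flat.
Qed.

End DimensionsOverA.

Section MainReduction.
Variables (R : comPzRingType) (C : lmodType R) (x y : R).
Hypotheses (Rn : noetherian R) (Csd : semidualizing C).
Hypotheses (xyR : exact_zero_divisors R^o x y) (xyC : exact_zero_divisors C x y).
Local Notation S := (quo_ring x).
Local Notation bar := (quo_mod x).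
Implicit Types M N : lmodType R.

Lemma exact_ker_im M : exact_zero_divisors M x y -> ker_im x y M /\ ker_im y x M.
Proof. by case=> _ _ /exactP h /exactP h'; split=> m; [move/h | move/h']. Qed.

Let xy : x * y = 0.
Proof.
case: xyR => _ _ /exactP h _; rewrite mulrC -[x]mulr1.
by apply/(h (x * 1 : R^o)); exists (1 : R^o).
Qed.

Let hR : ker_im x y R^o. Proof. by have [] := exact_ker_im xyR. Qed.
Let hR' : ker_im y x R^o. Proof. by have [] := exact_ker_im xyR. Qed.
Let hC : ker_im x y C. Proof. by have [] := exact_ker_im xyC. Qed.
Let hC' : ker_im y x C. Proof. by have [] := exact_ker_im xyC. Qed.
Let Cf : finite_module C. Proof. by case: Csd. Qed.
Let Ch : bijective (@homothety R C). Proof. by case: Csd. Qed.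
Let Cext n : ext_vanish n C C. Proof. by case: Csd => _ _ /Ext_pos_ext_vanish. Qed.
Let Sn : noetherian S := bar_noetherian (x := x) Rn.
Let bCf : finite_module (bar C) := bar_finite x Cf.
Let bCh : bijective (@homothety S (bar C)) := bar_homothety xy hR hR' hC hC' Ch Cext.
Let bCext n : ext_vanish n (bar C) (bar C) := bar_ext_vanishing xy hR hR' hC hC' Ch Cext n.

Lemma bar_iso (U V : lmodType R) (f : {linear U -> V}) :
  injective f -> (forall v, exists u, f u = v) ->
  injective (bmap x f) /\ forall q, exists p, bmap x f p = q.
Proof.
move=> fi fs; split.
  apply/lin_inj0 => q; have [u <-] := bpi_surj q; rewrite bmapE => /bpi_eq0[v vE].
  have [w wE] := fs v; apply/bpi_eq0; exists w; apply: fi.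
  by rewrite linearZZ wE.
move=> q; have [v <-] := bpi_surj q; have [u <-] := fs v.
by exists (bpi x u); rewrite bmapE.
Qed.

Lemma bar_hom n M : chain (@flat R) n (lhom C M) ->
  exists g : {linear bar (lhom C M) -> lhom (bar C) (bar M)},
    injective g /\ forall h, exists q, g q = h.
Proof.
move=> cN; have cbN := chain_bar xy hR hR' (fun F h => h) (bar_flat xy hR hR') cN.
have [ei es] := chain_flat_eval Rn Cf Ch Cext cN; have [bei bes] := bar_iso ei es.
have [t [ti ts]] := bar_tens x C (lhom C M); have [t' [t't tt']] := lin_inverse ti ts.
have [ui us _] := chain_flat_unit Sn bCf bCh bCext cbN.
pose f := lcomp (bmap x (evalt C M)) t'.
exists (lcomp (lpost (bar C) f) (unit_tens (bar C) (bar (lhom C M)))).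
have fi : injective f by move=> u v /bei e; rewrite -[u]tt' -[v]tt' e.
split.
  apply/lin_inj0 => q e; apply: ui; rewrite linear0; apply: lamP => c; apply: fi.
  by rewrite [RHS]linear0; exact: (congr1 (fun l => lap l c) e).
move=> h; have fs v : exists u, f u = v.
  by have [q <-] := bes v; exists (t q); rewrite /f lcompE t't.
have [f' [_ ff']] := lin_inverse fi fs.
have [q qE] := us (lam (lcomp f' (lap h))); exists q; apply: lamP => c.
by rewrite -[LHS]/(f (lap (unit_tens _ _ q) c)) qE -[LHS]/(f (f' (lap h c))) ff'.
Qed.

Lemma bar_P_pd M n : (P_pd C M <= level n)%E -> (P_pd (bar C) (bar M) <= level n)%E.
Proof.
move=> /(P_pd_le Rn Cf Ch) cN; apply/(P_pd_le Sn bCf bCh).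
have [g [gi gs]] := bar_hom (chain_sub (@projective_isflat R) cN).
apply: chain_iso gi gs _.
exact (chain_bar xy hR hR' (@projective_isflat R) (@bar_projective R x) cN).
Qed.

Lemma bar_F_pd M n : (F_pd C M <= level n)%E -> (F_pd (bar C) (bar M) <= level n)%E.
Proof.
move=> /(F_pd_le Rn Cf Ch) cN; apply/(F_pd_le Sn bCf bCh).
have [g [gi gs]] := bar_hom cN; apply: chain_iso gi gs _.
exact (chain_bar xy hR hR' (fun F h => h) (bar_flat xy hR hR') cN).
Qed.

Lemma bar_I_id M n : (I_id C M <= level n)%E -> (I_id (bar C) (bar M) <= level n)%E.
Proof.
move=> /(I_id_le Rn Cf Ch) cT; apply/(I_id_le Sn bCf bCh).
have [t [ti ts]] := bar_tens x C M; have [t' [t't tt']] := lin_inverse ti ts.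
apply: (ichain_iso (h := t')); last exact: (ichain_bar xy hR hR' cT).
  exact: can_inj tt'.
by move=> q; exists (t q).
Qed.

Lemma finite_tens (U V : lmodType R) :
  finite_module U -> finite_module V -> finite_module (tens U V).
Proof.
move=> /fg_cover[P [p [Pf ps]]] Vf; apply: (finite_surj Rn (tmap_surj ps)).
have f1 : finite_module (tens R^o V).
  apply: (finite_surj Rn (p := purer V (1 : R^o))) Vf => t.
  by have [w ->] := tens_ring t; exists w.
elim: Pf => // P' _ IH.
have nP := noeth_ext (prod_ses _ _) (finite_noeth Rn f1) (finite_noeth Rn IH).
apply: (finite_surj Rn (p := lcase (tmap (linl R^o P') (lid V)) (tmap (linr R^o P') (lid V)))).
  by move=> t; eexists (_, _); exact: esym (tens_prod t).
exact: noeth_finite.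
Qed.

Section Local.
Variable M : lmodType R.
Hypotheses (Rl : local_ring R) (Mf : finite_module M).

Let unit (a : R) : exists u, u * (1 - x * a) = 1.
Proof. by apply: local_unit => //; case: xyR. Qed.

Lemma local_P_pd m n : (P_pd C M <= level n)%E ->
  (P_pd (bar C) (bar M) <= level m)%E -> (P_pd C M <= level m)%E.
Proof.
move=> /(P_pd_le Rn Cf Ch) cN /(P_pd_le Sn bCf bCh) cbN; apply/(P_pd_le Rn Cf Ch).
have [g [gi gs]] := bar_hom (chain_sub (@projective_isflat R) cN).
have [g' [g'g gg']] := lin_inverse gi gs.
apply: (chain_of_bar Rn unit xy hR hR' _ cN); first exact: finite_lhom.
by apply: (chain_iso (h := g')) cbN; [exact: can_inj gg' | move=> q; exists (g q)].
Qed.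

Lemma local_F_pd m n : (F_pd C M <= level n)%E ->
  (F_pd (bar C) (bar M) <= level m)%E -> (F_pd C M <= level m)%E.
Proof.
move=> /(F_pd_le Rn Cf Ch) cN /(F_pd_le Sn bCf bCh) cbN; apply/(F_pd_le Rn Cf Ch).
have [g [gi gs]] := bar_hom cN; have [g' [g'g gg']] := lin_inverse gi gs.
have Nf : finite_module (lhom C M) by exact: finite_lhom.
apply: (chain_sub (@projective_isflat R)).
apply: (chain_of_bar Rn unit xy hR hR' Nf (finite_chain_flat Rn Nf cN)).
apply: (finite_chain_flat Sn (bar_finite x Nf)).
by apply: (chain_iso (h := g')) cbN; [exact: can_inj gg' | move=> q; exists (g q)].
Qed.

Lemma local_I_id m n : (I_id C M <= level n)%E ->
  (I_id (bar C) (bar M) <= level m)%E -> (I_id C M <= level m)%E.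
Proof.
move=> /(I_id_le Rn Cf Ch) cT /(I_id_le Sn bCf bCh) cbT; apply/(I_id_le Rn Cf Ch).
have [t [ti ts]] := bar_tens x C M.
apply: (ichain_of_bar Rn unit xy hR hR' _ cT); first exact: finite_tens.
exact: (ichain_iso ti ts cbT).
Qed.

End Local.
End MainReduction.

Lemma dim_eq (s t : \bar int) : (exists n, t = level n) -> (exists n, s = level n) ->
  (forall n, (t <= level n)%E -> (s <= level n)%E) ->
  (forall m, (s <= level m)%E -> (t <= level m)%E) -> s = t.
Proof.
move=> tl sl st ts; apply/eqP; rewrite eq_le.
by rewrite (level_monotone tl st) (level_monotone sl ts).
Qed.

Theorem proposition5p4 (R : comPzRingType) (C : lmodType R) (x y : R)
    (M : lmodType R)
    (R_noetherian : noetherian R)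
    (C_semidualizing : semidualizing C)
    (xy_R : exact_zero_divisors R^o x y)
    (xy_C : exact_zero_divisors C x y)
    (xM_neq0 : range ( *:%R x : M -> M) <> [set 0])
    (xM_neqM : range ( *:%R x : M -> M) <> [set: M]) :
  let Cbar : lmodType (quo_ring x) := quo_mod x C in
  let Mbar : lmodType (quo_ring x) := quo_mod x M in
  [/\ (P_pd C M < +oo)%E -> (P_pd Cbar Mbar <= P_pd C M)%E,
      (F_pd C M < +oo)%E -> (F_pd Cbar Mbar <= F_pd C M)%E,
      finite_module M ->
        (I_id C M < +oo)%E -> (I_id Cbar Mbar <= I_id C M)%E &
      local_ring R -> finite_module M ->
        [/\ (P_pd C M < +oo)%E -> P_pd Cbar Mbar = P_pd C M,
            (F_pd C M < +oo)%E -> F_pd Cbar Mbar = F_pd C M &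
            (I_id C M < +oo)%E -> I_id Cbar Mbar = I_id C M]].
Proof.
move=> Cbar Mbar.
have hP := bar_P_pd R_noetherian C_semidualizing xy_R xy_C (M := M).
have hF := bar_F_pd R_noetherian C_semidualizing xy_R xy_C (M := M).
have hI := bar_I_id R_noetherian C_semidualizing xy_R xy_C (M := M).
have lt_level (s t : \bar int) : (exists n, t = level n) -> (s <= t)%E -> (s < +oo)%E.
  by move=> [n ->] st; exact: le_lt_trans st (level_ltoo n).
split.
- by move=> /relative_pd_finite fin; exact: level_monotone.
- by move=> /relative_pd_finite fin; exact: level_monotone.
- by move=> _ /I_id_finite fin; exact: level_monotone.
move=> Rl Mf; split.
- move=> /relative_pd_finite fin; have [n nE] := fin.
  have fin' := relative_pd_finite (lt_level _ _ fin (level_monotone fin hP)).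
  apply: dim_eq => // m; apply: (local_P_pd R_noetherian C_semidualizing xy_R xy_C Rl Mf (n := n)).
  by rewrite -nE.
- move=> /relative_pd_finite fin; have [n nE] := fin.
  have fin' := relative_pd_finite (lt_level _ _ fin (level_monotone fin hF)).
  apply: dim_eq => // m; apply: (local_F_pd R_noetherian C_semidualizing xy_R xy_C Rl Mf (n := n)).
  by rewrite -nE.
- move=> /I_id_finite fin; have [n nE] := fin.
  have fin' := I_id_finite (lt_level _ _ fin (level_monotone fin hI)).
  apply: dim_eq => // m; apply: (local_I_id R_noetherian C_semidualizing xy_R xy_C Rl Mf (n := n)).
  by rewrite -nE.
Qed.
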